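(* There is a constant $\alpha>0$ such that, for every fixed real $\gamma\in(0,1)$, there are constants $B,C>0$ such that the following holds. If the edge-probability $p=p(n)$ satisfies $n^{-\alpha}\le p\le 1-\gamma$, then with high probability there exists a clique partition $\mathcal P$ of the edges of $G_{n,p}$ satisfying $$\max_{K\in\mathcal P}|K|\le\log_{1/p}n,\qquad |\mathcal P|\le B\,\frac{n^2p}{(\log_{1/p}n)^2}\qquad\text{and}\qquad \Delta(\mathcal P)\le\chi'(\mathcal P)\le C\,\frac{np}{\log_{1/p}n}.$$
   Context: The binomial random graph $G_{n,p}$ has vertex set $[n]$, and each of the $\binom n2$ possible edges is included independently with probability $p$. ''With high probability'' means with probability tending to $1$ as $n\to\infty$, and $\log_{1/p}n=\log n/\log(1/p)$. A clique partition $\mathcal P$ of the edges of a graph $G$ is a collection of cliques of $G$ such that every edge of $G$ is contained in exactly one of them. For a clique $K$, $|K|$ is its number of vertices. The collection $\mathcal P$ is viewed as a hypergraph with vertex-set $V(G)$ whose edges are the vertex-sets of the cliques in $\mathcal P$. Then $\Delta(\mathcal P)$ is its maximum degree (the maximum over vertices $v$ of the number of cliques of $\mathcal P$ containing $v$), and $\chi'(\mathcal P)$ is its chromatic index (the smallest number of colors in a coloring of the cliques of $\mathcal P$ in which any two cliques sharing a vertex get different colors). *)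

(* Defs.v *)
From HB Require Import structures.
From mathcomp Require Import all_boot all_order all_algebra.
From mathcomp Require Import all_classical all_reals all_analysis.

Set Implicit Arguments.
Unset Strict Implicit.
Unset Printing Implicit Defensive.

Import Order.TTheory GRing.Theory Num.Theory.
Import numFieldNormedType.Exports.

Local Open Scope ring_scope.

(* A simple graph on a finite type T is given by its edge set, a set of
   two-element subsets of T; a hypergraph on T is any P : {set {set T}}. *)
Definition vertex_pairs (T : finType) : {set {set T}} :=
  [set e : {set T} | #|e| == 2%N].

Definition clique (T : finType) (E : {set {set T}}) (K : {set T}) : bool :=
  [forall u in K, forall v in K, (u != v) ==> ([set u; v] \in E)].

Definition clique_partition (T : finType) (E P : {set {set T}}) : bool :=
  [forall K in P, clique E K] &&
  [forall e in E, #|[set K in P | e \subset K]| == 1%N].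

Definition max_degree (T : finType) (P : {set {set T}}) : nat :=
  \max_(v : T) #|[set K in P | v \in K]|.

(* Colourings are defined on the edges of P only, so that the empty hypergraph
   is colourable with no colours. *)
Definition edge_colorable (T : finType) (P : {set {set T}}) (k : nat) : bool :=
  [exists f : {ffun {K : {set T} | K \in P} -> 'I_k},
    forall K : {K : {set T} | K \in P}, forall L : {K : {set T} | K \in P},
      (K != L) && ~~ [disjoint val K & val L] ==> (f K != f L)].

Lemma edge_colorable_ex (T : finType) (P : {set {set T}}) :
  exists k, edge_colorable P k.
Proof.
exists #|{: {K : {set T} | K \in P}}|.
apply/existsP; exists [ffun K => enum_rank K].
apply/forallP => K; apply/forallP => L; apply/implyP => /andP[KL _].
by rewrite !ffunE (inj_eq enum_rank_inj).
Qed.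

Definition chromatic_index (T : finType) (P : {set {set T}}) : nat :=
  ex_minn (edge_colorable_ex P).

(* The law of the binomial random graph on 'I_n, meaningful for 0 <= p <= 1:
   gnp_prob p A is the probability that its edge set satisfies A. *)
Definition gnp_weight (R : realType) (n : nat) (p : R)
    (E : {set {set 'I_n}}) : R :=
  \prod_(e in vertex_pairs 'I_n) (if e \in E then p else 1 - p).

Definition gnp_prob (R : realType) (n : nat) (p : R)
    (A : pred {set {set 'I_n}}) : R :=
  \sum_(E : {set {set 'I_n}} | (E \subset vertex_pairs 'I_n) && A E)
    gnp_weight p E.

Definition log_base (R : realType) (b x : R) : R := ln x / ln b.

(* Main.v *)
Require Import Defs.
From HB Require Import structures.
From mathcomp Require Import all_boot all_order all_algebra.
From mathcomp Require Import all_classical all_reals all_analysis.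
From mathcomp Require Import ring lra zify fintype finset.

(** Write [n] for the number of vertices, [p] for the edge-probability and [L] for [ln n].
    Randomness is used only once, to see that with high probability the graph is
    typical: every set of at most [k] vertices, [k] a small multiple of
    [L / (1 + ln p^-1)], has [(1 + o(1)) * n * p ^ a] common neighbours, [a] being its size
    ([gnp_typical]).  The rest is a statement about an arbitrary typical graph.

    Such a graph is decomposed in about [L / 200] phases ([phase], [scheduled_phase]).  A phase
    takes a typical graph of density [d], packs into it edge-disjoint cliques of size
    [k ~ L / (1 + ln d^-1)], properly coloured with about [n * d / k] colours, and leaves
    a typical graph of density [d / e], up to a few dumped edges.  As [d] decreases
    geometrically while [k] decreases slowly, the total numbers of colours, of order
    [n * p / k], and of cliques, of order [n ^ 2 * p / k ^ 2], are those of the first phase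
    up to constant factors.  The edges that are left or dumped have so small degrees
    that they can be taken as cliques of size 2 and coloured greedily.

    The colours of a phase are handled as additional vertices: a colour is joined to the vertices
    at which it is still available, and a coloured clique is a clique with [k] vertices and one
    colour.  Packing edge-disjoint coloured cliques then gives a proper
    colouring at once, because two cliques with the same colour and a common vertex
    would share an edge to that colour.

    In a typical graph the coloured cliques through a given edge are counted by
    multiplying sizes of common neighbourhoods ([extensions_bounds]), so that a random coloured
    clique is almost equally likely to contain any given edge between vertices, and not more
    likely to contain a given edge to a colour.  Removing from time to time a single edge makes
    all these probabilities exactly equal to some tiny [rho] ([uniform_removal]); this dumps
    only a small proportion of the edges between vertices, and for edges to colours it
    costs nothing.  Under such a removal every common neighbourhood
    decays at the rate that its size predicts, whatever the current errors are, so that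
    errors do not amplify.  Instead of running the random process, one follows a
    potential, the sum of exponential moments of all the deviations and of the numbers of dumped
    edges at the vertices: its expectation does not increase ([expect_expR_le],
    [expect_expRN_le]), hence some choice of the removed set does not increase it, and the potential being bounded keeps all the
    common neighbourhoods close to their nominal sizes ([coloured_phase]). *)

Set Implicit Arguments.
Unset Strict Implicit.
Unset Printing Implicit Defensive.

Import Order.TTheory GRing.Theory Num.Theory.
Import numFieldNormedType.Exports.

Local Open Scope ring_scope.

(** * Exponential inequalities *)

Section RealBounds.
Variable R : realType.
Implicit Types x y : R.

Lemma expRN_le_quadratic x : 0 <= x -> expR (- x) <= 1 - x + x ^+ 2.
Proof.
move=> x0; rewrite expRN invf_ple ?posrE ?expR_gt0//; last by nra.
apply: le_trans (expR_ge1Dx x); rewrite invf_ple ?posrE; [|nra|nra].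
rewrite -[leLHS]mul1r ler_pdivrMr; last by nra.
by nra.
Qed.

Lemma expR_le_quadratic x : 0 <= x -> x <= 1 / 2 -> expR x <= 1 + x + 2 * x ^+ 2.
Proof.
move=> x0 x1; rewrite -[x in expR x]opprK expRN.
rewrite invf_ple ?posrE ?expR_gt0//; last by nra.
apply: le_trans (expR_ge1Dx (- x)).
rewrite -[leLHS]mul1r ler_pdivrMr; last by nra.
by nra.
Qed.

Lemma onem_ge_expR x : 0 <= x -> x <= 1 / 2 -> expR (- (x + 2 * x ^+ 2)) <= 1 - x.
Proof.
move=> x0 x1; rewrite expRN invf_ple ?posrE ?expR_gt0//; last by nra.
apply: le_trans (expR_ge1Dx _).
rewrite -[leLHS]mul1r ler_pdivrMr; last by nra.
by nra.
Qed.

Lemma onem_le_expR x : 1 - x <= expR (- x).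
Proof. exact: (expR_ge1Dx (- x)). Qed.

Lemma onep_ge_expR x : 0 <= x -> expR (x - x ^+ 2) <= 1 + x.
Proof.
move=> x0; rewrite -[x - _]opprK expRN invf_ple ?posrE ?expR_gt0//; last by nra.
apply: le_trans (expR_ge1Dx _).
rewrite -[leLHS]mul1r ler_pdivrMr; last by nra.
by nra.
Qed.

Lemma bernoulli_ineq x (m : nat) : 0 <= x -> x <= 1 -> 1 - m%:R * x <= (1 - x) ^+ m.
Proof.
move=> x0 x1; elim: m => [|m IH]; first by rewrite expr0 mul0r subr0.
rewrite exprS -natr1.
have : (1 - m%:R * x) * (1 - x) <= (1 - x) ^+ m * (1 - x) by rewrite ler_wpM2r// subr_ge0.
have : 0 <= m%:R :> R by []. 
move: (m%:R) ((1 - x) ^+ m) => u v; nra.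
Qed.

End RealBounds.

(** * Common neighbourhoods and the removal of random pairs *)

Section CommonNeighbours.
Variable T : finType.
Implicit Types (S : {set {set T}}) (A B U Q : {set T}).

Definition pairs_in Q : {set {set T}} := [set e in vertex_pairs T | e \subset Q].

(** Since [[set z; z]] is not a pair, a vertex of [A] is never one of its common
    neighbours when [S] consists of pairs. *)
Definition common_nbrs S A U : {set T} :=
  [set z in U | [forall a in A, [set z; a] \in S]].

Lemma in_vertex_pairs2 (x y : T) : ([set x; y] \in vertex_pairs T) = (x != y).
Proof. by rewrite inE cards2; case: (x != y). Qed.

Lemma vertex_pairsP (e : {set T}) :
  reflect (exists x y, x != y /\ e = [set x; y]) (e \in vertex_pairs T).
Proof.
rewrite inE; exact: cards2P.
Qed.

Lemma pairs_in_set2 Q (x y : T) :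
  ([set x; y] \in pairs_in Q) = [&& x != y, x \in Q & y \in Q].
Proof. by rewrite inE in_vertex_pairs2 subUset !sub1set. Qed.

Lemma pairs_in_pair (e : {set T}) : e \in vertex_pairs T -> pairs_in e = [set e].
Proof.
move=> e2; apply/setP => f; rewrite !inE in e2 *.
apply/andP/eqP => [[f2 fe]|->//].
by apply/eqP; rewrite eqEcard fe (eqP e2) (eqP f2).
Qed.

Lemma pairs_in_set0 : pairs_in set0 = set0.
Proof.
apply/setP => e; rewrite !inE subset0; apply/negP => /andP[/eqP + /eqP e0].
by rewrite e0 cards0.
Qed.

Lemma cliqueP S Q :
  reflect {in Q &, forall u v, u != v -> [set u; v] \in S} (clique S Q).
Proof.
apply: (iffP forallP) => [h u v uQ vQ uv|h u].
  by move: (h u); rewrite uQ => /forallP/(_ v); rewrite vQ uv.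
by apply/implyP => uQ; apply/forallP => v; apply/implyP => vQ; apply/implyP; apply: h.
Qed.

Lemma clique_pairs_in S Q : clique S Q -> pairs_in Q \subset S.
Proof.
move=> /cliqueP QS; apply/subsetP => e; rewrite inE => /andP[/vertex_pairsP[x [y [xy ->]]]].
by rewrite subUset !sub1set => /andP[xQ yQ]; apply: QS.
Qed.

Lemma clique_sub S Q Q' : Q' \subset Q -> clique S Q -> clique S Q'.
Proof. by move=> /subsetP s /cliqueP h; apply/cliqueP => u v /s uQ /s vQ; apply: h. Qed.

Lemma clique_subE S S' Q : S \subset S' -> clique S Q -> clique S' Q.
Proof.
by move=> /subsetP s /cliqueP h; apply/cliqueP => u v uQ vQ uv; apply/s/h.
Qed.

Lemma common_nbrsP S A U z :
  reflect (z \in U /\ {in A, forall a, [set z; a] \in S}) (z \in common_nbrs S A U).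
Proof.
rewrite inE; apply: (iffP andP) => [[-> /forallP h]|[-> h]]; split => //.
  by move=> a aA; move: (h a); rewrite aA.
by apply/forallP => a; apply/implyP; apply: h.
Qed.

Lemma common_nbrs_notin S A U z :
  S \subset vertex_pairs T -> z \in common_nbrs S A U -> z \notin A.
Proof.
move=> /subsetP SV /common_nbrsP[_ h]; apply/negP => /h/SV.
by rewrite in_vertex_pairs2 eqxx.
Qed.

Lemma clique_setU1 S B z :
  clique S B -> {in B, forall a, [set z; a] \in S} -> clique S (z |: B).
Proof.
move=> /cliqueP BS zB; apply/cliqueP => u v; rewrite !in_setU1.
move=> /orP[/eqP ->|uB] /orP[/eqP->|vB]; rewrite ?eqxx// => uv; first exact: zB.
- by rewrite setUC; apply: zB.
- exact: BS.
Qed.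

Lemma card_edges_at S (V : {set T}) v : S \subset vertex_pairs T ->
  (#|[set Q in S | (Q \subset V) && (v \in Q)]| <= (v \in V) * #|common_nbrs S [set v] V|)%N.
Proof.
move=> SV; have [vV|vV] := boolP (v \in V); last first.
  rewrite mul0n leqn0 cards_eq0 -subset0; apply/subsetP => Q; rewrite !inE.
  by move=> /and3P[_ /subsetP QV /QV vV']; rewrite vV' in vV.
rewrite mul1n; apply: leq_trans (leq_imset_card (fun z => [set z; v]) _).
apply/subset_leq_card/subsetP => Q; rewrite inE => /and3P[QS QV vQ].
have /vertex_pairsP[x [y [xy Qxy]]] := subsetP SV Q QS.
move: QV; rewrite Qxy subUset !sub1set => /andP[xV yV].
move: vQ; rewrite Qxy !inE => /orP[] /eqP vE.
  apply/imsetP; exists y; last by rewrite vE setUC.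
  by apply/common_nbrsP; split => // a; rewrite inE => /eqP ->; rewrite vE setUC -Qxy.
apply/imsetP; exists x; last by rewrite vE.
by apply/common_nbrsP; split => // a; rewrite inE => /eqP ->; rewrite vE -Qxy.
Qed.

End CommonNeighbours.

(** The random set [Q] has law [q], and its pairs are removed from [S].  Up to
    [kappa], two edges at a common vertex are lost at different steps. *)
Section OneStep.
Variables (R : realType) (T : finType) (S : {set {set T}}).
Hypothesis SV : S \subset vertex_pairs T.
Variables (q : {set T} -> R) (b : nat) (rho kappa : R).
Hypothesis q_ge0 : forall Q, 0 <= q Q.
Hypothesis kappa_ge0 : 0 <= kappa.
Hypothesis q_sum1 : \sum_Q q Q = 1.
Hypothesis q_supp : forall Q : {set T}, (b < #|Q|)%N -> q Q = 0.
Hypothesis q_marg : forall e, e \in S -> \sum_(Q : {set T} | e \subset Q) q Q = rho.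
Hypothesis q_trip : forall z a a', [set z; a] \in S -> [set z; a'] \in S -> a != a' ->
  \sum_(Q : {set T} | [set z; a; a'] \subset Q) q Q <= kappa * rho.
Variables (A U : {set T}).

Let X := common_nbrs S A U.
Definition lost_nbrs (Q : {set T}) : {set T} :=
  [set z in common_nbrs S A U | (z \in Q) && ~~ [disjoint A & Q]].

Lemma common_nbrs_setD (Q : {set T}) :
  common_nbrs (S :\: pairs_in Q) A U = X :\: lost_nbrs Q.
Proof.
apply/setP => z; rewrite in_setD; apply/common_nbrsP/andP.
  move=> [zU h]; split; last first.
    by apply/common_nbrsP; split=> // a /h; rewrite in_setD => /andP[].
  rewrite inE !negb_and negbK -implybE; apply/implyP => _.
  rewrite -implybE; apply/implyP => zQ.
  rewrite disjoint_subset; apply/subsetP => a aA; rewrite inE; apply/negP => aQ.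
  have := h a aA; rewrite in_setD pairs_in_set2 zQ aQ !andbT negbK => /andP[/eqP ->] /(subsetP SV).
  by rewrite in_vertex_pairs2 eqxx.
move=> [nh zX]; have /common_nbrsP[zU h] := zX; split=> // a aA.
rewrite in_setD h// andbT; apply: contra nh; rewrite pairs_in_set2 => /and3P[_ zQ aQ].
by rewrite inE zX zQ; apply/negP => /disjointFr/(_ aA); rewrite aQ.
Qed.

Lemma card_common_nbrs_setD (Q : {set T}) :
  #|common_nbrs (S :\: pairs_in Q) A U|%:R = #|X|%:R - #|lost_nbrs Q|%:R :> R.
Proof.
rewrite common_nbrs_setD -natrB; last by apply/subset_leq_card/subsetP => z; rewrite inE => /andP[].
rewrite cardsD; congr (_ - _)%:R; apply: eq_card => z; rewrite !inE.
by case: (z \in U) => //=; case: [forall a in A, _].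
Qed.

Lemma lost_nbrs_le_card (Q : {set T}) : (#|lost_nbrs Q| <= #|Q|)%N.
Proof. by apply/subset_leq_card/subsetP => z; rewrite [z \in lost_nbrs Q]in_set => /and3P[]. Qed.

Lemma lost_nbrsE (Q : {set T}) :
  #|lost_nbrs Q|%:R = \sum_(z in X) ((z \in Q) && ~~ [disjoint A & Q])%:R :> R.
Proof.
rewrite -sum1_card natr_sum [LHS]big_mkcond [RHS]big_mkcond; apply: eq_bigr => z _.
by rewrite [z \in lost_nbrs Q]in_set -/X; case: (z \in X) => //=; case: (_ && _).
Qed.

Lemma sum_mem (Q : {set T}) : (\sum_(a in A) (a \in Q))%N = #|A :&: Q|.
Proof.
rewrite -sum1_card [LHS]big_mkcond [RHS]big_mkcond; apply: eq_bigr => a _.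
by rewrite inE; case: (a \in A); case: (a \in Q).
Qed.

Lemma expect_lost_nbrs_le : \sum_Q q Q * #|lost_nbrs Q|%:R <= #|X|%:R * (#|A|%:R * rho).
Proof.
have -> : #|X|%:R * (#|A|%:R * rho) =
    \sum_(z in X) \sum_(a in A) \sum_(Q : {set T} | [set z; a] \subset Q) q Q.
  rewrite -sum1_card natr_sum mulr_suml; apply: eq_bigr => z zX.
  rewrite -sum1_card natr_sum mulr_suml mul1r; apply: eq_bigr => a aA.
  by rewrite mul1r q_marg//; move/common_nbrsP : zX => [_]; apply.
under [leRHS]eq_bigr => z _.
  under eq_bigr => a _ do rewrite big_mkcond.
  rewrite exchange_big/=; over.
rewrite exchange_big/=; apply: ler_sum => Q _.
rewrite lost_nbrsE mulr_sumr; apply: ler_sum => z zX.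
case: (boolP (z \in Q)) => /= zQ; last first.
  by rewrite mulr0; apply: sumr_ge0 => a _; case: ifP.
case: (boolP [disjoint A & Q]) => /= [_|].
  by rewrite mulr0; apply: sumr_ge0 => a _; case: ifP.
move/pred0Pn => [a /= /andP[aA aQ]]; rewrite mulr1 (bigD1 a)//=.
rewrite subUset !sub1set zQ aQ/= lerDl; apply: sumr_ge0 => *; by case: ifP.
Qed.

(** The second Bonferroni inequality, over the edges from a common neighbour to [A]. *)
Lemma expect_lost_nbrs_ge :
  #|X|%:R * (#|A|%:R * rho) * (1 - #|A|%:R * kappa) <= \sum_Q q Q * #|lost_nbrs Q|%:R.
Proof.
pose pairs := \sum_(z in X) \sum_(a in A) \sum_(a' in A | a' != a)
   \sum_(Q : {set T} | [set z; a; a'] \subset Q) q Q.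
have pairs_le : pairs <= #|X|%:R * (#|A|%:R * (#|A|%:R * (kappa * rho))).
  rewrite /pairs -[#|X|]sum1_card natr_sum mulr_suml; apply: ler_sum => z zX; rewrite mul1r.
  rewrite -[X in X%:R * (_ * _)]sum1_card natr_sum mulr_suml; apply: ler_sum => a aA; rewrite mul1r.
  have rho0 : 0 <= rho.
    rewrite -(q_marg (e := [set z; a])); first exact: sumr_ge0.
    by move/common_nbrsP : zX => [_]; apply.
  rewrite -[X in X%:R * _]sum1_card natr_sum mulr_suml big_mkcondr/=; apply: ler_sum => a' a'A.
  rewrite mul1r; case: ifPn => a'a; last exact: mulr_ge0.
  by have /common_nbrsP[_ h] := zX; apply: q_trip; rewrite ?h// eq_sym.
(* A vertex losing [m] edges counts for at least [m - m * (m - 1)]. *)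
apply: (@le_trans _ _ (#|X|%:R * (#|A|%:R * rho) - pairs)).
  move: pairs_le; move: (#|X|%:R) (#|A|%:R) pairs => x y w; nra.
have -> : #|X|%:R * (#|A|%:R * rho) =
    \sum_(z in X) \sum_(a in A) \sum_(Q : {set T} | [set z; a] \subset Q) q Q.
  rewrite -sum1_card natr_sum mulr_suml; apply: eq_bigr => z zX.
  rewrite -sum1_card natr_sum mulr_suml mul1r; apply: eq_bigr => a aA.
  by rewrite mul1r q_marg//; move/common_nbrsP : zX => [_]; apply.
rewrite lerBlDr.
have swap2 : \sum_(z in X) \sum_(a in A) \sum_(Q : {set T} | [set z; a] \subset Q) q Q =
    \sum_Q q Q * (\sum_(z in X) (z \in Q)%:R * #|A :&: Q|%:R).
  under eq_bigr => z _.
    under eq_bigr => a _ do rewrite big_mkcond.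
    rewrite exchange_big/=; over.
  rewrite exchange_big/=; apply: eq_bigr => Q _; rewrite mulr_sumr; apply: eq_bigr => z _.
  rewrite -sum_mem natr_sum 2!mulr_sumr; apply: eq_bigr => a _.
  by rewrite subUset !sub1set; case: (z \in Q); case: (a \in Q);
    rewrite /= ?mulr0 ?mul0r ?mul1r ?mulr1 ?mulr0.
have swap3 : pairs = \sum_Q q Q * (\sum_(z in X) (z \in Q)%:R *
    (#|A :&: Q|%:R * (#|A :&: Q|%:R - 1))).
  transitivity (\sum_(z in X) \sum_(Q : {set T}) \sum_(a in A) \sum_(a' in A | a' != a)
      if [set z; a; a'] \subset Q then q Q else 0).
    apply: eq_bigr => z _; rewrite [RHS]exchange_big/=; apply: eq_bigr => a _.
    rewrite [RHS]exchange_big/=; apply: eq_bigr => a' _.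
    by rewrite big_mkcond.
  rewrite exchange_big/=; apply: eq_bigr => Q _; rewrite mulr_sumr; apply: eq_bigr => z _.
  have [zQ|zQ] := boolP (z \in Q); last first.
    rewrite mul0r mulr0 big1// => a _; rewrite big1// => a' _.
    by rewrite !subUset !sub1set (negbTE zQ).
  rewrite mul1r -[X in X%:R * _]sum_mem natr_sum mulr_suml mulr_sumr; apply: eq_bigr => a aA.
  have [aQ|aQ] := boolP (a \in Q); last first.
    rewrite mul0r mulr0 big1// => a' _.
    by rewrite !subUset !sub1set (negbTE aQ) andbF.
  rewrite mul1r -sum_mem [in RHS](bigD1 a)//= aQ natrD addrAC subrr add0r natr_sum mulr_sumr.
  apply: eq_bigr => a' _.
  by rewrite !subUset !sub1set zQ aQ/=; case: (a' \in Q); rewrite ?mulr1 ?mulr0.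
rewrite swap2 swap3 -big_split/=; apply: ler_sum => Q _.
rewrite -mulrDr ler_wpM2l// lost_nbrsE -big_split/=; apply: ler_sum => z _.
case: (z \in Q); rewrite /= ?mul0r ?addr0// !mul1r.
rewrite -setI_eq0 -cards_eq0; case: #|A :&: Q| => [|m]; first by rewrite mul0r addr0.
by rewrite -natr1 addrK/=; have : 0 <= m%:R :> R by []; nra.
Qed.

(** On average a proportion [#|A| * rho] of the common neighbours is lost.  At most
    [b] of them are lost at a time, so that [mu * b] bounds the exponents and the
    second-order terms only change the rate by a factor [1 - 2 * eps]. *)
Lemma expect_expR_le (mu eps : R) : 0 <= mu -> mu * b%:R <= eps ->
  #|A|%:R * kappa <= eps -> eps <= 1 -> 0 <= rho ->
  \sum_Q q Q * expR (mu * #|common_nbrs (S :\: pairs_in Q) A U|%:R) <=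
  expR (mu * (1 - #|A|%:R * rho * (1 - 2 * eps)) * #|common_nbrs S A U|%:R).
Proof.
move=> mu0 mub akappa eps1 rho0; rewrite -/X.
have step (Q : {set T}) : q Q * expR (mu * #|common_nbrs (S :\: pairs_in Q) A U|%:R) <=
   expR (mu * #|X|%:R) * (q Q - mu * (1 - eps) * (q Q * #|lost_nbrs Q|%:R)).
  rewrite card_common_nbrs_setD mulrBr expRD.
  have [Qb|/q_supp ->] := leqP #|Q| b; last by rewrite !mul0r mulr0 subrr mulr0.
  set l := #|lost_nbrs Q|%:R : R; have l0 : 0 <= l by [].
  have lb : l <= b%:R by rewrite ler_nat (leq_trans (lost_nbrs_le_card _)).
  have h := expRN_le_quadratic (mulr_ge0 mu0 l0).
  have hl : expR (- (mu * l)) <= 1 - mu * (1 - eps) * l.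
    apply: le_trans h _; have : mu * l <= eps by nra.
    have : 0 <= mu * l by exact: mulr_ge0.
    by nra.
  rewrite mulrCA ler_pM2l ?expR_gt0//.
  have -> : q Q - mu * (1 - eps) * (q Q * l) = q Q * (1 - mu * (1 - eps) * l) by ring.
  exact: ler_wpM2l.
apply: (le_trans (ler_sum _ (fun Q _ => step Q))).
rewrite -mulr_sumr sumrB q_sum1 -mulr_sumr.
set E := \sum_Q q Q * #|lost_nbrs Q|%:R.
have -> : mu * (1 - #|A|%:R * rho * (1 - 2 * eps)) * #|X|%:R =
  mu * #|X|%:R - mu * #|X|%:R * #|A|%:R * rho * (1 - 2 * eps) by ring.
rewrite expRD ler_pM2l ?expR_gt0//; apply: le_trans (onem_le_expR _).
have := expect_lost_nbrs_ge; rewrite -/E => hE.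
have y0 : 0 <= #|X|%:R * (#|A|%:R * rho) by rewrite !mulr_ge0.
have eps0 : 0 <= eps by apply: le_trans mub; rewrite mulr_ge0.
rewrite lerB// -!mulrA ler_wpM2l//.
apply: (@le_trans _ _ ((1 - eps) * (#|X|%:R * (#|A|%:R * rho) * (1 - #|A|%:R * kappa)))); last first.
  by rewrite ler_wpM2l// subr_ge0.
move: y0 akappa; set y := _ * (_ * rho); set ak := _ * kappa => y0 akappa.
have -> : #|X|%:R * (#|A|%:R * (rho * (1 - 2 * eps))) = y * (1 - 2 * eps) by rewrite /y; ring.
have -> : (1 - eps) * (y * (1 - ak)) = y * ((1 - eps) * (1 - ak)) by ring.
rewrite ler_wpM2l//; nra.
Qed.

(** The lower deviations, for which losing pairs of edges together is harmless. *)
Lemma expect_expRN_le (mu eps : R) : 0 <= mu -> mu * b%:R <= eps -> eps <= 1 / 2 -> 0 <= rho ->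
  \sum_Q q Q * expR (- (mu * #|common_nbrs (S :\: pairs_in Q) A U|%:R)) <=
  expR (- (mu * (1 - #|A|%:R * rho * (1 + 2 * eps)) * #|common_nbrs S A U|%:R)).
Proof.
move=> mu0 mub eps1 rho0; rewrite -/X.
have eps0 : 0 <= eps by apply: le_trans mub; rewrite mulr_ge0.
have step (Q : {set T}) : q Q * expR (- (mu * #|common_nbrs (S :\: pairs_in Q) A U|%:R)) <=
   expR (- (mu * #|X|%:R)) * (q Q + mu * (1 + 2 * eps) * (q Q * #|lost_nbrs Q|%:R)).
  rewrite card_common_nbrs_setD mulrBr opprB addrC expRD.
  have [Qb|/q_supp ->] := leqP #|Q| b; last by rewrite !mul0r mulr0 addr0 mulr0.
  set l := #|lost_nbrs Q|%:R : R; have l0 : 0 <= l by [].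
  have lb : l <= b%:R by rewrite ler_nat (leq_trans (lost_nbrs_le_card _)).
  have mul0 : 0 <= mu * l by exact: mulr_ge0.
  have mule : mu * l <= eps by nra.
  have h := expR_le_quadratic mul0 (le_trans mule eps1).
  have hl : expR (mu * l) <= 1 + mu * (1 + 2 * eps) * l.
    by apply: le_trans h _; nra.
  rewrite mulrCA ler_pM2l ?expR_gt0//.
  have -> : q Q + mu * (1 + 2 * eps) * (q Q * l) = q Q * (1 + mu * (1 + 2 * eps) * l) by ring.
  exact: ler_wpM2l.
apply: (le_trans (ler_sum _ (fun Q _ => step Q))).
rewrite -mulr_sumr big_split/= q_sum1 -mulr_sumr.
set E := \sum_Q q Q * #|lost_nbrs Q|%:R.
have -> : - (mu * (1 - #|A|%:R * rho * (1 + 2 * eps)) * #|X|%:R) =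
  - (mu * #|X|%:R) + mu * (1 + 2 * eps) * (#|X|%:R * (#|A|%:R * rho)) by ring.
rewrite expRD ler_pM2l ?expR_gt0//; apply: le_trans (expR_ge1Dx _).
rewrite lerD2l ler_wpM2l//; first by rewrite mulr_ge0//; lra.
exact: expect_lost_nbrs_le.
Qed.

End OneStep.

(** * Counting coloured cliques *)

Section CliqueCount.
Variables (T : finType) (V : {set T}) (k : nat) (S : {set {set T}}).
Hypothesis SV : S \subset vertex_pairs T.
Implicit Types (B Q : {set T}).

(** The elements of [T] outside [V] are colours, adjacent to the vertices at which they are
    available. *)
Definition coloured_clique Q :=
  [&& clique S Q, #|Q :&: V| == k & #|Q :\: V| == 1%N].

Definition extensions B := #|[set Q | coloured_clique Q & B \subset Q]|.

Lemma card_coloured_clique Q : coloured_clique Q -> #|Q| = k.+1.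
Proof. by move=> /and3P[_ /eqP h1 /eqP h2]; rewrite -(cardsID V Q) h1 h2 addn1. Qed.

Lemma extensions_nonclique B : ~~ clique S B -> extensions B = 0%N.
Proof.
move=> nB; apply/eqP; rewrite cards_eq0 -subset0; apply/subsetP => Q; rewrite inE.
by move=> /andP[/and3P[cQ _ _] BQ]; rewrite (clique_sub BQ cQ) in nB.
Qed.

(** Double counting of the pairs formed by a coloured clique and one of its elements in [C]. *)
Lemma sum_extensions (C : {set T}) (m : nat) B :
  (forall Q, coloured_clique Q -> B \subset Q -> #|C :&: Q| = m) ->
  (\sum_(z in C) extensions (z |: B) = m * extensions B)%N.
Proof.
move=> h; rewrite /extensions -[X in (_ * X)%N]sum1_card big_distrr/= [RHS]big_mkcond.
under eq_bigr => z _ do rewrite -sum1_card big_mkcond.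
rewrite exchange_big/=; apply: eq_bigr => Q _; rewrite inE.
case: ifP => [/andP[cQ BQ]|ncQ].
  rewrite muln1 -(h Q cQ BQ) -sum1_card [LHS]big_mkcond [RHS]big_mkcond; apply: eq_bigr => z _.
  by rewrite !inE cQ subUset sub1set BQ andbT/=; case: (z \in C).
rewrite big1// => z _; rewrite inE subUset; case: ifP => // /and3P[cQ _ BQ].
by rewrite cQ BQ in ncQ.
Qed.

Lemma sum_extensions_vertex B : #|B :\: V| = 1%N -> clique S B ->
  (\sum_(z in common_nbrs S B V) extensions (z |: B) =
   (k - #|B :&: V|) * extensions B)%N.
Proof.
move=> B1 cB; apply: sum_extensions => Q /and3P[cQ /eqP Qk _] BQ.
have -> : common_nbrs S B V :&: Q = (Q :&: V) :\: (B :&: V).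
  apply/setP => z; rewrite !in_setI in_setD !in_setI; apply/andP/andP.
    move=> [zB zQ]; rewrite (negbTE (common_nbrs_notin SV zB)) zQ.
    by have /common_nbrsP[->] := zB.
  move=> [zB /andP[zQ zV]]; split => //; apply/common_nbrsP; split => // a aB.
  rewrite zV andbT in zB; move/cliqueP: cQ; apply => //; first exact: (subsetP BQ).
  by apply: contraNneq zB => ->.
rewrite cardsD Qk; congr (_ - _)%N; apply: eq_card => z; rewrite !inE.
by case zB: (z \in B); rewrite ?andbF//= (subsetP BQ _ zB); case: (z \in V).
Qed.

Lemma sum_extensions_colour B : B \subset V ->
  (\sum_(z in common_nbrs S B (~: V)) extensions (z |: B) = extensions B)%N.
Proof.
move=> BV; rewrite -[RHS]mul1n; apply: sum_extensions => Q /and3P[cQ _ /eqP Q1] BQ.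
rewrite -Q1; apply: eq_card => z; rewrite in_setI in_setD.
apply/andP/andP => [[/common_nbrsP[]]|[zV zQ]]; first by rewrite inE.
split => //; apply/common_nbrsP; split; first by rewrite inE.
move=> a aB; move/cliqueP: cQ; apply => //; first exact: (subsetP BQ).
by apply: contraNneq zV => ->; apply: (subsetP BV).
Qed.

Lemma extensions_full B : #|B :\: V| = 1%N -> #|B :&: V| = k -> clique S B -> extensions B = 1%N.
Proof.
move=> B1 Bk cB; rewrite /extensions -[RHS](cards1 B); congr #|pred_of_set _|.
apply/setP => Q; rewrite !inE; apply/andP/eqP => [[/card_coloured_clique Qk BQ]|->].
  by apply/eqP; rewrite eq_sym eqEcard BQ Qk -(cardsID V B) Bk B1 addn1 leqnn.
by rewrite /coloured_clique cB Bk B1 !eqxx subxx.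
Qed.

Variable R : realType.
Variables (lo up : nat -> R).
Hypothesis lo_ge0 : forall j, 0 <= lo j.
Hypothesis up_ge0 : forall j, 0 <= up j.
Hypothesis lo_up : forall B, clique S B -> #|B :\: V| = 1%N -> (#|B :&: V| < k)%N ->
  lo #|B :&: V| <= #|common_nbrs S B V|%:R <= up #|B :&: V|.

(** A coloured clique containing [B] arises [k - #|B :&: V|] times by adding a common neighbour to
    [B]; iterating, the number of extensions is a product of sizes of common neighbourhoods
    divided by a factorial. *)
Lemma extensions_bounds B : clique S B -> #|B :\: V| = 1%N -> (#|B :&: V| <= k)%N ->
  \prod_(#|B :&: V| <= i < k) (lo i / (k - i)%:R) <= (extensions B)%:R
    <= \prod_(#|B :&: V| <= i < k) (up i / (k - i)%:R).
Proof.
move=> cB B1 Bk; have [m hm] := ubnP (k - #|B :&: V|)%N.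
elim: m B cB B1 Bk hm => // m IH B cB B1 Bk hm.
have [kB|kB] := leqP k #|B :&: V|.
  by rewrite (big_geq kB) [X in _ <= _ <= X](big_geq kB) extensions_full ?lexx//; apply/eqP; rewrite eqn_leq Bk.
rewrite (big_ltn kB) [X in _ <= _ <= X](big_ltn kB).
have /andP[lB uB] := lo_up cB B1 kB.
have kj : (0 : R) < (k - #|B :&: V|)%:R by rewrite ltr0n subn_gt0.
have zBk z : z \in common_nbrs S B V -> #|(z |: B) :&: V| = #|B :&: V|.+1.
  move=> zB; have zV : z \in V by case/common_nbrsP : zB.
  rewrite setIUl (setIidPl _) ?sub1set// cardsU1 in_setI.
  by rewrite (negbTE (common_nbrs_notin SV zB)).
have zB1 z : z \in common_nbrs S B V -> #|(z |: B) :\: V| = 1%N.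
  move=> /common_nbrsP[zV _]; rewrite setDUl (_ : [set z] :\: V = set0) ?set0U//.
  by apply/eqP; rewrite setD_eq0 sub1set.
have zBb z : z \in common_nbrs S B V ->
    \prod_(#|B :&: V|.+1 <= i < k) (lo i / (k - i)%:R) <= (extensions (z |: B))%:R
    <= \prod_(#|B :&: V|.+1 <= i < k) (up i / (k - i)%:R).
  move=> zB; rewrite -(zBk z zB); apply: IH; rewrite ?zBk ?zB1//.
    by apply: clique_setU1 => //; case/common_nbrsP : zB.
  by rewrite -ltnS; apply: leq_trans hm; rewrite ltnS ltn_sub2l.
have := sum_extensions_vertex B1 cB => /(congr1 (fun x => x%:R : R)).
rewrite natr_sum natrM => e.
have -> : (extensions B)%:R = (k - #|B :&: V|)%:R^-1 *
   \sum_(i in common_nbrs S B V) (extensions (i |: B))%:R :> R.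
  by rewrite e mulKf// gt_eqF.
set P := \prod_(_ <= i < k) _; set P' := \prod_(_ <= i < k) _.
have sw (x P0 : R) : x / (k - #|B :&: V|)%:R * P0 = (k - #|B :&: V|)%:R^-1 * (x * P0) by ring.
rewrite !sw !ler_pM2l ?invr_gt0// {sw e}.
apply/andP; split.
  apply: (@le_trans _ _ (#|common_nbrs S B V|%:R * P)).
    by rewrite ler_wpM2r// prodr_ge0// => i _; rewrite divr_ge0.
  rewrite -sum1_card natr_sum mulr_suml; apply: ler_sum => z zB; rewrite mul1r.
  by case/andP : (zBb z zB).
apply: (@le_trans _ _ (#|common_nbrs S B V|%:R * P')).
  rewrite -sum1_card natr_sum mulr_suml; apply: ler_sum => z zB; rewrite mul1r.
  by case/andP : (zBb z zB).
by rewrite ler_wpM2r// prodr_ge0// => i _; rewrite divr_ge0.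
Qed.

End CliqueCount.

(** * A removal step with uniform marginals *)

(** The nominal sizes are those of a random graph with [N] vertices and edge
    density [d * g], in which each of [M] colours is available at each vertex with probability
    [g]. *)
Section UniformRemoval.
Variables (R : realType) (T : finType) (V : {set T}) (k : nat) (S : {set {set T}}).
Hypothesis SV : S \subset vertex_pairs T.
Variables (N M d g theta rho kappa : R).
Hypotheses (k3 : (3 <= k)%N) (N0 : 0 < N) (M0 : 0 < M) (d0 : 0 < d) (g0 : 0 < g).
Hypotheses (theta0 : 0 <= theta) (theta12 : 2 * theta <= 1) (rho0 : 0 <= rho).
Let theta1 : theta <= 1. Proof. by move: theta0 theta12; lra. Qed.
Let x (i : nat) : R := N * d ^+ i * g ^+ i.+1.
Hypothesis nbrs_vertex : forall B : {set T}, clique S B -> #|B :\: V| = 1%N ->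
  (#|B :&: V| < k)%N ->
  (1 - theta) * x #|B :&: V| <= #|common_nbrs S B V|%:R <= (1 + theta) * x #|B :&: V|.
Hypothesis nbrs_colour : forall u v, u \in V -> v \in V -> [set u; v] \in S ->
  (1 - theta) * (M * g ^+ 2) <= #|common_nbrs S [set u; v] (~: V)|%:R
    <= (1 + theta) * (M * g ^+ 2).
Hypothesis card_colours : #|~: V|%:R = M.
Hypothesis no_colour_pair : forall e, e \in S -> (#|e :\: V| <= 1)%N.
Hypothesis colours_enough : N * d <= (k%:R - 1) * M.
Hypothesis rho_small : rho * #|S|%:R <= 1.
Hypothesis kappa_vertex : k%:R / (g ^+ 2 * x 2) <= kappa.
Hypothesis kappa_colour : (M * g ^+ 2)^-1 <= kappa.

Let F (j : nat) : R := \prod_(j <= i < k) (x i / (k - i)%:R).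

Let x_gt0 i : 0 < x i. Proof. by rewrite !mulr_gt0// exprn_gt0. Qed.

Let F_gt0 j : 0 < F j.
Proof.
rewrite /F big_nat_cond; apply: prodr_gt0 => i /andP[/andP[_ ik] _].
by rewrite divr_gt0// ltr0n subn_gt0.
Qed.

Let F_rec j : (j < k)%N -> F j = x j / (k - j)%:R * F j.+1.
Proof. by move=> jk; rewrite /F big_ltn. Qed.

Let prod_scale (c : R) j :
  \prod_(j <= i < k) (c * x i / (k - i)%:R) = c ^+ (k - j) * F j.
Proof.
rewrite /F -prodr_const_nat -big_split/=; apply: eq_bigr => i _.
by rewrite /x !mulrA.
Qed.

Let lo_ge0 j : 0 <= (1 - theta) * x j. Proof. by rewrite mulr_ge0 ?subr_ge0// ltW. Qed.
Let up_ge0 j : 0 <= (1 + theta) * x j. Proof. by rewrite mulr_ge0 ?addr_ge0// ltW. Qed.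

Lemma extensions_le (B : {set T}) : #|B :\: V| = 1%N -> (#|B :&: V| <= k)%N ->
  (extensions V k S B)%:R <= (1 + theta) ^+ (k - #|B :&: V|) * F #|B :&: V|.
Proof.
move=> B1 Bk; have [cB|/extensions_nonclique ->] := boolP (clique S B); last first.
  by rewrite mulr_ge0 ?exprn_ge0 ?addr_ge0// ltW.
by have := extensions_bounds SV lo_ge0 up_ge0 nbrs_vertex cB B1 Bk; rewrite !prod_scale => /andP[].
Qed.

Lemma extensions_ge (B : {set T}) : clique S B -> #|B :\: V| = 1%N -> (#|B :&: V| <= k)%N ->
  (1 - theta) ^+ (k - #|B :&: V|) * F #|B :&: V| <= (extensions V k S B)%:R.
Proof.
move=> cB B1 Bk.
by have := extensions_bounds SV lo_ge0 up_ge0 nbrs_vertex cB B1 Bk; rewrite !prod_scale => /andP[].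
Qed.

(** The nominal number of coloured cliques through an edge between vertices, increased by
    the largest relative error. *)
Let top := (1 + theta) ^+ k.-1 * (M * g ^+ 2) * F 2.

Let top_gt0 : 0 < top.
Proof. by rewrite !mulr_gt0 ?exprn_gt0// ltr_wpDr. Qed.

Lemma card_colour_setU1 (B : {set T}) c : B \subset V -> c \in ~: V ->
  #|(c |: B) :\: V| = 1%N /\ #|(c |: B) :&: V| = #|B|.
Proof.
move=> BV; rewrite inE => cV; split.
  rewrite setDUl (_ : B :\: V = set0) ?setU0; last by apply/eqP; rewrite setD_eq0.
  rewrite (_ : [set c] :\: V = [set c]) ?cards1//; apply/setP => z; rewrite !inE.
  by case: eqP => [->|]; rewrite ?cV ?andbF ?andbT.
rewrite setIUl (setIidPl BV) (_ : [set c] :&: V = set0) ?set0U//.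
by apply/eqP; rewrite setI_eq0 disjoints1.
Qed.

Lemma clique_pair u v : [set u; v] \in S -> clique S [set u; v].
Proof.
move=> uv; apply/cliqueP => a b; rewrite !inE => /orP[]/eqP-> /orP[]/eqP->; rewrite ?eqxx//.
by rewrite setUC.
Qed.

Lemma extensions_vertex_pair u v : u \in V -> v \in V -> [set u; v] \in S ->
  (1 - theta) ^+ k.-1 * (M * g ^+ 2) * F 2 <= (extensions V k S [set u; v])%:R <= top.
Proof.
move=> uV vV uvS; have uv : u != v by rewrite -in_vertex_pairs2 (subsetP SV).
have BV : [set u; v] \subset V by rewrite subUset !sub1set uV.
have /andP[cl cu] := nbrs_colour uV vV uvS.
rewrite -(sum_extensions_colour k S BV) natr_sum.
have c2 c : c \in common_nbrs S [set u; v] (~: V) ->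
    #|(c |: [set u; v]) :\: V| = 1%N /\ #|(c |: [set u; v]) :&: V| = 2%N.
  move=> /common_nbrsP[cC _]; have [h1 h2] := card_colour_setU1 BV cC.
  by rewrite h1 h2 cards2 uv.
have kk : k.-1 = (k - 2).+1 by case: k k3 => [|[|]]// k' _; rewrite subn2.
apply/andP; split.
  apply: (@le_trans _ _ (#|common_nbrs S [set u; v] (~: V)|%:R * ((1 - theta) ^+ (k - 2) * F 2))).
    have -> : (1 - theta) ^+ k.-1 * (M * g ^+ 2) * F 2 =
        (1 - theta) * (M * g ^+ 2) * ((1 - theta) ^+ (k - 2) * F 2).
      by rewrite kk exprS; ring.
    by rewrite ler_wpM2r// mulr_ge0 ?exprn_ge0 ?subr_ge0// ltW.
  rewrite -[#|common_nbrs _ _ _|]sum1_card natr_sum mulr_suml; apply: ler_sum => c cB; rewrite mul1r.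
  have [h1 h2] := c2 c cB; rewrite -{1 2}h2; apply: extensions_ge; rewrite ?h2// 1?ltnW//.
  by apply: clique_setU1; [exact: clique_pair|case/common_nbrsP : cB].
apply: (@le_trans _ _ (#|common_nbrs S [set u; v] (~: V)|%:R * ((1 + theta) ^+ (k - 2) * F 2))).
  rewrite -[#|common_nbrs _ _ _|]sum1_card natr_sum mulr_suml; apply: ler_sum => c cB; rewrite mul1r.
  have [h1 h2] := c2 c cB; rewrite -{1 2}h2; by apply: extensions_le; rewrite ?h2// ltnW.
have -> : top = (1 + theta) * (M * g ^+ 2) * ((1 + theta) ^+ (k - 2) * F 2).
  by rewrite /top kk exprS; ring.
by rewrite ler_wpM2r// mulr_ge0// ?exprn_ge0 ?addr_ge0// ltW.
Qed.

Let onep_le i j : (i <= j)%N -> (1 + theta) ^+ i <= (1 + theta) ^+ j.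
Proof. by move=> ij; rewrite ler_weXn2l// lerDl. Qed.

(** For an edge to a colour this rests on [colours_enough]: with fewer colours such
    edges would be in more coloured cliques than the edges between vertices. *)
Lemma extensions_edge e : e \in S -> (extensions V k S e)%:R <= top.
Proof.
move=> eS; have e2 : #|e| = 2%N by move: (subsetP SV e eS); rewrite inE => /eqP.
have := no_colour_pair eS; rewrite leq_eqVlt ltnS leqn0 => /orP[/eqP e1|].
  have eV : #|e :&: V| = 1%N by move: (cardsID V e); rewrite e1 e2 addn1 => -[].
  apply: (le_trans (extensions_le e1 _)); first by rewrite eV (leq_trans _ k3).
  rewrite eV subn1 /top -mulrA ler_wpM2l ?exprn_ge0 ?addr_ge0//.
  rewrite F_rec ?(leq_trans _ k3)// (ler_wpM2r (ltW (F_gt0 _)))//.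
  rewrite ler_pdivrMr ?ltr0n ?subn_gt0 ?(leq_trans _ k3)// natrB ?(leq_trans _ k3)//.
  rewrite /x expr1; have g2 : 0 <= g ^+ 2 by rewrite exprn_ge0// ltW.
  have -> : M * g ^+ 2 * (k%:R - 1%:R) = (k%:R - 1) * M * g ^+ 2 by ring.
  exact: (ler_wpM2r g2 colours_enough).
rewrite cards_eq0 setD_eq0 => eV; have := subsetP SV e eS.
move=> /vertex_pairsP[u [v [_ euv]]]; move: eV eS; rewrite euv subUset !sub1set => /andP[uV vV] eS.
by case/andP : (extensions_vertex_pair uV vV eS).
Qed.

Lemma extensions_triple (B : {set T}) : #|B| = 3%N -> (extensions V k S B)%:R <= kappa * top.
Proof.
move=> B3; have kappa0 : 0 <= kappa.
  by apply: le_trans kappa_colour; rewrite invr_ge0 mulr_ge0 ?exprn_ge0// ltW.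
have [B0|] := posnP #|B :\: V|.
  have BV : B \subset V by rewrite -setD_eq0 -cards_eq0 B0.
  rewrite -(sum_extensions_colour k S BV) natr_sum.
  apply: (@le_trans _ _ (#|common_nbrs S B (~: V)|%:R * ((1 + theta) ^+ (k - 3) * F 3))).
    rewrite -[#|common_nbrs _ _ _|]sum1_card natr_sum mulr_suml; apply: ler_sum => c.
    move=> /common_nbrsP[cC _]; rewrite mul1r; have [h1 h2] := card_colour_setU1 BV cC.
    by rewrite -B3 -h2; apply: extensions_le; rewrite // h2 B3.
  apply: (@le_trans _ _ (M * ((1 + theta) ^+ (k - 3) * F 3))).
    rewrite ler_wpM2r ?mulr_ge0 ?exprn_ge0 ?addr_ge0 ?(ltW (F_gt0 _))//.
    rewrite -card_colours ler_nat; apply/subset_leq_card/subsetP => c.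
    by case/common_nbrsP.
  have h3 : F 3 <= kappa * g ^+ 2 * F 2.
    rewrite (F_rec k3) [leRHS](_ : _ = kappa * (g ^+ 2 * x 2) / (k - 2)%:R * F 3); last by ring.
    rewrite -[leLHS]mul1r (ler_wpM2r (ltW (F_gt0 _)))//.
    have gx : 0 < g ^+ 2 * x 2 by rewrite mulr_gt0 ?exprn_gt0.
    move: kappa_vertex; rewrite ler_pdivrMr// => h.
    rewrite ler_pdivlMr ?ltr0n ?subn_gt0// mul1r; apply: le_trans h.
    by rewrite ler_nat leq_subr.
  have -> : kappa * top = M * ((1 + theta) ^+ k.-1 * (kappa * g ^+ 2 * F 2)) by rewrite /top; ring.
  rewrite ler_pM2l// ler_pM ?exprn_ge0 ?addr_ge0 ?(ltW (F_gt0 _))//.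
  by apply: onep_le; rewrite -subn1 leq_sub2l.
rewrite leq_eqVlt => /orP[/eqP /esym B1|B2].
  have BV : #|B :&: V| = 2%N by move: (cardsID V B); rewrite B1 B3 addn1 => -[].
  apply: (le_trans (extensions_le B1 _)); first by rewrite BV ltnW.
  rewrite BV /top.
  have -> : kappa * ((1 + theta) ^+ k.-1 * (M * g ^+ 2) * F 2) =
    (1 + theta) ^+ k.-1 * (kappa * (M * g ^+ 2) * F 2) by ring.
  apply: ler_pM; rewrite ?exprn_ge0 ?addr_ge0 ?(ltW (F_gt0 _))//.
    by apply: onep_le; rewrite -subn1 leq_sub2l.
  rewrite -[leLHS]mul1r (ler_wpM2r (ltW (F_gt0 _)))//.
  by rewrite -ler_pdivrMr ?mul1r// mulr_gt0 ?exprn_gt0.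
suff -> : extensions V k S B = 0%N by rewrite mulr_ge0 ?(ltW top_gt0).
apply/eqP; rewrite cards_eq0 -subset0; apply/subsetP => Q; rewrite inE.
move=> /andP[/and3P[_ _ /eqP Q1] BQ]; have := subset_leq_card (setSD V BQ).
by rewrite Q1 leqNgt B2.
Qed.

Let w := rho / top.
Let w_ge0 : 0 <= w. Proof. by rewrite divr_ge0// ltW. Qed.

Let dump (Q : {set T}) : R := (Q \in S)%:R * (rho - w * (extensions V k S Q)%:R).
Let q0 (Q : {set T}) : R := (coloured_clique V k S Q)%:R * w + dump Q.

Let wext_le e : e \in S -> w * (extensions V k S e)%:R <= rho.
Proof.
move=> eS; apply: (@le_trans _ _ (w * top)); first by rewrite ler_wpM2l// extensions_edge.
by rewrite /w divfK// gt_eqF.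
Qed.

Let dump_ge0 Q : 0 <= dump Q.
Proof. by rewrite /dump; case: (boolP (Q \in S)) => QS; rewrite ?mul0r// mul1r subr_ge0 wext_le. Qed.

Let q0_ge0 Q : 0 <= q0 Q.
Proof. by rewrite addr_ge0// mulr_ge0. Qed.

Let sum_cc (P : pred {set T}) (B : {set T}) : 
  \sum_(Q : {set T} | B \subset Q) (coloured_clique V k S Q)%:R * w = w * (extensions V k S B)%:R.
Proof.
rewrite /extensions -sum1_card natr_sum mulr_sumr [LHS]big_mkcond [RHS]big_mkcond.
apply: eq_bigr => Q _; rewrite inE; case: (B \subset Q); rewrite ?andbF ?andbT//.
by case: coloured_clique; rewrite ?mul0r ?mul1r ?mulr1.
Qed.

Let q0_sum_le1 : \sum_(Q : {set T}) q0 Q <= 1.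
Proof.
apply: le_trans rho_small; rewrite big_split/=.
have -> : \sum_(Q : {set T}) dump Q = rho * #|S|%:R - \sum_(e in S) w * (extensions V k S e)%:R.
  rewrite -sum1_card natr_sum mulr_sumr -sumrB [RHS]big_mkcond; apply: eq_bigr => Q _.
  by rewrite /dump; case: (Q \in S); rewrite ?mul0r ?mul1r ?mulr1.
rewrite addrCA gerDl subr_le0.
rewrite (eq_bigr _ (fun e _ => esym (sum_cc xpredT e))).
under [leRHS]eq_bigr => e _ do rewrite big_mkcond.
rewrite exchange_big/=; apply: ler_sum => Q _.
have [cQ|_] := boolP (coloured_clique V k S Q); last first.
  by rewrite mul0r sumr_ge0// => e _; case: ifP; rewrite ?mul0r.
have /and3P[/cliqueP clQ /eqP Qk _] := cQ.
have /card_gt1P[u [v [uQ vQ uv]]] : (1 < #|Q :&: V|)%N by rewrite Qk ltnW.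
move: uQ vQ; rewrite !inE => /andP[uQ _] /andP[vQ _].
rewrite (bigD1 [set u; v])/=; last exact: clQ.
by rewrite subUset !sub1set uQ vQ lerDl; apply: sumr_ge0 => e _; case: ifP; rewrite ?mul1r.
Qed.

(** Every coloured clique gets the same weight [w], chosen such that no edge is covered
    with probability above [rho]; the single edge [e] gets the missing probability
    [rho - w * extensions e], and the empty set all that remains.  All the edges being lost
    equally often, errors in the densities do not feed back on the rates.  For
    the edges between vertices, the only ones whose dumping is costly, the correction is small. *)
Lemma uniform_removal : exists q : {set T} -> R,
  [/\ forall Q, 0 <= q Q, \sum_Q q Q = 1,
      forall Q, q Q != 0 -> [|| Q == set0, coloured_clique V k S Q | Q \in S],
      forall e, e \in S -> \sum_(Q : {set T} | e \subset Q) q Q = rho &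
      forall B : {set T}, #|B| = 3%N -> \sum_(Q : {set T} | B \subset Q) q Q <= kappa * rho]
  /\ forall e, e \in S -> e \subset V -> q e <= rho * (2 * k%:R * theta).
Proof.
have q00 : q0 set0 = 0.
  rewrite /q0 /dump (negbTE (_ : set0 \notin S)).
    rewrite mul0r addr0 (negbTE (_ : ~~ coloured_clique V k S set0)) ?mul0r//.
    by apply/negP => /card_coloured_clique; rewrite cards0.
  by apply/negP => /(subsetP SV); rewrite inE cards0.
have S2 e : e \in S -> #|e| = 2%N by move/(subsetP SV); rewrite inE => /eqP.
have Snc e : e \in S -> coloured_clique V k S e = false.
  by move=> eS; apply/negP => /card_coloured_clique; rewrite S2// => -[] kk; move: k3; rewrite -kk.
pose q Q := q0 Q + (Q == set0)%:R * (1 - \sum_(Q : {set T}) q0 Q).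
have q_sup B : B != set0 -> \sum_(Q : {set T} | B \subset Q) q Q =
    w * (extensions V k S B)%:R + \sum_(Q : {set T} | B \subset Q) dump Q.
  move=> B0; rewrite -(sum_cc xpredT) -big_split/=; apply: eq_bigr => Q BQ.
  rewrite /q (_ : (Q == set0) = false) ?mul0r ?addr0//.
  by apply: contraNF B0 => /eqP Q0; rewrite Q0 subset0 in BQ.
exists q; split; first split.
- by move=> Q; rewrite addr_ge0// mulr_ge0// subr_ge0.
- have sum1 : \sum_(Q : {set T}) (Q == set0)%:R = 1 :> R.
    by rewrite (bigD1 set0)//= eqxx big1 ?addr0// => Q /negbTE ->.
  by rewrite big_split/= -mulr_suml sum1 mul1r addrC subrK.
- move=> Q; apply: contraNT; rewrite !negb_or => /and3P[/negbTE Q0 /negbTE cQ /negbTE QS].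
  by rewrite /q /q0 /dump Q0 cQ QS !mul0r !addr0.
- move=> e eS; rewrite q_sup; last by rewrite -cards_eq0 S2.
  rewrite (bigD1 e)//= big1 ?addr0; first by rewrite /dump eS mul1r addrC subrK.
  move=> Q /andP[eQ Qe]; rewrite /dump; have [QS|] := boolP (Q \in S); last by rewrite mul0r.
  by case/negP : Qe; rewrite eq_sym eqEcard eQ !S2.
- move=> B B3; rewrite q_sup; last by rewrite -cards_eq0 B3.
  rewrite [X in _ + X]big1 ?addr0; last first.
    move=> Q BQ; rewrite /dump; have [QS|] := boolP (Q \in S); last by rewrite mul0r.
    by have := subset_leq_card BQ; rewrite B3 S2.
  rewrite /w mulrAC ler_pdivrMr// [leRHS]mulrAC [leRHS]mulrC ler_wpM2l//.
  exact: extensions_triple.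
move=> e eS eV; rewrite /q /q0 Snc// mul0r add0r.
rewrite (_ : (e == set0) = false) ?mul0r ?addr0; last first.
  by apply/eqP => e0; move: (S2 e eS); rewrite e0 cards0.
rewrite /dump eS mul1r /w mulrAC -mulrA -[X in X - _]mulr1 -mulrBr ler_wpM2l//.
have /vertex_pairsP[u [v [_ euv]]] := subsetP SV e eS; rewrite euv in eS eV *.
move: eV; rewrite subUset !sub1set => /andP[uV vV].
have /andP[h0 _] := extensions_vertex_pair uV vV eS.
have itop : 0 <= top^-1 by rewrite invr_ge0 ltW.
have h := ler_wpM2r itop h0.
rewrite lerBlDr -lerBlDl; apply: le_trans h.
have -> : (1 - theta) ^+ k.-1 * (M * g ^+ 2) * F 2 / top = (1 - theta) ^+ k.-1 / (1 + theta) ^+ k.-1.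
  have M0' := lt0r_neq0 M0; have g0' := lt0r_neq0 g0; have F0' := lt0r_neq0 (F_gt0 2).
  have t0' : 1 + theta != 0 by rewrite lt0r_neq0// ltr_wpDr.
  rewrite /top; field; by rewrite expf_neq0// F0' g0' M0'.
rewrite -expr_div_n; apply: (@le_trans _ _ ((1 - 2 * theta) ^+ k.-1)).
  have t2 : 0 <= 2 * theta by rewrite mulr_ge0.
  apply: le_trans (bernoulli_ineq k.-1 t2 theta12).
  rewrite lerD2l lerN2 mulrCA -mulrA ler_wpM2l// ler_wpM2r// ler_nat leq_pred//.
have q1 : 0 <= (1 - theta) / (1 + theta) by apply: divr_ge0; [rewrite subr_ge0|exact: addr_ge0].
rewrite lerXn2r ?nnegrE ?subr_ge0//.
rewrite ler_pdivlMr; last by rewrite ltr_wpDr.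
have := mulr_ge0 theta0 theta0; move: (theta) => t; nra.
Qed.

End UniformRemoval.

(** * Bookkeeping of the removed edges *)

Section Averaging.
Variables (R : realType) (I : finType) (q f : I -> R) (c : R).

Lemma averaging : (forall i, 0 <= q i) -> \sum_i q i = 1 -> \sum_i q i * f i <= c ->
  exists i, q i != 0 /\ f i <= c.
Proof.
move=> q0 q1 qf; have [/existsP[i /andP[]]|/existsPn h] := boolP [exists i, (q i != 0) && (f i <= c)].
  by exists i.
suff : c < \sum_i q i * f i by rewrite ltNge qf.
have hi i : q i * c <= q i * f i.
  have := h i; rewrite negb_and negbK -ltNge => /orP[/eqP ->|/ltW fc]; first by rewrite !mul0r.
  exact: ler_wpM2l.
have [i qi] : exists i, q i != 0.
  apply/existsP; apply: contraT => /existsPn q00; move: q1; rewrite big1 => [/eqP|i _].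
    by rewrite eq_sym oner_eq0.
  by apply/eqP; move: (q00 i); rewrite negbK.
rewrite -[c]mul1r -q1 mulr_suml (bigD1 i)//= [ltRHS](bigD1 i)//=.
apply: ltr_leD; last by apply: ler_sum => j _; exact: hi.
have := h i; rewrite qi/= -ltNge => cf; rewrite ltr_pM2l// lt0r qi; exact: q0.
Qed.

End Averaging.

Section Bookkeeping.
Variables (T : finType) (V : {set T}) (k : nat) (S0 : {set {set T}}).
Hypothesis S0V : S0 \subset vertex_pairs T.
Implicit Types (S QQ F : {set {set T}}) (Q e : {set T}).

Definition coverage S F QQ e : nat :=
  (e \in S) + (e \in F) + #|[set Q in QQ | e \subset Q]|.

(** An edge between vertices must end up in exactly one place, while an edge to a colour
    only records that this colour is available, and may vanish without trace. *)
Definition removal_state S F QQ : Prop :=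
  [/\ S \subset S0, forall e, e \in F -> e \in S0 /\ e \subset V,
      forall Q, Q \in QQ -> coloured_clique V k S0 Q,
      forall e, e \in S0 -> (coverage S F QQ e <= 1)%N &
      forall e, e \in S0 -> e \subset V -> coverage S F QQ e = 1%N].

(** A removed set is a coloured clique, a single edge or empty; only a single edge
    between vertices has to be recorded as dumped. *)
Definition next_dumps S F Q := if (Q \in S) && (Q \subset V) then Q |: F else F.
Definition next_cliques S QQ Q := if coloured_clique V k S Q then Q |: QQ else QQ.

Lemma removal_state_init : removal_state S0 set0 set0.
Proof.
have cov e : e \in S0 -> coverage S0 set0 set0 e = 1%N.
  move=> eS; rewrite /coverage eS inE; apply/eqP; rewrite addn0 -[1%N]addn0 eqn_add2l.
  by rewrite cards_eq0 -subset0; apply/subsetP => Q; rewrite !inE.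
by split=> [//|e|Q|e /cov ->//|e /cov ->//]; rewrite inE.
Qed.

Hypothesis k2 : (2 <= k)%N.

Lemma removal_state_next S F QQ Q : removal_state S F QQ ->
  [|| Q == set0, coloured_clique V k S Q | Q \in S] ->
  removal_state (S :\: pairs_in Q) (next_dumps S F Q) (next_cliques S QQ Q).
Proof.
move=> [SS0 F0 QQ0 cov1 covV].
have S'S0 : S :\: pairs_in Q \subset S0 by rewrite (subset_trans (subsetDl _ _)).
have [->|] := eqVneq Q set0 => /= [_|_].
  have s0 : set0 \notin S by apply/negP => /(subsetP SS0)/(subsetP S0V); rewrite inE cards0.
  have nc : coloured_clique V k S set0 = false.
    by apply/negP => /card_coloured_clique; rewrite cards0.
  by rewrite pairs_in_set0 setD0 /next_dumps /next_cliques (negbTE s0) nc; split.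
case cQ: coloured_clique => /=.
  move=> _; have QnS : Q \notin S.
    apply/negP => /(subsetP SS0)/(subsetP S0V); rewrite inE (card_coloured_clique cQ).
    by rewrite eqSS => /eqP k1; move: k2; rewrite k1.
  rewrite /next_dumps /next_cliques cQ (negbTE QnS)/=.
  have pS : pairs_in Q \subset S by apply: clique_pairs_in; case/and3P : cQ.
  have [u [v [uv uQ vQ]]] : exists u v, [/\ u != v, u \in Q & v \in Q].
    have /card_gt1P[u [v [uQ vQ uv]]] : (1 < #|Q|)%N by rewrite (card_coloured_clique cQ) (leq_trans k2).
    by exists u, v.
  have QnQQ : Q \notin QQ.
    apply/negP => QQQ; have uvS : [set u; v] \in S.
      by apply: (subsetP pS); rewrite pairs_in_set2 uv uQ.
    have := cov1 _ (subsetP SS0 _ uvS); rewrite /coverage uvS -addnA add1n ltnS leqn0 addn_eq0.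
    rewrite cards_eq0 => /andP[_ /eqP/setP/(_ Q)]; rewrite !inE QQQ/=.
    by rewrite subUset !sub1set uQ vQ.
  have covE e : e \in S0 -> coverage (S :\: pairs_in Q) F (Q |: QQ) e = coverage S F QQ e.
    move=> eS0; have [eQ|eQ] := boolP (e \subset Q).
      have ep : e \in pairs_in Q by rewrite inE eQ (subsetP S0V).
      rewrite /coverage in_setD ep/= (subsetP pS e ep).
      rewrite (_ : [set Q' in Q |: QQ | e \subset Q'] = Q |: [set Q' in QQ | e \subset Q']).
        by rewrite cardsU1 inE (negbTE QnQQ)/= addnCA addnA.
      by apply/setP => Q'; rewrite !inE; case: eqP => [->|]//=.
    rewrite /coverage in_setD [e \in pairs_in Q]inE (negbTE eQ) andbF/=; congr (_ + #|pred_of_set _|)%N.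
    apply/setP => Q'; rewrite !inE; case: eqP => [->|]//=.
    by rewrite (negbTE eQ) andbF.
  split=> //.
  - move=> Q'; rewrite !inE => /orP[/eqP ->|]; last exact: QQ0.
    by case/and3P : cQ => h1 h2 h3; apply/and3P; split=> //; apply: clique_subE h1.
  - by move=> e eS0; rewrite covE// cov1.
  - by move=> e eS0 eV; rewrite covE// covV.
move=> QS; rewrite /next_dumps /next_cliques cQ QS/=.
have QS0 := subsetP SS0 _ QS.
rewrite (pairs_in_pair (subsetP S0V _ QS0)) in S'S0 *.
have [QF QQQ] : (Q \in F) = false /\ #|[set Q' in QQ | Q \subset Q']| = 0%N.
  have := cov1 Q QS0; rewrite /coverage QS -addnA add1n ltnS leqn0 addn_eq0.
  by case: (Q \in F) => //= /eqP ->.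
have covE e : e != Q -> forall F', (e \in F') = (e \in F) ->
    coverage (S :\ Q) F' QQ e = coverage S F QQ e.
  by move=> eQ F' eF; rewrite /coverage eF in_setD1 eQ.
split=> //.
- case: ifP => QV e; last exact: F0.
  by rewrite !inE => /orP[/eqP ->|/F0].
- move=> e eS0; have [->|eQ] := eqVneq e Q.
    rewrite /coverage in_setD1 eqxx/=; case: ifP => _; last by rewrite QF QQQ.
    by rewrite in_setU1 eqxx QQQ.
  by rewrite covE ?cov1//; case: ifP; rewrite // in_setU1 (negbTE eQ).
- move=> e eS0 eV; have [eQ|eQ] := eqVneq e Q.
    by rewrite eQ in eV *; rewrite /coverage in_setD1 eqxx/= eV in_setU1 eqxx QQQ.
  by rewrite covE ?covV//; case: ifP; rewrite // in_setU1 (negbTE eQ).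
Qed.

End Bookkeeping.

(** * The random removal process *)

Section ColouredPhase.
Variables (R : realType) (T : finType) (V : {set T}) (k : nat) (S0 : {set {set T}}).
Hypothesis S0V : S0 \subset vertex_pairs T.
Hypothesis no_colour_pair : forall e, e \in S0 -> (#|e :\: V| <= 1)%N.
Variables (N M d theta0 theta tau eps lam Lam Y : R).
Hypotheses (k3 : (3 <= k)%N) (N0 : 0 < N) (M0 : 0 < M) (d0 : 0 < d).
Hypothesis card_colours : #|~: V|%:R = M.
Hypothesis colours_enough : N * d <= (k%:R - 1) * M.

(** The pairs [(A, b)] index the common neighbourhoods that are followed: those of [A] among the
    vertices if [b] holds, and among the colours otherwise.  These are the ones whose sizes
    enter the counts of coloured cliques. *)
Definition admissible (j : {set T} * bool) : bool :=
  if j.2 then (#|j.1| <= k)%N && (#|j.1 :\: V| <= 1)%N else (#|j.1| == 2%N) && (j.1 \subset V).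
Definition target (j : {set T} * bool) : {set T} := if j.2 then V else ~: V.
Definition base (j : {set T} * bool) : R := if j.2 then N * d ^+ #|j.1 :&: V| else M.
Let X (S : {set {set T}}) (j : {set T} * bool) : R := #|common_nbrs S j.1 (target j)|%:R.

Hypothesis start : forall j, admissible j ->
  (1 - theta0) * base j <= X S0 j <= (1 + theta0) * base j.
Hypothesis base_power : forall j : nat, (j <= k)%N -> Y <= N * d ^+ j.
Hypothesis base_colour : Y <= M.

Hypotheses (Y0 : 0 < Y) (lam0 : 0 < lam) (theta00 : 0 <= theta0) (tau0 : 0 <= tau).
Hypotheses (theta0' : 0 <= theta) (theta12 : 2 * theta <= 1).
Hypotheses (eps0 : 0 < eps) (eps4 : 4 * eps <= 1).
Hypothesis tests_few : (2 * #|[pred j | admissible j]| + #|T|)%:R <= expR Lam.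
Hypothesis tau_big : Lam <= tau * lam * Y.
Hypothesis theta_up : (1 + theta0 + tau) * expR (2 * eps * k%:R) <= 1 + theta.
Hypothesis theta_lo : 1 - theta <= (1 - theta0 - tau) * expR (- (4 * eps * k%:R)).
Hypothesis lam_small : lam * expR (k%:R + 4 * eps * k%:R) * k.+1%:R <= eps.
Let kappa : R := k%:R * expR 5 / Y.
Hypothesis kappa_small : k%:R * kappa <= eps.

Section Steps.
(* The number of steps is a free parameter: with steps of tiny probability [1 / m] all
   the second-order effects disappear. *)
Variable m : nat.
Hypothesis m_gt0 : (0 < m)%N.
Hypothesis m_big : 4 * k%:R <= eps * m%:R.
Hypothesis m_edges : (#|S0| <= m)%N.
Let rho : R := m%:R^-1.
Let rho_gt0 : 0 < rho. Proof. by rewrite invr_gt0 ltr0n. Qed.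

Let bp (a : nat) : R := 1 - a%:R * rho * (1 - 2 * eps).
Let bm (a : nat) : R := 1 - a%:R * rho * (1 + 2 * eps).
Let g (t : nat) : R := expR (- (t%:R * rho)).

Let krho : 4 * (k%:R * rho) <= eps.
Proof. by rewrite mulrA ler_pdivrMr ?ltr0n. Qed.

Let arho a : (a <= k)%N -> 4 * (a%:R * rho) <= eps.
Proof.
move=> ak; apply: le_trans krho; rewrite ler_pM2l// ler_wpM2r ?ler_nat//.
exact: ltW.
Qed.

Let bm_half a : (a <= k)%N -> a%:R * rho * (1 + 2 * eps) <= 1 / 2.
Proof.
move=> /arho; have : 0 <= a%:R * rho by rewrite mulr_ge0// ltW.
by have e0 := eps0; have e4 := eps4; move: (a%:R * rho) => u u0 u1; nra.
Qed.

Let bm_gt0 a : (a <= k)%N -> 0 < bm a.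
Proof. by move=> /bm_half; rewrite /bm; lra. Qed.

Let bm_bp a : bm a <= bp a.
Proof.
rewrite /bm /bp; have : 0 <= a%:R * rho by rewrite mulr_ge0// ltW.
by have e0 := eps0; move: (a%:R * rho) => u u0; nra.
Qed.

Let bp_gt0 a : (a <= k)%N -> 0 < bp a.
Proof. by move=> /bm_gt0/lt_le_trans; apply; exact: bm_bp. Qed.

Let g_gt0 t : 0 < g t. Proof. exact: expR_gt0. Qed.

Let trho t : (t <= m)%N -> 0 <= t%:R * rho <= 1.
Proof.
move=> tm; rewrite mulr_ge0 ?(ltW rho_gt0)//= /rho.
by rewrite ler_pdivrMr ?ltr0n// mul1r ler_nat.
Qed.

Let g_ge t : (t <= m)%N -> expR (- 1) <= g t.
Proof. by move=> /trho/andP[_ h]; rewrite ler_expR lerN2. Qed.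

Let g_le1 t : g t <= 1.
Proof. by rewrite -expR0 ler_expR oppr_le0 mulr_ge0// ltW. Qed.

Let bp_le a t : (a <= k)%N -> (t <= m)%N -> bp a ^+ t <= g t ^+ a * expR (2 * eps * k%:R).
Proof.
move=> ak tm; have h : bp a <= expR (- (a%:R * rho * (1 - 2 * eps))) by exact: onem_le_expR.
apply: (le_trans (_ : _ <= expR (- (a%:R * rho * (1 - 2 * eps))) ^+ t)).
  by rewrite lerXn2r ?nnegrE ?expR_ge0// ltW// bp_gt0.
rewrite -!expRM_natl -expRD ler_expR.
have /andP[t0 t1] := trho tm.
have ak' : a%:R <= k%:R :> R by rewrite ler_nat.
have a0 : 0 <= a%:R :> R by [].
have -> : t%:R * - (a%:R * rho * (1 - 2 * eps)) = a%:R * - (t%:R * rho) + 2 * eps * (a%:R * (t%:R * rho)) by ring.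
rewrite lerD2l ler_wpM2l ?mulr_ge0 ?(ltW eps0)//.
by move: (t%:R * rho) (a%:R) (k%:R) t0 t1 ak' a0 => u v w; nra.
Qed.

Let bm_ge a t : (a <= k)%N -> (t <= m)%N -> g t ^+ a * expR (- (4 * eps * k%:R)) <= bm a ^+ t.
Proof.
move=> ak tm; set y := a%:R * rho * (1 + 2 * eps); have e0 := eps0; have e4 := eps4.
have ar0 : 0 <= a%:R * rho by rewrite mulr_ge0// ltW.
have y0 : 0 <= y by rewrite mulr_ge0// addr_ge0// mulr_ge0// ltW.
have h : expR (- (y + 2 * y ^+ 2)) <= bm a by apply: onem_ge_expR => //; exact: bm_half.
apply: (le_trans (_ : _ <= expR (- (y + 2 * y ^+ 2)) ^+ t)); last first.
  by rewrite lerXn2r ?nnegrE ?expR_ge0// ltW// bm_gt0.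
rewrite -!expRM_natl -expRD ler_expR.
rewrite (_ : _ + _ = - (a%:R * (t%:R * rho) + 4 * eps * k%:R)); last by ring.
rewrite mulrN lerN2.
have /andP[t0 t1] := trho tm.
have ak' : a%:R <= k%:R :> R by rewrite ler_nat.
have a0 : 0 <= a%:R :> R by [].
have har := arho ak.
have ye : 2 * y <= 3 / 4 * eps.
  by rewrite /y; move: (a%:R * rho) ar0 har => u; nra.
apply: (@le_trans _ _ (t%:R * (y + y * (3 / 4 * eps)))).
  by rewrite ler_wpM2l// lerD2l expr2 mulrCA ler_wpM2l.
have -> : t%:R * (y + y * (3 / 4 * eps)) = (a%:R * (t%:R * rho)) * ((1 + 2 * eps) * (1 + 3 / 4 * eps)).
  by rewrite /y; ring.
have s1 : (1 + 2 * eps) * (1 + 3 / 4 * eps) <= 1 + 4 * eps by nra.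
have s0 : a%:R * (t%:R * rho) <= k%:R.
  by move: (t%:R * rho) (a%:R) (k%:R) t0 t1 ak' a0 => u v w; nra.
have s2 : 0 <= a%:R * (t%:R * rho) by rewrite mulr_ge0.
apply: (le_trans (ler_wpM2l s2 s1)); rewrite mulrDr mulr1 lerD2l mulrC.
by rewrite ler_wpM2l// mulr_ge0// ltW.
Qed.

(* These rates grow as the common neighbourhoods are expected to shrink, up to the relative error
   [2 * eps] in the decay, which makes the potential nonincreasing on average. *)
Let lp a t : R := lam / bp a ^+ t.
Let lm a t : R := lam / bm a ^+ t.
Definition dump_degree (F : {set {set T}}) (v : T) : nat := #|[set e in F | v \in e]|.
Let xi : R := rho * (4 * k%:R * theta * (N * d)).

(** At time [0] every summand is at most [2].  A sum that never exceeds its initial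
    bound keeps each exponent below [Lam], and so controls all the deviations at once. *)
Let Phi (t : nat) (S F : {set {set T}}) : R :=
  \sum_(j | admissible j) (expR (lp #|j.1| t * X S j - lam * X S0 j) +
     expR (- (lm #|j.1| t * X S j) + lam * X S0 j))
  + \sum_v 2 ^+ dump_degree F v / (1 + xi) ^+ t.

Let Phi0 : Phi 0 S0 set0 <= expR Lam.
Proof.
apply: le_trans tests_few; rewrite /Phi natrD natrM; apply: lerD.
  rewrite -sum1_card natr_sum mulr_sumr; apply: ler_sum => j _.
  by rewrite /lp /lm !expr0 !divr1 subrr addNr expR0; lra.
rewrite -sum1_card natr_sum; apply: ler_sum => v _.
suff -> : dump_degree set0 v = 0%N by rewrite !expr0 divr1.
by apply/eqP; rewrite cards_eq0 -subset0; apply/subsetP => e; rewrite !inE.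
Qed.

Let card_test j : admissible j -> (#|j.1| <= k)%N.
Proof.
rewrite /admissible; case: ifP => _ /andP[h _]//.
by rewrite (eqP h) ltnW.
Qed.

Let base_ge j : admissible j -> Y <= base j.
Proof.
rewrite /admissible /base; case: ifP => // _ /andP[jk _]; apply: base_power.
by apply: leq_trans jk; rewrite subset_leq_card// subsetIl.
Qed.

Let base_gt0 j : admissible j -> 0 < base j.
Proof. by move=> /base_ge/(lt_le_trans Y0). Qed.

Let xi0 : 0 <= xi.
Proof. by rewrite !mulr_ge0// ltW. Qed.

Let Phi_bounds t S F : (t <= m)%N -> Phi t S F <= expR Lam ->
  (forall j, admissible j ->
     (1 - theta) * (base j * g t ^+ #|j.1|) <= X S j <= (1 + theta) * (base j * g t ^+ #|j.1|))
  /\ forall v, 2 ^+ dump_degree F v <= expR Lam * (1 + xi) ^+ t.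
Proof.
move=> tm PL.
have D0 v : 0 <= 2 ^+ dump_degree F v / (1 + xi) ^+ t by rewrite divr_ge0 ?exprn_ge0 ?addr_ge0.
have E0 (j : {set T} * bool) : 0 <= expR (lp #|j.1| t * X S j - lam * X S0 j) +
     expR (- (lm #|j.1| t * X S j) + lam * X S0 j) by rewrite addr_ge0 ?expR_ge0.
split=> [j adj|v]; last first.
  rewrite -ler_pdivrMr ?exprn_gt0 ?ltr_wpDr//; apply: le_trans PL.
  rewrite /Phi (bigD1 v)//= addrCA lerDl addr_ge0// sumr_ge0//.
have ak := card_test adj.
have bj := base_gt0 adj; have bY := base_ge adj.
have /andP[X0lo X0up] := start adj.
have LT : Lam / lam <= tau * base j.
  rewrite ler_pdivrMr// (le_trans tau_big)// mulrAC ler_wpM2r ?(ltW lam0)// ler_wpM2l//.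
have TT : expR (lp #|j.1| t * X S j - lam * X S0 j) + expR (- (lm #|j.1| t * X S j) + lam * X S0 j) <= expR Lam.
  apply: le_trans PL; rewrite /Phi (bigD1 j)//= -addrA lerDl addr_ge0// sumr_ge0//.
have gp : 0 < g t ^+ #|j.1| by rewrite exprn_gt0.
apply/andP; split.
  have : - (lm #|j.1| t * X S j) + lam * X S0 j <= Lam.
    by rewrite -ler_expR (le_trans _ TT)// lerDr expR_ge0.
  have bt : 0 < bm #|j.1| ^+ t by rewrite exprn_gt0// bm_gt0.
  move=> h; have {h} h : bm #|j.1| ^+ t * (X S0 j - Lam / lam) <= X S j.
    rewrite -(ler_pM2l (_ : 0 < lm #|j.1| t)); last by rewrite divr_gt0.
    rewrite mulrA {1}/lm divfK ?gt_eqF// mulrBr [lam * (_ / _)]mulrC divfK ?gt_eqF//.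
    by lra.
  apply: le_trans h; apply: (@le_trans _ _ (bm #|j.1| ^+ t * ((1 - theta0 - tau) * base j))).
    have t1 : 0 <= 1 - theta by have := theta12; have := theta0'; lra.
    have t2 : 0 <= 1 - theta0 - tau.
      by rewrite -(pmulr_lge0 _ (expR_gt0 (- (4 * eps * k%:R)))); apply: le_trans theta_lo.
    set G := g t ^+ #|j.1| in gp *; set c := 1 - theta0 - tau in t2 *.
    apply: (@le_trans _ _ (base j * c * (G * expR (- (4 * eps * k%:R))))); last first.
      rewrite [leRHS]mulrC [c * _]mulrC ler_wpM2l ?mulr_ge0 ?(ltW bj)//.
      exact: bm_ge.
    have bG : 0 <= base j * G by rewrite mulr_ge0// ltW.
    have := ler_wpM2r bG theta_lo; rewrite -/c => h; apply: (le_trans h).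
    by rewrite le_eqVlt; apply/orP; left; apply/eqP; ring.
  rewrite ler_wpM2l ?(ltW bt)//; lra.
have : lp #|j.1| t * X S j - lam * X S0 j <= Lam.
  by rewrite -ler_expR (le_trans _ TT)// lerDl expR_ge0.
have bt : 0 < bp #|j.1| ^+ t by rewrite exprn_gt0// bp_gt0.
move=> h; have {}h : X S j <= bp #|j.1| ^+ t * (X S0 j + Lam / lam).
  rewrite -(ler_pM2l (_ : 0 < lp #|j.1| t)); last by rewrite divr_gt0.
  rewrite [leRHS]mulrA {2}/lp divfK ?gt_eqF// mulrDr [lam * (_ / _)]mulrC divfK ?gt_eqF//.
  by lra.
apply: (le_trans h); apply: (@le_trans _ _ (bp #|j.1| ^+ t * ((1 + theta0 + tau) * base j))).
  rewrite ler_wpM2l ?(ltW bt)//; lra.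
have t2 : 0 <= 1 + theta0 + tau by rewrite !addr_ge0.
set G := g t ^+ #|j.1| in gp *; set c := 1 + theta0 + tau in t2 *.
apply: (@le_trans _ _ (base j * c * (G * expR (2 * eps * k%:R)))).
  rewrite [leLHS]mulrC [c * _]mulrC ler_wpM2l ?mulr_ge0 ?(ltW bj)//.
  exact: bp_le.
have bG : 0 <= base j * G by rewrite mulr_ge0// ltW.
have := ler_wpM2r bG theta_up; rewrite -/c => h'; apply: le_trans h'.
by rewrite le_eqVlt; apply/orP; left; apply/eqP; ring.
Qed.

Let no_colour_pairS (S : {set {set T}}) : S \subset S0 -> forall e, e \in S -> (#|e :\: V| <= 1)%N.
Proof. by move=> /subsetP SS0 e /SS0; apply: no_colour_pair. Qed.

Let kappa0 : 0 <= kappa. Proof. by rewrite divr_ge0 ?mulr_ge0 ?expR_ge0// ltW. Qed.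

Let removal_dist t (S F : {set {set T}}) : (t <= m)%N -> S \subset S0 -> Phi t S F <= expR Lam ->
  exists q : {set T} -> R,
  [/\ forall Q, 0 <= q Q, \sum_Q q Q = 1,
      forall Q : {set T}, q Q != 0 -> [|| Q == set0, coloured_clique V k S Q | Q \in S],
      forall e, e \in S -> \sum_(Q : {set T} | e \subset Q) q Q = rho &
      forall B : {set T}, #|B| = 3%N -> \sum_(Q : {set T} | B \subset Q) q Q <= kappa * rho]
  /\ forall e, e \in S -> e \subset V -> q e <= rho * (2 * k%:R * theta).
Proof.
move=> tm SS0 /(Phi_bounds tm)[XS _].
have SV : S \subset vertex_pairs T := subset_trans SS0 S0V.
have gt := g_gt0 t.
have g1 : expR (-1) <= g t := g_ge tm.
apply: (uniform_removal SV k3 N0 M0 d0 gt theta0' theta12 (ltW rho_gt0) _ _ card_colours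
  (no_colour_pairS SS0) colours_enough).
- move=> B cB B1 Bk; have adB : admissible (B, true).
    by rewrite /admissible/= B1 leqnn andbT -(cardsID V B) B1 addn1.
  have := XS _ adB; rewrite /X /base /target/= -[in g t ^+ _](cardsID V B) B1 addn1.
  by rewrite !mulrA.
- move=> u v uV vV uvS; have uv : u != v by rewrite -in_vertex_pairs2 (subsetP SV).
  have ad : admissible ([set u; v], false).
    by rewrite /admissible/= cards2 uv eqxx subUset !sub1set uV vV.
  by have := XS _ ad; rewrite /X /base /target/= cards2 uv.
- rewrite mulrC -/rho ler_pdivrMr ?ltr0n// mul1r ler_nat.
  exact: leq_trans (subset_leq_card SS0) m_edges.
- have h2 := base_power (ltnW k3).
  have g5 : expR (- 5) <= g t ^+ 5.
    apply: (le_trans (_ : _ <= expR (-1) ^+ 5)).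
      by rewrite -expRM_natl mulrN1.
    by rewrite lerXn2r ?nnegrE ?expR_ge0// ltW.
  have Y5 : Y * expR (- 5) <= g t ^+ 2 * (N * d ^+ 2 * g t ^+ 3).
    have -> : g t ^+ 2 * (N * d ^+ 2 * g t ^+ 3) = N * d ^+ 2 * g t ^+ 5 by ring.
    by apply: ler_pM; rewrite ?expR_ge0// ltW.
  have Y50 : 0 < Y * expR (-5) by rewrite mulr_gt0 ?expR_gt0.
  have -> : kappa = k%:R * (Y * expR (- 5))^-1.
    by rewrite /kappa invfM expRN invrK -mulrA [expR 5 * _]mulrC.
  apply: ler_wpM2l => //.
  by rewrite lef_pV2// posrE// (lt_le_trans Y50).
have M2 : Y * expR (- 2) <= M * g t ^+ 2.
  apply: ler_pM; rewrite ?expR_ge0 ?(ltW Y0)//.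
  apply: (le_trans (_ : _ <= expR (-1) ^+ 2)).
    by rewrite -expRM_natl mulrN1.
  by rewrite lerXn2r ?nnegrE ?expR_ge0// ltW.
have Y20 : 0 < Y * expR (-2) by rewrite mulr_gt0 ?expR_gt0.
apply: (@le_trans _ _ (Y * expR (-2))^-1).
  by rewrite lef_pV2// posrE// (lt_le_trans Y20).
rewrite invfM expRN invrK mulrC /kappa ler_wpM2r ?invr_ge0 ?(ltW Y0)//.
rewrite -[leLHS]mul1r ler_pM ?expR_ge0// ?ler1n ?(leq_trans _ k3)// ler_expR ler_nat//.
Qed.
Let lp_step a t : (a <= k)%N -> lp a t.+1 * (1 - a%:R * rho * (1 - 2 * eps)) = lp a t.
Proof.
move=> ak; rewrite -/(bp a) /lp exprSr invfM mulrA -mulrA mulVf ?mulr1//.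
by rewrite gt_eqF ?bp_gt0.
Qed.

Let lm_step a t : (a <= k)%N -> lm a t.+1 * (1 - a%:R * rho * (1 + 2 * eps)) = lm a t.
Proof.
move=> ak; rewrite -/(bm a) /lm exprSr invfM mulrA -mulrA mulVf ?mulr1//.
by rewrite gt_eqF ?bm_gt0.
Qed.

Let lm_small a t : (a <= k)%N -> (t <= m)%N -> lm a t * k.+1%:R <= eps.
Proof.
move=> ak tm; apply: le_trans lam_small; rewrite ler_wpM2r// /lm ler_wpM2l ?(ltW lam0)//.
rewrite -[expR (_ + _)]invrK lef_pV2 ?posrE ?invr_gt0 ?expR_gt0 ?exprn_gt0 ?bm_gt0//.
apply: le_trans (bm_ge ak tm); rewrite -expRN opprD expRD ler_wpM2r ?expR_ge0//.
apply: (@le_trans _ _ (expR (-1) ^+ a)).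
  by rewrite -expRM_natl ler_expR mulrN1 lerN2 ler_nat.
by rewrite lerXn2r ?nnegrE ?expR_ge0 ?(ltW (g_gt0 _)) ?g_ge.
Qed.

Let lp_lm a t : (a <= k)%N -> 0 <= lp a t <= lm a t.
Proof.
move=> ak; rewrite divr_ge0 ?exprn_ge0 ?(ltW (bp_gt0 _)) ?(ltW lam0)//=.
rewrite /lp /lm ler_wpM2l ?(ltW lam0)// lef_pV2 ?posrE ?exprn_gt0 ?bm_gt0 ?bp_gt0//.
by rewrite lerXn2r ?nnegrE ?(ltW (bp_gt0 _)) ?(ltW (bm_gt0 _))// bm_bp.
Qed.

Let dump_step t (S F : {set {set T}}) (q : {set T} -> R) v :
  (t <= m)%N -> S \subset S0 -> Phi t S F <= expR Lam ->
  (forall Q, 0 <= q Q) -> \sum_Q q Q = 1 ->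
  (forall e, e \in S -> e \subset V -> q e <= rho * (2 * k%:R * theta)) ->
  \sum_Q q Q * 2 ^+ dump_degree (next_dumps V S F Q) v <= 2 ^+ dump_degree F v * (1 + xi).
Proof.
move=> tm SS0 PL q0 q1 qd; have SV : S \subset vertex_pairs T := subset_trans SS0 S0V.
have step (Q : {set T}) : q Q * 2 ^+ dump_degree (next_dumps V S F Q) v <=
    2 ^+ dump_degree F v * (q Q + if [&& Q \in S, Q \subset V & v \in Q] then q Q else 0).
  rewrite mulrC; have -> : q Q + (if [&& Q \in S, Q \subset V & v \in Q] then q Q else 0) =
    (1 + ([&& Q \in S, Q \subset V & v \in Q])%:R) * q Q.
    by case: ifP => _ /=; rewrite ?addr0 ?mulrDl !mul1r.
  rewrite mulrA ler_wpM2r// /next_dumps.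
  have [QS|QS] := boolP (Q \in S); last by rewrite /= addr0 mulr1.
  have [QV|QV] := boolP (Q \subset V); last by rewrite /= addr0 mulr1.
  have [vQ|vQ] := boolP (v \in Q) => /=; last first.
    rewrite addr0 mulr1 ler_weXn2l ?ler1n//; apply/subset_leq_card/subsetP => e.
    by rewrite !inE; case: eqP => [->|]//=; rewrite (negbTE vQ).
  rewrite -[1 + 1%:R]/(2%:R) -exprSr ler_weXn2l ?ler1n//.
  apply: leq_trans (_ : #|Q |: [set e in F | v \in e]| <= _)%N; last first.
    by rewrite cardsU1 -add1n leq_add2r; case: (_ \notin _).
  apply/subset_leq_card/subsetP => e; rewrite !inE => /andP[/orP[->//|->] ->].
  by rewrite orbT.
apply: (le_trans (ler_sum _ (fun Q _ => step Q))).
rewrite -mulr_sumr ler_wpM2l ?exprn_ge0// big_split/= q1 lerD2l -big_mkcond/=.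
apply: (@le_trans _ _ (\sum_(Q : {set T} | [&& Q \in S, Q \subset V & v \in Q]) rho * (2 * k%:R * theta))).
  by apply: ler_sum => Q /and3P[QS QV _]; apply: qd.
rewrite sumr_const -[leLHS]mulr_natr.
have -> : xi = rho * (2 * k%:R * theta) * (2 * (N * d)) by rewrite /xi; ring.
rewrite ler_wpM2l ?mulr_ge0 ?(ltW rho_gt0)//.
apply: (@le_trans _ _ ((v \in V) * #|common_nbrs S [set v] V|)%:R).
  rewrite ler_nat; apply: leq_trans (card_edges_at V v SV); rewrite leq_eqVlt; apply/orP; left.
  by apply/eqP/eq_card => Q; rewrite !inE.
have [vV|_] := boolP (v \in V); last by rewrite mul0n !mulr_ge0// ltW.
rewrite mul1n; have ad : admissible ([set v], true).
  rewrite /admissible/= cards1 (leq_trans _ k3)//= (_ : [set v] :\: V = set0) ?cards0//.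
  by apply/eqP; rewrite setD_eq0 sub1set.
have [/(_ _ ad)/andP[_ up] _] := Phi_bounds tm PL; apply: (le_trans up).
rewrite /base/= (setIidPl _) ?sub1set// cards1 !expr1 mulrA.
have Nd : 0 <= N * d by rewrite mulr_ge0// ltW.
have t0 := theta0'; have t2 := theta12; have gt := g_le1 t; have gt0 := g_gt0 t.
apply: (@le_trans _ _ ((1 + theta) * (N * d))).
  by rewrite ler_piMr// mulr_ge0// addr_ge0.
by rewrite ler_wpM2r//; lra.
Qed.

Let Phi_step t (S F QQ : {set {set T}}) : (t < m)%N -> removal_state V k S0 S F QQ ->
  Phi t S F <= expR Lam ->
  exists S' F' QQ', removal_state V k S0 S' F' QQ' /\ Phi t.+1 S' F' <= expR Lam.
Proof.
move=> tm st PL; have tm' := ltnW tm.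
have SS0 : S \subset S0 by case: st.
have SV : S \subset vertex_pairs T := subset_trans SS0 S0V.
have [q [[q0 q1 qsupp qmarg qtrip] qd]] := removal_dist tm' SS0 PL.
suff /(averaging q0 q1)[Q [/qsupp QQ1 PQ]] :
    \sum_Q q Q * Phi t.+1 (S :\: pairs_in Q) (next_dumps V S F Q) <= Phi t S F.
  exists (S :\: pairs_in Q), (next_dumps V S F Q), (next_cliques V k S QQ Q); split.
    by apply: removal_state_next => //; exact: ltnW.
  exact: le_trans PQ PL.
have qsupp' (Q : {set T}) : (k.+1 < #|Q|)%N -> q Q = 0.
  move=> kQ; apply/eqP; apply: contraTT kQ => /qsupp; rewrite -leqNgt => /or3P[/eqP ->|cQ|QS].
  - by rewrite cards0.
  - by rewrite (card_coloured_clique cQ).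
  - by move: (subsetP SV Q QS); rewrite inE => /eqP ->; exact: leqW (ltnW k3).
have qtrip' (z a a' : T) : [set z; a] \in S -> [set z; a'] \in S -> a != a' ->
    \sum_(Q : {set T} | [set z; a; a'] \subset Q) q Q <= kappa * rho.
  move=> zaS za'S aa'; apply: qtrip.
  move: (subsetP SV _ zaS) (subsetP SV _ za'S); rewrite !in_vertex_pairs2 => za za'.
  rewrite setUC cardsU1 cards2 za !inE negb_or eq_sym za' eq_sym aa'//.
rewrite /Phi.
under eq_bigr => Q _ do rewrite mulrDr !mulr_sumr.
rewrite big_split/= exchange_big/= [X in _ + X <= _]exchange_big/=.
apply: lerD; [apply: ler_sum => j adj|apply: ler_sum => v _].
  have ak := card_test adj.
  under eq_bigr => Q _ do rewrite mulrDr.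
  rewrite big_split/=; apply: lerD.
    rewrite [leRHS]expRD; under eq_bigr => Q _ do rewrite expRD mulrA.
    rewrite -mulr_suml ler_wpM2r ?expR_ge0//.
    have /andP[l0 l1] := lp_lm t.+1 ak.
    have mu1 : lp #|j.1| t.+1 * k.+1%:R <= eps.
      by apply: le_trans (lm_small ak tm); rewrite ler_wpM2r.
    have ak1 : #|j.1|%:R * kappa <= eps.
      by apply: le_trans kappa_small; rewrite ler_wpM2r ?ler_nat ?kappa0.
    have e1 : eps <= 1 by have := eps4; have := eps0; lra.
    have := expect_expR_le SV q0 kappa0 q1 qsupp' qmarg qtrip' (target j) l0 mu1 ak1 e1 (ltW rho_gt0).
    by rewrite lp_step.
  rewrite [leRHS]expRD; under eq_bigr => Q _ do rewrite expRD mulrA.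
  rewrite -mulr_suml ler_wpM2r ?expR_ge0//.
  have /andP[l0 l1] := lp_lm t.+1 ak.
  have mu1 : lm #|j.1| t.+1 * k.+1%:R <= eps := lm_small ak tm.
  have e1 : eps <= 1 / 2 by have := eps4; have := eps0; lra.
  have := expect_expRN_le SV q0 q1 qsupp' qmarg j.1 (target j) (le_trans l0 l1) mu1 e1 (ltW rho_gt0).
  by rewrite lm_step.
rewrite [leRHS]mulrC; under eq_bigr => Q _ do rewrite mulrA.
rewrite -mulr_suml; have := dump_step v tm' SS0 PL q0 q1 qd => h.
rewrite exprS invfM mulrA; have xi1 : 0 < 1 + xi by rewrite ltr_wpDr.
rewrite [leRHS]mulrC ler_wpM2r ?invr_ge0 ?exprn_ge0 ?(ltW xi1)//.
by rewrite ler_pdivrMr.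
Qed.

Let Phi_end t : (t <= m)%N -> exists S F QQ,
  removal_state V k S0 S F QQ /\ Phi t S F <= expR Lam.
Proof.
elim: t => [_|t IH tm].
  by exists S0, set0, set0; split; [exact: removal_state_init|exact: Phi0].
by have [S [F [QQ [st PL]]]] := IH (ltnW tm); exact: Phi_step tm st PL.
Qed.

Lemma coloured_phase_steps : exists S F QQ,
  [/\ removal_state V k S0 S F QQ,
     forall A : {set T}, A \subset V -> (#|A| <= k)%N ->
       (1 - theta) * (N * (d / expR 1) ^+ #|A|) <= #|common_nbrs S A V|%:R <=
       (1 + theta) * (N * (d / expR 1) ^+ #|A|) &
     forall v, 2 ^+ dump_degree F v <= expR (Lam + 4 * k%:R * theta * (N * d))].
Proof.
have [S [F [QQ [st PL]]]] := Phi_end (leqnn m).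
have [XS DF] := Phi_bounds (leqnn m) PL.
exists S, F, QQ; split => // [A AV Ak|v].
  have ad : admissible (A, true).
    by rewrite /admissible/= Ak (_ : A :\: V = set0) ?cards0//; apply/eqP; rewrite setD_eq0.
  have := XS _ ad; rewrite /X /base/= (setIidPl AV) /g /rho divff ?pnatr_eq0 -?lt0n//.
  by rewrite expRN -mulrA -exprMn.
apply: (le_trans (DF v)); rewrite expRD ler_wpM2l ?expR_ge0//.
have -> : 4 * k%:R * theta * (N * d) = m%:R * xi.
  by rewrite /xi /rho mulVKf// pnatr_eq0 -lt0n.
by rewrite expRM_natl lerXn2r ?nnegrE ?expR_ge0 ?addr_ge0// expR_ge1Dx.
Qed.
End Steps.

(** At the end of the [m] steps each edge has survived with probability about [expR (- 1)]. *)
Lemma coloured_phase : exists S F QQ,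
  [/\ removal_state V k S0 S F QQ,
     forall A : {set T}, A \subset V -> (#|A| <= k)%N ->
       (1 - theta) * (N * (d / expR 1) ^+ #|A|) <= #|common_nbrs S A V|%:R <=
       (1 + theta) * (N * (d / expR 1) ^+ #|A|) &
     forall v, 2 ^+ dump_degree F v <= expR (Lam + 4 * k%:R * theta * (N * d))].
Proof.
pose b := Num.Def.archi_bound (4 * k%:R / eps).
apply: (@coloured_phase_steps (b + #|S0|).+1) => //; last by rewrite -addSn leq_addl.
rewrite [leRHS]mulrC -ler_pdivrMr//; apply: (@le_trans _ _ b%:R).
  have h : 0 <= 4 * k%:R / eps by rewrite divr_ge0 ?mulr_ge0// ltW.
  exact: (ltW (archi_boundP h)).
by rewrite ler_nat -addnS leq_addr.
Qed.

End ColouredPhase.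

(** * One phase of clique packing *)

Section CountSmallSets.
Variable T : finType.

Lemma card_small_sets (k : nat) : (#|[set A : {set T} | #|A| <= k]| <= #|T|.+1 ^ k)%N.
Proof.
pose code (f : {ffun 'I_k -> option T}) : {set T} := [set x | [exists i, f i == Some x]].
have -> : (#|T|.+1 ^ k = #|{ffun 'I_k -> option T}|)%N.
  by rewrite card_ffun card_option card_ord.
rewrite -cardsT; apply: leq_trans (leq_imset_card code _).
apply/subset_leq_card/subsetP => A; rewrite inE => Ak.
have [->|/set0Pn[x0 _]] := eqVneq A set0.
  apply/imsetP; exists [ffun => None]; rewrite ?inE//.
  by apply/setP => x; rewrite !inE; apply/esym/existsP => -[i]; rewrite ffunE.
apply/imsetP; exists [ffun i : 'I_k => if (i < #|A|)%N then Some (nth x0 (enum A) i) else None].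
  by rewrite inE.
apply/setP => x; rewrite inE; apply/idP/existsP => [xA|[i]].
  have xi : (index x (enum A) < #|A|)%N by rewrite cardE index_mem mem_enum.
  exists (Ordinal (leq_trans xi Ak)); rewrite ffunE/= xi nth_index ?mem_enum//.
rewrite ffunE; case: ifP => // iA /eqP[<-].
by rewrite -mem_enum mem_nth// -cardE.
Qed.

End CountSmallSets.

Section Phase.
Variables (R : realType) (W : finType) (M : nat).
Implicit Types (H F P : {set {set W}}) (A K : {set W}).

(** The pseudo-randomness that is inherited from phase to phase, with a growing error
    [theta]; the case of a single vertex controls the degrees. *)
Definition typical H (k : nat) (d theta : R) : bool :=
  [forall A : {set W}, (#|A| <= k)%N ==>
    ((1 - theta) * (#|W|%:R * d ^+ #|A|) <= #|common_nbrs H A setT|%:R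
       <= (1 + theta) * (#|W|%:R * d ^+ #|A|))].

Lemma typicalP H k d theta : reflect (forall A : {set W}, (#|A| <= k)%N ->
    (1 - theta) * (#|W|%:R * d ^+ #|A|) <= #|common_nbrs H A setT|%:R
       <= (1 + theta) * (#|W|%:R * d ^+ #|A|)) (typical H k d theta).
Proof.
by apply: (iffP forallP) => h A; [move=> Ak; move: (h A); rewrite Ak|apply/implyP/h].
Qed.

Let T : finType := (W + 'I_M)%type.
Let V : {set T} := [set x | if x is inl _ then true else false].
Let up (A : {set W}) : {set T} := [set inl x | x in A].
Let down (A : {set T}) : {set W} := [set x | inl x \in A].

Let in_up A x : (inl x \in up A) = (x \in A).
Proof. by apply/imsetP/idP => [[y yA [->]]//|xA]; exists x. Qed.

Let inr_up A c : (inr c \in up A) = false.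
Proof. by apply/imsetP => -[]. Qed.

Let up_inj : injective up. Proof. by apply: imset_inj => x y []. Qed.

Let downK (A : {set T}) : up (down A) = A :&: V.
Proof.
apply/setP => -[x|c]; rewrite !inE; first by rewrite in_up inE andbT.
by rewrite inr_up andbF.
Qed.

Let card_up A : #|up A| = #|A|. Proof. by apply: card_imset => x y []. Qed.

Let card_down (A : {set T}) : #|down A| = #|A :&: V|. Proof. by rewrite -downK card_up. Qed.

Let up_sub A (B : {set T}) : (up A \subset B) = (A \subset down B).
Proof.
apply/subsetP/subsetP => h x; first by move=> xA; rewrite inE h// in_up.
by move=> /imsetP[y /h + ->]; rewrite inE.
Qed.

Let upV A : up A \subset V.
Proof. by apply/subsetP => x /imsetP[y _ ->]; rewrite inE. Qed.

Let up2 x y : up [set x; y] = [set inl x; inl y].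
Proof. by rewrite /up imsetU1 imset_set1. Qed.

(** At the beginning of a phase every colour is available everywhere. *)
Definition join_colours H : {set {set T}} :=
  [set up e | e in H] :|: [set e | [exists w, exists c, e == [set inl w; inr c]]].

Let edge_ll H x y : ([set inl x; inl y] \in join_colours H) = ([set x; y] \in H).
Proof.
rewrite -up2 inE mem_imset//; apply/orP/idP => [[//|]|->]; last by left.
rewrite inE => /existsP[w /existsP[c /eqP/setP/(_ (inr c))]].
by rewrite inr_up !inE eqxx orbT.
Qed.

Let edge_up H e : (up e \in join_colours H) = (e \in H).
Proof.
rewrite inE mem_imset//; apply/orP/idP => [[//|]|->]; last by left.
rewrite inE => /existsP[w /existsP[c /eqP/setP/(_ (inr c))]].
by rewrite inr_up !inE eqxx orbT.
Qed.

Let edge_lr H x c : [set inl x; inr c] \in join_colours H.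
Proof. by rewrite !inE; apply/orP; right; apply/existsP; exists x; apply/existsP; exists c. Qed.

Let join_vertex_pairs H : H \subset vertex_pairs W -> join_colours H \subset vertex_pairs T.
Proof.
move=> /subsetP HV; apply/subsetP => e; rewrite in_setU => /orP[/imsetP[f /HV + ->]|].
  by rewrite !inE card_up.
by rewrite inE => /existsP[w /existsP[c /eqP->]]; rewrite in_vertex_pairs2.
Qed.

Let join_one_colour H e : e \in join_colours H -> (#|e :\: V| <= 1)%N.
Proof.
rewrite in_setU => /orP[/imsetP[f _ ->]|].
  by rewrite (_ : up f :\: V = set0) ?cards0//; apply/eqP; rewrite setD_eq0.
rewrite inE => /existsP[w /existsP[c /eqP->]].
rewrite -(cards1 (inr c : T)); apply/subset_leq_card/subsetP => -[x|c'] //; rewrite !inE//.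
Qed.

Let nbrs_up (S : {set {set T}}) H A : H = [set e | up e \in S] ->
  #|common_nbrs S (up A) V| = #|common_nbrs H A setT|.
Proof.
move=> HS; rewrite -card_up; apply: eq_card => -[x|c]; last first.
  by rewrite inr_up; apply/negbTE/negP => /common_nbrsP[]; rewrite inE.
rewrite in_up; apply/common_nbrsP/common_nbrsP => -[_ h]; split=> //; rewrite ?inE//.
  by move=> a aA; rewrite HS inE up2; apply: h; rewrite in_up.
by move=> _ /imsetP[a aA ->]; have := h a aA; rewrite HS inE up2.
Qed.

Let nbrs_start H (A : {set T}) :
  #|common_nbrs (join_colours H) A V| = #|common_nbrs H (down A) setT|.
Proof.
rewrite -card_up; apply: eq_card => -[x|c]; last first.
  by rewrite inr_up; apply/negbTE/negP => /common_nbrsP[]; rewrite inE.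
rewrite in_up; apply/common_nbrsP/common_nbrsP => -[_ h]; split=> //; rewrite ?inE//.
  by move=> a; rewrite inE => /h; rewrite edge_ll.
by move=> [a|c] aA; [rewrite edge_ll; apply: h; rewrite inE|exact: edge_lr].
Qed.

Let card_colours : #|~: V| = M.
Proof.
rewrite -[RHS](card_ord M) -cardsT -(card_imset _ (inr_inj : injective (inr : 'I_M -> T))).
apply: eq_card => -[x|c]; rewrite !inE.
  by apply/esym/negbTE/negP => /imsetP[].
by apply/esym/imsetP; exists c.
Qed.

Let card_T : #|T| = (#|W| + M)%N. Proof. by rewrite card_sum card_ord. Qed.

Variables (H : {set {set W}}) (k : nat) (d theta0 theta tau eps lam Lam Y : R).
Hypotheses (HV : H \subset vertex_pairs W) (W0 : (0 < #|W|)%N) (M0 : (0 < M)%N).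
Hypotheses (k3 : (3 <= k)%N) (d0 : 0 < d).
Hypothesis colours_enough : #|W|%:R * d <= (k%:R - 1) * M%:R.
Hypothesis Htyp : typical H k d theta0.
Hypotheses (Y0 : 0 < Y) (lam0 : 0 < lam) (theta00 : 0 <= theta0) (tau0 : 0 <= tau).
Hypotheses (theta0' : 0 <= theta) (theta12 : 2 * theta <= 1).
Hypotheses (eps0 : 0 < eps) (eps4 : 4 * eps <= 1).
Hypothesis base_power : forall j : nat, (j <= k)%N -> Y <= #|W|%:R * d ^+ j.
Hypothesis base_colour : Y <= M%:R.
Hypothesis tests_few : (5 * (#|W| + M).+1 ^ k)%:R <= expR Lam.
Hypothesis tau_big : Lam <= tau * lam * Y.
Hypothesis theta_up : (1 + theta0 + tau) * expR (2 * eps * k%:R) <= 1 + theta.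
Hypothesis theta_lo : 1 - theta <= (1 - theta0 - tau) * expR (- (4 * eps * k%:R)).
Hypothesis lam_small : lam * expR (k%:R + 4 * eps * k%:R) * k.+1%:R <= eps.
Hypothesis kappa_small : k%:R * (k%:R * expR 5 / Y) <= eps.

Let arith (x y z : nat) : (z < x -> y <= x * 2 -> 2 * y + z <= 5 * x)%N.
Proof. by clear; lia. Qed.

Let few : (2 * #|[pred j | admissible V k j]| + #|T|)%:R <= expR Lam.
Proof.
apply: le_trans tests_few; rewrite ler_nat -card_T.
have h1 : (#|[pred j | admissible V k j]| <= #|[set A : {set T} | #|A| <= k]%N| * #|{: bool}|)%N.
  rewrite -[#|{: bool}|]cardsT -cardsX; apply/subset_leq_card/subsetP => -[A b].
  rewrite !inE /admissible/= andbT; case: b => /andP[h _] //.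
  by rewrite (eqP h) ltnW.
have h2 := card_small_sets T k; rewrite card_bool in h1.
have h3 : (#|T|.+1 <= #|T|.+1 ^ k)%N by rewrite -[X in (X <= _)%N]expn1 leq_pexp2l// (leq_trans _ k3).
have := leq_trans h1 (leq_mul h2 (leqnn 2)); move: h3.
exact: arith.
Qed.

Let start (j : {set T} * bool) : admissible V k j ->
  (1 - theta0) * base V #|W|%:R M%:R d j <= #|common_nbrs (join_colours H) j.1 (target V j)|%:R
   <= (1 + theta0) * base V #|W|%:R M%:R d j.
Proof.
case: j => A [] ; rewrite /admissible /base /target/= => /andP[Ak AV].
  rewrite nbrs_start -card_down; apply: (typicalP _ _ _ _ Htyp).
  by rewrite card_down (leq_trans _ Ak)// subset_leq_card// subsetIl.
rewrite (_ : common_nbrs _ _ _ = ~: V); last first.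
  apply/setP => z; apply/common_nbrsP/idP => [[]//|zC]; split=> // a /(subsetP AV).
  case: z zC => [z|c _]; first by rewrite !inE.
  by case: a => [a _|c']; [rewrite setUC edge_lr|rewrite inE].
rewrite card_colours; have M1 : 0 <= M%:R :> R by []; have t0 := theta00.
by apply/andP; split; nra.
Qed.

(** The process on the vertices and the colours, translated back to the vertices alone.  The
    last clause bounds the numbers of dumped edges at the vertices in the exponential form
    in which the potential provides it. *)
Lemma phase : exists H' F P (col : {set W} -> nat),
  [/\ [/\ H' \subset H, F \subset H & typical H' k (d / expR 1) theta],
      forall K, K \in P -> clique H K && (#|K| == k),
      forall e, e \in H -> ((e \in H') + (e \in F) + #|[set K in P | e \subset K]| = 1)%N,
      (forall K, K \in P -> (col K < M)%N) /\
      (forall K L, K \in P -> L \in P -> K != L -> ~~ [disjoint K & L] -> col K != col L) &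
      forall v, 2 ^+ #|[set e in F | v \in e]| <= expR (Lam + 4 * k%:R * theta * (#|W|%:R * d))].
Proof.
have N0 : 0 < #|W|%:R :> R by rewrite ltr0n.
have M0' : 0 < M%:R :> R by rewrite ltr0n.
have cC : #|~: V|%:R = M%:R :> R by rewrite card_colours.
have [S [F [QQ [st XS DF]]]] := coloured_phase (join_vertex_pairs HV) (@join_one_colour H)
  k3 N0 M0' d0 cC colours_enough start base_power base_colour Y0 lam0 theta00 tau0
  theta0' theta12 eps0 eps4 few tau_big theta_up theta_lo lam_small kappa_small.
have [SS0 FS0 QQ0 cov1 covV] := st.
pose H' := [set e : {set W} | up e \in S]; pose F' := [set e : {set W} | up e \in F].
pose P := [set down Q | Q in QQ].
have H'H : H' \subset H by apply/subsetP => e; rewrite inE => /(subsetP SS0); rewrite edge_up.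
have F'H : F' \subset H by apply/subsetP => e; rewrite inE => /FS0[]; rewrite edge_up.
have QQclique Q : Q \in QQ -> clique H (down Q) && (#|down Q| == k).
  move=> /QQ0/and3P[/cliqueP cQ Qk _]; rewrite card_down Qk andbT.
  apply/cliqueP => x y; rewrite !inE => xQ yQ xy; rewrite -edge_ll; apply: cQ => //.
have uniqQ (Q Q' : {set T}) e : Q \in QQ -> Q' \in QQ -> e \in join_colours H ->
    e \subset Q -> e \subset Q' -> Q = Q'.
  move=> QQQ QQQ' eS eQ eQ'; have : (#|[set Q in QQ | e \subset Q]| <= 1)%N.
    by apply: leq_trans (cov1 e eS); rewrite leq_addl.
  by move=> /card_le1_eqP; apply; rewrite inE ?QQQ ?QQQ'.
have down_inj : {in QQ &, injective down}.
  move=> Q Q' QQQ QQQ' e.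
  have /andP[cQ /eqP Qk] := QQclique Q QQQ.
  have /card_gt1P[x [y [xQ yQ xy]]] : (1 < #|down Q|)%N by rewrite Qk ltnW.
  have uvH : [set x; y] \in H by move/cliqueP : cQ; apply.
  apply: (uniqQ Q Q' (up [set x; y])) => //; first by rewrite edge_up.
    by rewrite up_sub subUset !sub1set xQ.
  by rewrite up_sub -e subUset !sub1set xQ.
(* The value [0] for the sets outside [P] is arbitrary. *)
pose colour K : nat := if [pick c | [exists Q in QQ, (down Q == K) && (inr c \in Q)]] is Some c
  then nat_of_ord c else 0%N.
have colourP Q : Q \in QQ -> exists c : 'I_M, colour (down Q) = c /\ inr c \in Q.
  move=> QQQ; rewrite /colour; case: pickP => [c /existsP[Q' /and3P[QQQ' /eqP e cQ]]|].
    by exists c; split=> //; rewrite -(down_inj Q' Q).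
  have /and3P[_ _ /eqP Q1] := QQ0 Q QQQ.
  have /card_gt0P[z] : (0 < #|Q :\: V|)%N by rewrite Q1.
  case: z => [x|c]; rewrite !inE//= => cQ /(_ c)/negbT/negP[].
  by apply/existsP; exists Q; rewrite QQQ eqxx.
exists H', F', P, colour; split.
- split => //; apply/typicalP => A Ak.
  by rewrite -(nbrs_up (S := S))// -(card_up A); apply: XS; rewrite ?upV ?card_up.
- by move=> K /imsetP[Q QQQ ->]; exact: QQclique.
- move=> e eH; have eV := upV e; have eS : up e \in join_colours H by rewrite edge_up.
  rewrite -(covV _ eS eV) /coverage !inE; congr (_ + _)%N.
  rewrite -(card_in_imset (f := down) (D := [set Q in QQ | up e \subset Q])); last first.
    by move=> Q Q'; rewrite !inE => /andP[QQQ _] /andP[QQQ' _]; exact: down_inj.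
  apply: eq_card => K; rewrite inE; apply/andP/imsetP => [[/imsetP[Q QQQ ->] eQ]|[Q]].
    by exists Q; rewrite // inE QQQ up_sub.
  by rewrite inE => /andP[QQQ eQ] ->; rewrite -up_sub eQ; split=> //; apply: imset_f.
- split=> [K /imsetP[Q QQQ ->]|K L /imsetP[Q QQQ ->] /imsetP[Q' QQQ' ->] QQ' ].
    by have [c [-> _]] := colourP Q QQQ.
  move=> /pred0Pn[x /=/andP[]]; rewrite !inE => xQ xQ'; apply: contraNN QQ' => /eqP.
  have [c [-> cQ]] := colourP Q QQQ; have [c' [-> cQ']] := colourP Q' QQQ'.
  move=> /val_inj cc'; rewrite -cc' in cQ'; apply/eqP; congr down.
  by apply: (uniqQ _ _ [set inl x; inr c]); rewrite ?edge_lr// subUset !sub1set ?xQ ?xQ'.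
- move=> v; apply: le_trans (DF (inl v)); rewrite ler_weXn2l ?ler1n//.
  rewrite -(card_imset _ up_inj); apply/subset_leq_card/subsetP => f /imsetP[e].
  by rewrite !inE => /andP[eF ve] ->; rewrite eF in_up.
Qed.

End Phase.

(** * Common neighbourhoods in the binomial random graph *)

Section RandomGraph.
Variables (R : realType) (n : nat) (p : R).
Hypotheses (p0 : 0 <= p) (p1 : p <= 1).
Implicit Types (E S : {set {set 'I_n}}) (A Z : {set 'I_n}).
Local Notation VP := (vertex_pairs 'I_n).

Definition gnp_expect (f : {set {set 'I_n}} -> R) : R :=
  \sum_(E : {set {set 'I_n}} | E \subset VP) gnp_weight p E * f E.

Lemma gnp_weight_ge0 E : 0 <= gnp_weight p E.
Proof. by apply: prodr_ge0 => e _; case: ifP => _; rewrite ?subr_ge0. Qed.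

Lemma gnp_probE (P : pred {set {set 'I_n}}) :
  gnp_prob p P = gnp_expect (fun E => (P E)%:R).
Proof.
rewrite /gnp_prob /gnp_expect big_mkcondr/=; apply: eq_bigr => E _.
by case: (P E); rewrite ?mulr1 ?mulr0.
Qed.

Lemma gnp_expect_le f h : (forall E, E \subset VP -> f E <= h E) ->
  gnp_expect f <= gnp_expect h.
Proof. by move=> fh; apply: ler_sum => E EV; rewrite ler_wpM2l ?gnp_weight_ge0 ?fh. Qed.

(** Expanding [\prod_e (F e + G e)] over the sets of edges, with summands that vanish unless the
    set contains [S] and consists of pairs. *)
Lemma gnp_prob_supset S : S \subset VP ->
  gnp_expect (fun E => (S \subset E)%:R) = p ^+ #|S|.
Proof.
move=> SV; pose F (e : {set 'I_n}) : R := if e \in VP then p else 0.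
pose G (e : {set 'I_n}) : R := if e \in VP then (if e \in S then 0 else 1 - p) else 1.
have := bigA_distr 1 (GRing.add : Monoid.add_law _ _) F G.
have -> : \prod_e (F e + G e) = p ^+ #|S|.
  rewrite -prodr_const [RHS]big_mkcond; apply: eq_bigr => e _; rewrite /F /G.
  have [eV|eV] := boolP (e \in VP); last first.
    by rewrite add0r; case: ifP => // eS; rewrite (subsetP SV e eS) in eV.
  by case: ifP => _; rewrite ?addr0 // addrC subrK.
move=> ->; rewrite /gnp_expect big_mkcond; apply: eq_bigr => E _.
have [EV|/subsetPn[e eE eV]] := boolP (E \subset VP); last first.
  by rewrite (bigD1 e)//= eE /F (negbTE eV) mul0r.
rewrite /gnp_weight; have [SE|/subsetPn[e eS eE]] := boolP (S \subset E); last first.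
  rewrite mulr0 (bigD1 e)//= (negbTE eE) /G eS (subsetP SV e eS) mul0r//.
rewrite mulr1 big_mkcond; apply: eq_bigr => e _; rewrite /F /G.
have [eV|eV] := boolP (e \in VP); last first.
  by case: ifP => // eE; rewrite (subsetP EV e eE) in eV.
case: ifP => // eE; case: ifP => // eS; by rewrite (subsetP SE e eS) in eE.
Qed.

Lemma gnp_expect1 : gnp_expect (fun=> 1) = 1.
Proof.
rewrite -[RHS](expr0 p) -(cards0 {set 'I_n}) -gnp_prob_supset ?sub0set//.
by apply: eq_bigr => E _; rewrite sub0set.
Qed.

Definition stars A Z : {set {set 'I_n}} := [set [set u.1; u.2] | u in finset.setX Z A].

Lemma card_stars A Z : Z \subset ~: A -> #|stars A Z| = (#|Z| * #|A|)%N.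
Proof.
move=> /subsetP ZA; rewrite -cardsX; apply: card_in_imset => -[z a] [z' a'].
rewrite !in_setX/= => /andP[zZ aA] /andP[zZ' aA'] /setP e.
have zz' : z = z'.
  have := e z; rewrite !inE eqxx/= => /esym/orP[/eqP//|/eqP za'].
  by have := ZA z zZ; rewrite inE za' aA'.
congr pair => //; have := e a; rewrite !inE eqxx orbT => /esym/orP[/eqP az|/eqP//].
by have := ZA z' zZ'; rewrite inE -az aA.
Qed.

Lemma stars_sub A Z E : (stars A Z \subset E) = [forall z in Z, forall a in A, [set z; a] \in E].
Proof.
apply/subsetP/forallP => [h z|h e /imsetP[[z a]]].
  apply/implyP => zZ; apply/forallP => a; apply/implyP => aA; apply: h.
  by apply/imsetP; exists (z, a); rewrite ?in_setX ?zZ.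
rewrite in_setX/= => /andP[zZ aA] ->.
by have := h z; rewrite zZ => /forallP/(_ a); rewrite aA.
Qed.

Lemma stars_vertex_pairs A Z : Z \subset ~: A -> stars A Z \subset VP.
Proof.
move=> /subsetP ZA; apply/subsetP => e /imsetP[[z a]]; rewrite in_setX/= => /andP[zZ aA] ->.
by rewrite in_vertex_pairs2; apply: contraTneq (ZA z zZ) => ->; rewrite inE aA.
Qed.

Lemma subset_binomial (x : R) A :
  \sum_(Z : {set 'I_n} | Z \subset ~: A) x ^+ #|Z| = (1 + x) ^+ #|~: A|.
Proof.
have := bigA_distr 1 (GRing.add : Monoid.add_law _ _)
  (fun z : 'I_n => if z \in A then 0 else x) (fun=> 1).
have -> : \prod_(z : 'I_n) ((if z \in A then 0 else x) + 1) = (1 + x) ^+ #|~: A|.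
  rewrite -prodr_const [RHS]big_mkcond; apply: eq_bigr => z _.
  by rewrite inE; case: (z \in A); rewrite ?add0r//= addrC.
move=> ->; rewrite big_mkcond; apply: eq_bigr => Z _.
have [ZA|/subsetPn[z zZ zA]] := boolP (Z \subset ~: A); last first.
  by rewrite (bigD1 z)//= zZ; move: zA; rewrite inE negbK => ->; rewrite mul0r.
rewrite -prodr_const big_mkcond; apply: eq_bigr => z _; case: ifP => // zZ.
by have := subsetP ZA z zZ; rewrite inE => /negbTE ->.
Qed.

Lemma common_nbrs_binomial (x : R) A E : E \subset VP ->
  (1 + x) ^+ #|common_nbrs E A setT| =
  \sum_(Z : {set 'I_n} | Z \subset ~: A) x ^+ #|Z| * (stars A Z \subset E)%:R.
Proof.
move=> EV; pose C := common_nbrs E A setT.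
have CA : C \subset ~: A.
  by apply/subsetP => z /(common_nbrs_notin EV); rewrite inE.
rewrite -/C; rewrite -[C]setCK -subset_binomial big_mkcond [RHS]big_mkcond; apply: eq_bigr => Z _.
rewrite setCK.
have -> : (Z \subset C) = (Z \subset ~: A) && (stars A Z \subset E).
  rewrite stars_sub; apply/idP/andP => [ZC|[_ /forallP h]].
    split; first exact: subset_trans ZC CA.
    apply/forallP => z; apply/implyP => zZ; apply/forallP => a; apply/implyP => aA.
    by have /common_nbrsP[_] := subsetP ZC z zZ; apply.
  apply/subsetP => z zZ; apply/common_nbrsP; split; rewrite ?inE// => a aA.
  by have := h z; rewrite zZ => /forallP/(_ a); rewrite aA.
by case: (_ \subset _) => //=; case: (_ \subset _); rewrite ?mulr1 ?mulr0.
Qed.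

(** The stars from distinct vertices outside [A] to [A] are disjoint, so that the number of
    common neighbours of [A] is binomial; this is its generating function. *)
Lemma gnp_expect_common_nbrs (x : R) A :
  gnp_expect (fun E => (1 + x) ^+ #|common_nbrs E A setT|) = (1 + x * p ^+ #|A|) ^+ (n - #|A|).
Proof.
have -> : (n - #|A| = #|~: A|)%N by have := cardsC A; rewrite card_ord; lia.
rewrite -subset_binomial /gnp_expect.
under eq_bigr => E EV do rewrite (common_nbrs_binomial x A EV) mulr_sumr.
rewrite exchange_big/=; apply: eq_bigr => Z ZA.
rewrite exprMn -exprM mulnC -(card_stars ZA) -gnp_prob_supset ?stars_vertex_pairs//.
by rewrite mulr_sumr; apply: eq_bigr => E _; ring.
Qed.

Variable theta : R.
Hypotheses (theta0 : 0 < theta) (theta1 : theta <= 1).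

(** Chernoff bounds: the generating function at [1 + theta / 4] and at [1 - theta / 4]. *)
Lemma common_nbrs_upper_tail A :
  gnp_expect (fun E => ((1 + theta) * (n%:R * p ^+ #|A|) < #|common_nbrs E A setT|%:R)%R%:R)
    <= expR (- (n%:R * p ^+ #|A| * theta ^+ 2 / 8)).
Proof.
set mu := n%:R * p ^+ #|A|; have mu0 : 0 <= mu by rewrite mulr_ge0 ?exprn_ge0.
pose x := theta / 4; have t0 := theta0; have t1 := theta1.
have x0 : 0 <= x by rewrite /x; lra.
have xx : 0 <= x - x ^+ 2 by rewrite /x; nra.
pose c := expR (- ((x - x ^+ 2) * ((1 + theta) * mu))).
apply: (@le_trans _ _ (gnp_expect (fun E => c * (1 + x) ^+ #|common_nbrs E A setT|))).
  apply: gnp_expect_le => E _; case: ltP => [h|_]; last first.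
    by rewrite mulr_ge0 ?expR_ge0 ?exprn_ge0 ?addr_ge0.
  apply: (@le_trans _ _ (c * expR (x - x ^+ 2) ^+ #|common_nbrs E A setT|)).
    rewrite -expRM_natl -expRD -[leLHS]expR0 ler_expR addrC subr_ge0 mulrC.
    by rewrite ler_wpM2r// ltW.
  rewrite ler_wpM2l ?expR_ge0// lerXn2r ?nnegrE ?expR_ge0 ?addr_ge0//.
  exact: onep_ge_expR.
have -> : gnp_expect (fun E => c * (1 + x) ^+ #|common_nbrs E A setT|) =
    c * (1 + x * p ^+ #|A|) ^+ (n - #|A|).
  by rewrite -gnp_expect_common_nbrs mulr_sumr; apply: eq_bigr => E _; rewrite mulrCA.
apply: (@le_trans _ _ (c * expR (x * mu))).
  rewrite ler_wpM2l ?expR_ge0//.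
  have xp : 0 <= x * p ^+ #|A| by rewrite mulr_ge0 ?exprn_ge0.
  apply: (@le_trans _ _ ((1 + x * p ^+ #|A|) ^+ n)).
    by rewrite ler_weXn2l ?leq_subr// lerDl.
  rewrite (_ : x * mu = n%:R * (x * p ^+ #|A|)); last by rewrite /mu; ring.
  by rewrite expRM_natl lerXn2r ?nnegrE ?expR_ge0 ?addr_ge0 ?expR_ge1Dx.
rewrite /c -expRD ler_expR.
have : 0 <= mu * theta ^+ 2 * (1 - theta) by rewrite !mulr_ge0 ?exprn_ge0 ?subr_ge0// ltW.
by rewrite /x; lra.
Qed.

Lemma common_nbrs_lower_tail A :
  gnp_expect (fun E => (#|common_nbrs E A setT|%:R < (1 - theta) * (n%:R * p ^+ #|A|))%R%:R)
    <= expR (#|A|%:R - n%:R * p ^+ #|A| * theta ^+ 2 / 8).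
Proof.
set mu := n%:R * p ^+ #|A|; have mu0 : 0 <= mu by rewrite mulr_ge0 ?exprn_ge0.
pose x := theta / 4; have t0 := theta0; have t1 := theta1.
have x0 : 0 <= x by rewrite /x; lra.
have x12 : x <= 1 / 2 by rewrite /x; lra.
have x1 : 0 <= 1 - x by lra.
have xx : 0 <= x + 2 * x ^+ 2 by rewrite addr_ge0// mulr_ge0// exprn_ge0.
pose c := expR ((x + 2 * x ^+ 2) * ((1 - theta) * mu)).
apply: (@le_trans _ _ (gnp_expect (fun E => c * (1 + (- x)) ^+ #|common_nbrs E A setT|))).
  apply: gnp_expect_le => E _; case: ltP => [h|_]; last first.
    by rewrite mulr_ge0 ?expR_ge0 ?exprn_ge0.
  apply: (@le_trans _ _ (c * expR (- (x + 2 * x ^+ 2)) ^+ #|common_nbrs E A setT|)).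
    rewrite -expRM_natl -expRD -[leLHS]expR0 ler_expR mulrN subr_ge0 mulrC.
    by rewrite ler_wpM2l// ltW.
  rewrite ler_wpM2l ?expR_ge0// lerXn2r ?nnegrE ?expR_ge0//.
  exact: onem_ge_expR.
have -> : gnp_expect (fun E => c * (1 + (- x)) ^+ #|common_nbrs E A setT|) =
    c * (1 + (- x) * p ^+ #|A|) ^+ (n - #|A|).
  by rewrite -gnp_expect_common_nbrs mulr_sumr; apply: eq_bigr => E _; rewrite mulrCA.
have pA0 : 0 <= p ^+ #|A| by rewrite exprn_ge0.
have pA1 : p ^+ #|A| <= 1 by rewrite exprn_ile1.
have An : (#|A| <= n)%N by have := max_card A; rewrite card_ord.
apply: (@le_trans _ _ (c * expR (- (x * p ^+ #|A| * (n%:R - #|A|%:R))))).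
  rewrite ler_wpM2l ?expR_ge0//.
  have -> : - (x * p ^+ #|A| * (n%:R - #|A|%:R)) = (n - #|A|)%:R * (- x * p ^+ #|A|).
    by rewrite natrB//; ring.
  rewrite expRM_natl lerXn2r ?nnegrE ?expR_ge0 ?expR_ge1Dx//.
  by rewrite mulNr subr_ge0; nra.
rewrite /c -expRD ler_expR.
have -> : - (x * p ^+ #|A| * (n%:R - #|A|%:R)) = x * p ^+ #|A| * #|A|%:R - x * mu by rewrite /mu; ring.
have h1 : x * p ^+ #|A| * #|A|%:R <= #|A|%:R by rewrite ler_piMl// mulr_ile1//; lra.
have h2 : 0 <= mu * theta ^+ 3 by rewrite mulr_ge0// exprn_ge0// ltW.
rewrite -lerBrDr in h1 *.
move: h1; set u := x * _ * _; rewrite /x; set v := #|A|%:R => h1.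
have : theta ^+ 3 = theta ^+ 2 * theta by rewrite exprSr.
by move=> e3; rewrite e3 in h2; lra.
Qed.

(** A union bound over the sets of at most [k] vertices. *)
Lemma gnp_typical (k : nat) (Y : R) : (forall j, (j <= k)%N -> Y <= n%:R * p ^+ j) ->
  1 - 2 * n.+1%:R ^+ k * expR (k%:R - Y * theta ^+ 2 / 8) <=
  gnp_prob p (fun E => typical E k p theta).
Proof.
move=> hY; rewrite lerBlDr -[leLHS]gnp_expect1 -lerBlDl gnp_probE /gnp_expect -sumrB.
pose up A E : R := ((1 + theta) * (n%:R * p ^+ #|A|) < #|common_nbrs E A setT|%:R)%R%:R.
pose lo A E : R := (#|common_nbrs E A setT|%:R < (1 - theta) * (n%:R * p ^+ #|A|))%R%:R.
apply: (@le_trans _ _ (gnp_expect (fun E => \sum_(A in [set A : {set 'I_n} | (#|A| <= k)%N]) (up A E + lo A E)))).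
  apply: ler_sum => E EV; rewrite -mulrBr ler_wpM2l ?gnp_weight_ge0//.
  have [_|] := boolP (typical E k p theta).
    by rewrite subrr; apply: sumr_ge0 => A _; rewrite addr_ge0.
  move=> /forallPn[A]; rewrite negb_imply negb_and -!ltNge card_ord => /andP[Ak h].
  rewrite subr0 (bigD1 A)/= ?inE//; apply: le_trans (_ : up A E + lo A E <= _); last first.
    by rewrite lerDl; apply: sumr_ge0 => B _; rewrite addr_ge0.
  by rewrite /up /lo; case/orP : h => ->; rewrite ?lerDl ?lerDr.
rewrite /gnp_expect; under eq_bigr => E _ do rewrite mulr_sumr.
rewrite exchange_big/=.
apply: (@le_trans _ _ (\sum_(A in [set A : {set 'I_n} | (#|A| <= k)%N]) 2 * expR (k%:R - Y * theta ^+ 2 / 8))).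
  apply: ler_sum => A; rewrite inE => Ak; under eq_bigr => E _ do rewrite mulrDr.
  rewrite big_split/= mulr_natl mulr2n; have hA := hY _ Ak.
  have hYt : Y * theta ^+ 2 <= n%:R * p ^+ #|A| * theta ^+ 2 by rewrite ler_wpM2r// exprn_ge0// ltW.
  have kA : #|A|%:R <= k%:R :> R by rewrite ler_nat.
  have k0 : 0 <= k%:R :> R by [].
  apply: lerD.
    by apply: (le_trans (common_nbrs_upper_tail A)); rewrite ler_expR; lra.
  by apply: (le_trans (common_nbrs_lower_tail A)); rewrite ler_expR; lra.
have cardA : #|[set A : {set 'I_n} | (#|A| <= k)%N]|%:R <= n.+1%:R ^+ k :> R.
  by rewrite -natrX ler_nat; have := card_small_sets 'I_n k; rewrite card_ord.
rewrite sumr_const -[leLHS]mulr_natr mulrAC ler_wpM2r ?expR_ge0//.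
by rewrite ler_wpM2l.
Qed.

End RandomGraph.

(** * Edge colourings and partial clique partitions *)

Section EdgeColouring.
Variable T : finType.
Implicit Types (P : {set {set T}}) (K L : {set T}).

Lemma chromatic_index_le P (col : {set T} -> nat) (m : nat) :
  (forall K, K \in P -> (col K < m)%N) ->
  (forall K L, K \in P -> L \in P -> K != L -> ~~ [disjoint K & L] -> col K != col L) ->
  (chromatic_index P <= m)%N.
Proof.
move=> colm colP; rewrite /chromatic_index; case: ex_minnP => k _; apply.
apply/existsP; exists [ffun K => Ordinal (colm (val K) (valP K))].
apply/forallP => K; apply/forallP => L; apply/implyP => /andP[KL meet].
rewrite !ffunE -val_eqE/=; apply: colP; rewrite ?(valP K) ?(valP L)//.
Qed.

(** The cliques through a vertex pairwise intersect. *)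
Lemma max_degree_le_chromatic_index P : (max_degree P <= chromatic_index P)%N.
Proof.
rewrite /chromatic_index; case: ex_minnP => k /existsP[f /forallP fP] _.
apply/bigmax_leqP => v _.
pose g (K : {K : {set T} | K \in P}) := f K.
pose Pv := [set K : {K : {set T} | K \in P} | v \in val K].
have -> : #|[set K in P | v \in K]| = #|Pv|.
  rewrite -[RHS](card_imset _ val_inj); apply: eq_card => K; rewrite inE.
  apply/andP/imsetP => [[KP vK]|[K' + ->]]; first by exists (exist _ K KP); rewrite ?inE.
  by rewrite inE => vK; split=> //; exact: valP.
rewrite -[k in (_ <= k)%N]card_ord -(card_in_imset (f := g)); first exact: max_card.
move=> K L; rewrite !inE => vK vL fKL; apply/eqP; apply: contraT => KL.
have /forallP/(_ L)/implyP := fP K; rewrite KL /= -/(g K) -/(g L) fKL eqxx; apply.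
by apply/pred0Pn; exists v; rewrite /= vK.
Qed.

(** The number of conflicts counts [K] itself, whence [m] colours and not [m.+1]. *)
Lemma greedy_colouring P (m : nat) :
  (forall K, K \in P -> K != set0 /\ (#|[set L in P | ~~ [disjoint K & L]]| <= m)%N) ->
  exists col : {set T} -> nat, (forall K, K \in P -> (col K < m)%N) /\
  (forall K L, K \in P -> L \in P -> K != L -> ~~ [disjoint K & L] -> col K != col L).
Proof.
have [s] := ubnP #|P|; elim: s P => // s IH P Ps hP.
have [->|/set0Pn[K KP]] := eqVneq P set0.
  by exists (fun=> 0%N); split=> [K|K L]; rewrite inE.
have P'P : P :\ K \subset P by exact: subD1set.
have [|L /(subsetP P'P) LP|col [colm colP]] := IH (P :\ K).
- by move: Ps; rewrite (cardsD1 K) KP.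
- have [L0 Lm] := hP L LP; split=> //; apply: leq_trans Lm; apply/subset_leq_card/subsetP => L'.
  by rewrite !inE => /andP[/andP[_ ->] ->].
have [/set0Pn[x xK] Km] := hP K KP.
pose used := [seq col L | L <- enum [set L in P :\ K | ~~ [disjoint K & L]]].
have used_small : (size used < m)%N.
  apply: leq_trans Km; rewrite size_map -cardE [leqRHS](cardsD1 K) inE KP/=.
  rewrite (_ : ~~ [disjoint K & K]) ?add1n ?ltnS; last by apply/pred0Pn; exists x; rewrite /= xK.
  by apply/subset_leq_card/subsetP => L; rewrite !inE andbA.
have [c cm cused] : exists2 c, (c < m)%N & c \notin used.
  have [/allP h|/allPn[c]] := boolP (all [in used] (iota 0 m)).
    by have := uniq_leq_size (iota_uniq 0 m) h; rewrite size_iota leqNgt used_small.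
  by rewrite mem_iota add0n => /= cm cn; exists c.
have usedP L : L \in P -> K != L -> ~~ [disjoint K & L] -> col L != c.
  move=> LP KL meet; apply: contraNneq cused => <-; apply: map_f.
  by rewrite mem_enum !inE eq_sym KL LP.
exists (fun L => if L == K then c else col L); split=> [L LP|L L' LP LP' LL' meet].
  by case: eqP => // /eqP LK; apply: colm; rewrite !inE LK.
case: (eqVneq L K) => [LK|LK]; case: (eqVneq L' K) => [LK'|LK'].
- by rewrite LK LK' eqxx in LL'.
- by rewrite eq_sym; apply: usedP; rewrite -?LK.
- by apply: usedP; rewrite -?LK' 1?eq_sym// disjoint_sym.
- by apply: colP => //; rewrite !inE ?LK ?LK'.
Qed.

Lemma greedy_edge_colouring (F : {set {set T}}) (D : nat) : F \subset vertex_pairs T ->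
  (forall v, #|[set e in F | v \in e]| <= D)%N ->
  exists col : {set T} -> nat, (forall K, K \in F -> (col K < 2 * D)%N) /\
  (forall K L, K \in F -> L \in F -> K != L -> ~~ [disjoint K & L] -> col K != col L).
Proof.
move=> FV FD; apply: greedy_colouring => e eF.
have /vertex_pairsP[x [y [xy exy]]] := subsetP FV e eF; split.
  by rewrite exy; apply/set0Pn; exists x; rewrite !inE eqxx.
apply: leq_trans (_ : #|[set f in F | x \in f] :|: [set f in F | y \in f]| <= _)%N.
  apply/subset_leq_card/subsetP => f; rewrite !inE => /andP[-> /pred0Pn[z/=]]/=.
  by rewrite exy !inE => /andP[/orP[]/eqP -> ->]; rewrite ?orbT.
apply: leq_trans (leq_of_leqif (leq_card_setU _ _)) _.
by rewrite mul2n -addnn leq_add.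
Qed.

Lemma card_edges_le (F : {set {set T}}) (D : nat) : F \subset vertex_pairs T ->
  (forall v, #|[set e in F | v \in e]| <= D)%N -> (2 * #|F| <= #|T| * D)%N.
Proof.
move=> FV FD; apply: (@leq_trans (\sum_(v : T) #|[set e in F | v \in e]|)); last first.
  by rewrite -sum_nat_const; apply: leq_sum.
have -> : (\sum_(v : T) #|[set e in F | v \in e]| = \sum_(e in F) #|e|)%N.
  under eq_bigr => v _ do rewrite -sum1_card big_mkcond.
  rewrite exchange_big/= [RHS]big_mkcond; apply: eq_bigr => e _.
  rewrite -[in RHS]sum1_card [in RHS]big_mkcond/=.
  have [eF|eF] := boolP (e \in F); first by apply: eq_bigr => v _; rewrite inE eF.
  by rewrite big1// => v _; rewrite inE (negbTE eF).
rewrite mulnC -sum_nat_const; apply: leq_sum => e eF.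
by have := subsetP FV e eF; rewrite inE => /eqP ->.
Qed.

(** Edge-disjoint cliques use up [k * k.-1 / 2] edges each. *)
Lemma card_cliques_le (H P : {set {set T}}) (k : nat) : H \subset vertex_pairs T ->
  (forall K, K \in P -> clique H K && (#|K| == k)) ->
  (forall e, e \in H -> (#|[set K in P | e \subset K]| <= 1)%N) ->
  (#|P| * (k * k.-1) <= 2 * #|H|)%N.
Proof.
move=> HV Pk P1; have bin k' : (k' * k'.-1 = 2 * 'C(k', 2))%N by rewrite -mul_bin_diag bin1.
rewrite bin mulnCA leq_mul2l/=.
apply: (@leq_trans (\sum_(K in P) #|pairs_in K|)).
  rewrite -sum_nat_const; apply: leq_sum => K /Pk/andP[_ /eqP <-].
  rewrite -cards_draws; apply/subset_leq_card/subsetP => e.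
  by rewrite !inE => /andP[-> ->].
have -> : (\sum_(K in P) #|pairs_in K| = \sum_(e in H) #|[set K in P | e \subset K]|)%N.
  under [RHS]eq_bigr => v _ do rewrite -sum1_card big_mkcond.
  rewrite [RHS]exchange_big/= [LHS]big_mkcond; apply: eq_bigr => K _.
  have [KP|KP] := boolP (K \in P); last first.
    by rewrite big1// => e _; rewrite inE (negbTE KP).
  have /andP[cK _] := Pk K KP; rewrite -sum1_card [LHS]big_mkcond [RHS]big_mkcond.
  apply: eq_bigr => e _; have [eH|eH] := boolP (e \in H); rewrite !inE ?KP/=.
    by have := subsetP HV e eH; rewrite inE => ->.
  case: ifP => // /andP[e2 eK]; have := subsetP (clique_pairs_in cK) e.
  by rewrite (negbTE eH) !inE e2 eK => /(_ isT).
rewrite -[leqRHS]muln1 -sum_nat_const; exact: leq_sum.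
Qed.

End EdgeColouring.

Section PartialPartition.
Variables (T : finType) (E : {set {set T}}).
Hypothesis EV : E \subset vertex_pairs T.
Implicit Types (H F P : {set {set T}}) (K L : {set T}).

(** The invariant of the successive phases: [H] is the graph on which the next phase
    works and [F] collects the dumped edges.  Asking for more than two
    vertices separates the cliques of [P] from the edges that are added at the very end. *)
Definition partial_partition (kmax : nat) H F P (col : {set T} -> nat) (c : nat) : Prop :=
  [/\ H \subset E /\ F \subset E,
      forall K, K \in P -> [&& clique E K, (2 < #|K|)%N & (#|K| <= kmax)%N],
      forall e, e \in E -> ((e \in H) + (e \in F) + #|[set K in P | e \subset K]| = 1)%N,
      forall K, K \in P -> (col K < c)%N &
      forall K L, K \in P -> L \in P -> K != L -> ~~ [disjoint K & L] -> col K != col L].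

Lemma partial_partition_init kmax : partial_partition kmax E set0 set0 (fun=> 0%N) 0.
Proof.
split=> [|K|e eE|K|K L]; rewrite ?inE//; first by rewrite subxx sub0set.
rewrite eE; apply/eqP; rewrite addn0 -[1%N]addn0 eqn_add2l cards_eq0 -subset0.
by apply/subsetP => K; rewrite !inE.
Qed.

Lemma partial_partition_extend kmax H F P col c k M H' F' P' col' :
  partial_partition kmax H F P col c -> (2 < k)%N -> (k <= kmax)%N ->
  H' \subset H -> F' \subset H ->
  (forall K, K \in P' -> clique H K && (#|K| == k)) ->
  (forall e, e \in H -> ((e \in H') + (e \in F') + #|[set K in P' | e \subset K]| = 1)%N) ->
  (forall K, K \in P' -> (col' K < M)%N) ->
  (forall K L, K \in P' -> L \in P' -> K != L -> ~~ [disjoint K & L] -> col' K != col' L) ->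
  partial_partition kmax H' (F :|: F') (P :|: P')
    (fun K => if K \in P then col K else (c + col' K)%N) (c + M).
Proof.
move=> [[HE FE] Pc cov colc colP] k2 kk H'H F'H P'c cov' colM colP'.
have PP' K : K \in P' -> K \notin P.
  move=> KP'; apply/negP => KP; have /andP[/cliqueP cK /eqP Kk] := P'c K KP'.
  have /card_gt1P[x [y [xK yK xy]]] : (1 < #|K|)%N by rewrite Kk ltnW.
  have xyH := cK x y xK yK xy; have := cov _ (subsetP HE _ xyH).
  rewrite xyH -addnA add1n => -[/eqP]; rewrite addn_eq0 cards_eq0.
  move=> /andP[_ /eqP/setP/(_ K)]; rewrite !inE KP subUset !sub1set xK yK//.
split.
- by rewrite (subset_trans H'H)// subUset FE (subset_trans F'H).
- move=> K; rewrite in_setU => /orP[/Pc //|/P'c/andP[cK /eqP ->]].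
  by rewrite k2 kk (clique_subE HE cK).
- move=> e eE; have cE := cov e eE.
  have split_count : #|[set K in P :|: P' | e \subset K]| =
      (#|[set K in P | e \subset K]| + #|[set K in P' | e \subset K]|)%N.
    rewrite -[LHS](cardsID P); congr (_ + _)%N; apply: eq_card => K; rewrite !inE.
      by case: (K \in P); rewrite ?andbT ?andbF.
    have [KP'|KP'] := boolP (K \in P'); first by rewrite (PP' K KP') orbT.
    by case: (K \in P); rewrite ?andbF.
  rewrite split_count in_setU; have [eH|eH] := boolP (e \in H).
    rewrite eH in cE; have [-> ->] : (e \in F) = false /\ #|[set K in P | e \subset K]| = 0%N.
      by move: cE; case: (e \in F) => //; rewrite addn0 add1n => -[].
    by rewrite add0n/= cov'.
  rewrite (negbTE eH) in cE.
  have -> : (e \in H') = false by apply: contraNF eH => /(subsetP H'H).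
  have -> : (e \in F') = false by apply: contraNF eH => /(subsetP F'H).
  have -> : #|[set K in P' | e \subset K]| = 0%N; last by rewrite orbF addn0.
  apply/eqP; rewrite cards_eq0 -subset0; apply/subsetP => K; rewrite !inE => /andP[KP' eK].
  have /andP[cK _] := P'c K KP'; case/negP : eH; apply: (subsetP (clique_pairs_in cK)).
  by have := subsetP EV e eE; rewrite !inE eK andbT.
- move=> K; rewrite in_setU; case: ifP => [KP _|KP /= KP'].
    by apply: leq_trans (colc K KP) _; exact: leq_addr.
  by rewrite ltn_add2l colM.
- move=> K L; rewrite !in_setU; case: ifP => KP; case: ifP => LP /= KP' LP' KL meet.
  + exact: colP.
  + by rewrite neq_ltn (leq_trans (colc K KP))// leq_addr.
  + by rewrite neq_ltn [X in _ || X](leq_trans (colc L LP)) ?orbT// leq_addr.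
  + by rewrite eqn_add2l; apply: colP'.
Qed.

Lemma partial_partition_complete kmax H F P col c D :
  partial_partition kmax H F P col c ->
  (forall v, #|[set e in H :|: F | v \in e]| <= D)%N -> (2 <= kmax)%N ->
  exists P' : {set {set T}}, [/\ clique_partition E P', (\max_(K in P') #|K| <= kmax)%N,
    (#|P'| <= #|P| + #|T| * D)%N & (chromatic_index P' <= c + 2 * D)%N].
Proof.
move=> [[HE FE] Pc cov colc colP] degD kmax2.
have RE : H :|: F \subset E by rewrite subUset HE.
have RV : H :|: F \subset vertex_pairs T := subset_trans RE EV.
have [gcol [gm gP]] := greedy_edge_colouring RV degD.
have R2 K : K \in H :|: F -> #|K| = 2%N by move/(subsetP RV); rewrite inE => /eqP.
have PR K : K \in P -> K \notin H :|: F.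
  by move=> /Pc/and3P[_ K3 _]; apply/negP => /R2 K2; rewrite K2 in K3.
exists (P :|: (H :|: F)); split.
- apply/andP; split.
    apply/forallP => K; apply/implyP; rewrite in_setU => /orP[/Pc/and3P[]//|KR].
    apply/cliqueP => x y xK yK xy.
    rewrite (_ : [set x; y] = K) ?(subsetP RE)//; apply/eqP.
    by rewrite eqEcard subUset !sub1set xK yK R2// cards2 xy.
  apply/forallP => e; apply/implyP => eE; rewrite -(cov e eE).
  have e2 : #|e| = 2%N by have := subsetP EV e eE; rewrite inE => /eqP.
  rewrite -(cardsID P) addnC; apply/eqP; congr (_ + _)%N.
    have -> : [set K in P :|: (H :|: F) | e \subset K] :\: P = [set K in H :|: F | K == e].
      apply/setP => K; rewrite !inE; have [KR|KR] := boolP ((K \in H) || (K \in F)).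
        have KR' : K \in H :|: F by rewrite inE.
        rewrite orbT/=; have [KP|_/=] := boolP (K \in P).
          by have := PR K KP; rewrite KR'.
        by rewrite eq_sym eqEcard (R2 K KR') e2 leqnn andbT.
      by rewrite orbF; case: (K \in P); rewrite ?andbF.
    have := cov e eE; have [eH|eH] := boolP (e \in H); have [eF|eF] := boolP (e \in F) => /= h.
    + by move: h; rewrite addSn => -[].
    + by rewrite ?addn0 ?add0n -(cards1 e); apply: eq_card => K; rewrite !inE; case: eqP => [->|]; rewrite ?eH ?andbF.
    + by rewrite ?addn0 ?add0n -(cards1 e); apply: eq_card => K; rewrite !inE; case: eqP => [->|]; rewrite ?eF ?orbT ?andbF.
    + apply/eqP; rewrite cards_eq0 -subset0; apply/subsetP => K; rewrite !inE.
      by case: eqP => [->|]; rewrite ?(negbTE eH) ?(negbTE eF) ?andbF.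
  by apply: eq_card => K; rewrite !inE; case: (K \in P); rewrite ?andbF ?andbT.
- apply/bigmax_leqP => K; rewrite in_setU => /orP[/Pc/and3P[]//|/R2 ->//].
- apply: leq_trans (leq_of_leqif (leq_card_setU _ _)) _; rewrite leq_add2l.
  have := card_edges_le RV degD; lia.
- pose col2 K := if K \in P then col K else (c + gcol K)%N.
  apply: (@chromatic_index_le _ _ col2); rewrite /col2.
    move=> K; rewrite in_setU; case: ifP => [KP _|KP /= KR].
      by apply: leq_trans (colc K KP) _; exact: leq_addr.
    by rewrite ltn_add2l gm.
  move=> K L; rewrite !(in_setU _ P); case: ifP => KP; case: ifP => LP /= KP' LP' KL meet.
  + exact: colP.
  + by rewrite neq_ltn (leq_trans (colc K KP))// leq_addr.
  + by rewrite neq_ltn [X in _ || X](leq_trans (colc L LP)) ?orbT// leq_addr.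
  + by rewrite eqn_add2l; apply: gP.
Qed.

End PartialPartition.

(** * The schedule of the phases *)

(** Here [p] is [expR (- l)], and the two largeness hypotheses on [L] imply all the
    comparisons between powers of [L] and powers of [n] that are needed. *)
Section Schedule.
Variables (R : realType) (n : nat) (gamma l : R).
Let L : R := ln n%:R.
Hypotheses (n0 : (0 < n)%N) (gamma0 : 0 < gamma) (gamma1 : gamma < 1).
Hypotheses (L_large : 1000 <= L) (L_dom : 1000 * L ^+ 5 <= gamma ^+ 2 * expR (L / 200)).
Hypotheses (l_lo : gamma <= l) (l_up : l <= L / 200).
Let N : R := n%:R.
Let p : R := expR (- l).
Let U : R := expR (L / 200).

Definition density (i : nat) : R := expR (- (l + i%:R)).
(** This is [- ln (density i.+1)], so that cliques of size at most
    [L / (10 * clique_cost i)] keep the common neighbourhoods of their vertices above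
    [n ^ (9 / 10)] up to the end of phase [i]. *)
Definition clique_cost (i : nat) : R := 1 + i%:R + l.
Definition clique_size (i : nat) : nat := Num.trunc (L / (10 * clique_cost i)).
Definition colours (i : nat) : nat := (Num.trunc (N * density i / ((clique_size i)%:R - 1))).+1.
Definition error (i : nat) : R := i.+1%:R * expR (- (L / 8)).
Definition phases : nat := Num.trunc (L / 200).
Let eps : R := expR (- (L / 4)).
Let lam : R := expR (- (L / 2)).
Let Lam : R := 4 * L ^+ 2.
Let Y : R := expR (4 / 5 * L).
Let tau : R := expR (- (L / 5)).

Let L1 : 1 <= L. Proof. by have := L_large; lra. Qed.
Let L0 : 0 < L. Proof. by have := L_large; lra. Qed.
Let l0 : 0 < l. Proof. exact: lt_le_trans l_lo. Qed.
Let NE : N = expR L. Proof. by rewrite lnK// posrE ltr0n. Qed.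
Let U_dom : 1000 * L ^+ 5 <= U.
Proof.
apply: (le_trans L_dom); rewrite ler_piMl ?expR_ge0// exprn_ile1 ?(ltW gamma0) ?(ltW gamma1)//.
Qed.

Let poly (a : R) (m : nat) : a <= 1000 -> (m <= 5)%N -> a * L ^+ m <= U.
Proof.
move=> a1 m5; apply: le_trans U_dom; apply: (@le_trans _ _ (1000 * L ^+ m)).
  by rewrite ler_wpM2r// exprn_ge0// ltW.
by apply: ler_wpM2l; [exact: ler0n|exact: ler_weXn2l].
Qed.

Let poly_expR (a x : R) (m : nat) : a <= 1000 -> (m <= 5)%N -> L / 200 <= x -> a * L ^+ m <= expR x.
Proof. by move=> a1 m5 Lx; apply: (le_trans (poly a1 m5)); rewrite ler_expR. Qed.

Let L_expR (x : R) : L / 200 <= x -> L <= expR x.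
Proof.
by move=> Lx; have := @poly_expR 1 x 1; rewrite mul1r expr1; apply => //; lra.
Qed.

Let phases_le : phases%:R <= L / 200.
Proof. by rewrite truncn_le divr_ge0 ?ler0n// ltW. Qed.

Let cost_gt0 i : 0 < clique_cost i.
Proof. by rewrite /clique_cost ltr_wpDl// addr_ge0. Qed.

Let cost_le i : (i <= phases)%N -> clique_cost i <= L / 50.
Proof.
rewrite -(ler_nat R) => h; have := le_trans h phases_le.
by rewrite /clique_cost; have := l_up; have := L_large; lra.
Qed.

Let size_ratio_ge5 i : (i <= phases)%N -> 5 <= L / (10 * clique_cost i).
Proof.
move=> /cost_le h; rewrite ler_pdivlMr ?mulr_gt0//; lra.
Qed.

Let size_le_ratio i : (clique_size i)%:R <= L / (10 * clique_cost i).
Proof. by rewrite truncn_le divr_ge0 ?mulr_ge0 ?(ltW L0) ?(ltW (cost_gt0 _)). Qed.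

Let size_gt_ratio i : L / (10 * clique_cost i) < (clique_size i)%:R + 1.
Proof. by rewrite natr1 truncnS_gt. Qed.

Let size_ge5 i : (i <= phases)%N -> (5 <= clique_size i)%N.
Proof.
by move=> /size_ratio_ge5 h; rewrite truncn_ge_nat// (le_trans _ h).
Qed.

Let size_m1_ge i : (i <= phases)%N -> L / (10 * clique_cost i) / 2 <= (clique_size i)%:R - 1.
Proof. by move=> /size_ratio_ge5; have := size_gt_ratio i; lra. Qed.

Let size_m1_gt0 i : (i <= phases)%N -> 0 < (clique_size i)%:R - 1 :> R.
Proof. by move=> h; apply: lt_le_trans (size_m1_ge h); rewrite !divr_gt0 ?mulr_gt0. Qed.

Let size_cost i : (clique_size i)%:R * clique_cost i <= L / 10.
Proof.
have := size_le_ratio i; rewrite ler_pdivlMr ?mulr_gt0//; lra.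
Qed.

Let size_le i : (clique_size i)%:R <= L / 10.
Proof.
apply: le_trans (size_cost i); rewrite ler_peMr// /clique_cost -addrA lerDl addr_ge0// ltW//.
Qed.

Let size_anti i : (clique_size i.+1 <= clique_size i)%N.
Proof.
apply: le_truncn; rewrite ler_pM2l// lef_pV2 ?posrE ?mulr_gt0//.
by rewrite ler_pM2l// /clique_cost lerD2r lerD2l ler_nat.
Qed.

Let density_gt0 i : 0 < density i. Proof. exact: expR_gt0. Qed.

Let density_le_p i : density i <= p.
Proof. by rewrite ler_expR lerN2 lerDl. Qed.

Let density_next i : density i / expR 1 = density i.+1.
Proof. by rewrite /density -expRN -expRD -natr1; congr expR; ring. Qed.

Let nominal_ge i j : (j <= clique_size i)%N -> expR (9 / 10 * L) <= N * density i ^+ j.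
Proof.
move=> jk; rewrite NE /density -expRM_natl -expRD ler_expR.
have : j%:R <= (clique_size i)%:R :> R by rewrite ler_nat.
move=> jk'; have := size_cost i; rewrite /clique_cost.
have : j%:R * (l + i%:R) <= (clique_size i)%:R * (1 + i%:R + l).
  have h := l0; have h2 : 0 <= i%:R :> R by [].
  apply: ler_pM => //; first by rewrite addr_ge0// ltW.
  by lra.
lra.
Qed.

Let nominal_ge' i j : (j <= clique_size i)%N -> Y <= N * density i ^+ j.
Proof.
by move=> /nominal_ge; apply: le_trans; rewrite ler_expR; have := L0; lra.
Qed.

Let Nd_ge i : (i <= phases)%N -> expR (9 / 10 * L) <= N * density i.
Proof.
move=> ip; have := @nominal_ge i 1; rewrite expr1; apply.
exact: leq_trans (size_ge5 ip).
Qed.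

Let colours_ge i : N * density i / ((clique_size i)%:R - 1) <= (colours i)%:R.
Proof. exact/ltW/truncnS_gt. Qed.

Let colours_enough i : (i <= phases)%N ->
  N * density i <= ((clique_size i)%:R - 1) * (colours i)%:R.
Proof. by move=> ip; rewrite -ler_pdivrMl ?size_m1_gt0// mulrC colours_ge. Qed.

Let Y_colours i : (i <= phases)%N -> Y <= (colours i)%:R.
Proof.
move=> ip; apply: le_trans (colours_ge i); rewrite ler_pdivlMr ?size_m1_gt0//.
apply: le_trans (Nd_ge ip); apply: (@le_trans _ _ (Y * expR (L / 10))).
  rewrite ler_wpM2l ?expR_ge0//; have hL : L <= expR (L / 10).
    by apply: L_expR; have := L0; lra.
  by have := size_le i; have := L0; lra.
rewrite -expRD ler_expR; lra.
Qed.

Let eps_size i : 8 * eps * (clique_size i)%:R <= expR (- (6 / 25 * L)).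
Proof.
have h := size_le i; apply: (@le_trans _ _ (eps * (1 * L ^+ 1))).
  rewrite mul1r expr1 mulrAC [leRHS]mulrC ler_wpM2r ?expR_ge0//.
  by have := L0; lra.
apply: (@le_trans _ _ (eps * U)).
  by rewrite ler_wpM2l ?expR_ge0// poly//; lra.
by rewrite -expRD ler_expR; have := L0; lra.
Qed.

Let eps_size_small i : 8 * eps * (clique_size i)%:R <= 1.
Proof.
apply: (le_trans (eps_size i)); rewrite -[leRHS]expR0 ler_expR; have := L0; lra.
Qed.

Let slack i : tau + 8 * eps * (clique_size i)%:R <= expR (- (L / 8)).
Proof.
have two (x : R) : x + L / 200 <= - (L / 8) -> 2 * expR x <= expR (- (L / 8)).
  move=> h; apply: (@le_trans _ _ (expR (x + L / 200))); last by rewrite ler_expR.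
  rewrite expRD [leRHS]mulrC ler_wpM2r ?expR_ge0//.
  by have := @poly 2 0; rewrite expr0 mulr1; apply => //; lra.
have h1 := eps_size i.
have h2 : 2 * tau <= expR (- (L / 8)) by apply: two; have := L0; lra.
have h3 : 2 * expR (- (6 / 25 * L)) <= expR (- (L / 8)) by apply: two; have := L0; lra.
lra.
Qed.

Let error_ge0 i : 0 <= error i. Proof. by rewrite mulr_ge0 ?expR_ge0. Qed.

Let error_small i : (i <= phases)%N -> 4 * error i <= 1.
Proof.
rewrite -(ler_nat R) => h; have h' := le_trans h phases_le.
apply: (@le_trans _ _ (U * expR (- (L / 8)))).
  rewrite mulrA ler_wpM2r ?expR_ge0//; have := @poly 4 1; rewrite expr1 => q.
  apply: le_trans (q _ _) => //; last by lra.
  by rewrite -natr1; have := L_large; lra.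
by rewrite -expRD -[leRHS]expR0 ler_expR; have := L0; lra.
Qed.

Let error_next i : error i.+1 = error i + expR (- (L / 8)).
Proof. by rewrite /error -natr1 mulrDl mul1r. Qed.

Let theta_up i : (i < phases)%N ->
  (1 + error i + tau) * expR (2 * eps * (clique_size i)%:R) <= 1 + error i.+1.
Proof.
move=> ip; set y := 2 * eps * _.
have y0 : 0 <= y by rewrite !mulr_ge0 ?expR_ge0.
have y8 : 4 * y <= 1 by have := eps_size_small i; rewrite /y; lra.
have ey : expR y <= 1 + 2 * y.
  by apply: le_trans (expR_le_quadratic y0 _) _; [lra|nra].
have e1 := error_small (ltnW ip); have e0 := error_ge0 i.
have t0 : 0 <= tau := expR_ge0 _.
have := slack i; rewrite error_next => sl.
have t1 : tau <= 1 / 4.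
  have := error_small (leq0n phases); rewrite /error mul1r.
  have : 0 <= 8 * eps * (clique_size i)%:R by rewrite !mulr_ge0 ?expR_ge0.
  lra.
apply: (@le_trans _ _ ((1 + error i + tau) * (1 + 2 * y))).
  by rewrite ler_wpM2l// !addr_ge0.
have {sl} : tau + 4 * y <= expR (- (L / 8)) by rewrite /y; lra.
move: (error i) (expR (- (L / 8))) tau e1 e0 t0 t1 => e ex t e1 e0 t0 t1 h.
have : y * (e + t) <= y * 1 by rewrite ler_wpM2l//; lra.
lra.
Qed.

Let theta_lo i : (i < phases)%N ->
  1 - error i.+1 <= (1 - error i - tau) * expR (- (4 * eps * (clique_size i)%:R)).
Proof.
move=> ip; set y := 4 * eps * _.
have y0 : 0 <= y by rewrite !mulr_ge0 ?expR_ge0.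
have e1 := error_small (ltnW ip); have e0 := error_ge0 i.
have t0 : 0 <= tau := expR_ge0 _.
have := slack i; rewrite error_next => sl.
have t1 : tau <= 1 / 4.
  have := error_small (leq0n phases); rewrite /error mul1r.
  have : 0 <= 8 * eps * (clique_size i)%:R by rewrite !mulr_ge0 ?expR_ge0.
  lra.
apply: (@le_trans _ _ ((1 - error i - tau) * (1 - y))); last first.
  by rewrite ler_wpM2l ?onem_le_expR//; lra.
have {sl} : tau + y <= expR (- (L / 8)) by rewrite /y in y0 *; lra.
move: (error i) (expR (- (L / 8))) tau e1 e0 t0 t1 => e ex t e1 e0 t0 t1 h.
have : 0 <= y * (e + t) by rewrite mulr_ge0// addr_ge0.
lra.
Qed.

Let size_le_L i : (clique_size i)%:R <= L.
Proof. by have := size_le i; have := L0; lra. Qed.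

Let lam_small i : (i <= phases)%N ->
  lam * expR ((clique_size i)%:R + 4 * eps * (clique_size i)%:R) * (clique_size i).+1%:R <= eps.
Proof.
move=> ip; have hy : 4 * eps * (clique_size i)%:R <= L / 200.
  have := eps_size_small i; have : 0 <= eps * (clique_size i)%:R by rewrite mulr_ge0 ?expR_ge0.
  by have := L_large; lra.
have hk : (clique_size i).+1%:R <= U.
  apply: le_trans (poly _ _ : 2 * L ^+ 1 <= U) => //; last by lra.
  by rewrite expr1 -natr1; have := size_le_L i; have := L1; lra.
apply: (@le_trans _ _ (lam * expR (L / 10 + L / 200) * U)).
  apply: ler_pM => //; first by rewrite mulr_ge0 ?expR_ge0.
  by rewrite ler_wpM2l ?expR_ge0// ler_expR lerD// size_le.
by rewrite -!expRD ler_expR; have := L0; lra.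
Qed.

Let kappa_small i : (clique_size i)%:R * ((clique_size i)%:R * expR 5 / Y) <= eps.
Proof.
have k2 : (clique_size i)%:R * (clique_size i)%:R <= U.
  apply: le_trans (poly _ _ : 1 * L ^+ 2 <= U) => //; last by lra.
  by rewrite mul1r expr2 ler_pM// size_le_L.
have e5 : expR 5 <= U by rewrite ler_expR; have := L_large; lra.
rewrite !mulrA -mulrA; apply: (@le_trans _ _ (U * (U * Y^-1))).
  apply: ler_pM; rewrite ?mulr_ge0 ?expR_ge0 ?invr_ge0 ?expR_ge0//.
  by apply: ler_wpM2r => //; rewrite invr_ge0 expR_ge0.
by rewrite -expRN -!expRD ler_expR; have := L0; lra.
Qed.

Let N_large : 1000 <= N.
Proof. by rewrite NE; apply: le_trans L_large _; apply: L_expR; have := L0; lra. Qed.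

Let colours_le i : (i <= phases)%N -> (colours i <= n)%N.
Proof.
move=> ip; rewrite /colours -(ler_nat R) -natr1.
have k4 : 4 <= (clique_size i)%:R - 1 :> R.
  by have := size_ge5 ip; rewrite -(ler_nat R); lra.
apply: (@le_trans _ _ (N * density i / ((clique_size i)%:R - 1) + 1)).
  by rewrite lerD2r truncn_le divr_ge0 ?mulr_ge0 ?expR_ge0//; lra.
have d1 : density i <= 1.
  by rewrite -[leRHS]expR0 ler_expR oppr_le0 addr_ge0// ltW.
have : N * density i / ((clique_size i)%:R - 1) <= N / 4.
  rewrite ler_pdivrMr; last by lra.
  have : N * density i <= N by rewrite ler_piMr.
  have := N_large; set K := _ - 1 in k4 *; move=> h1 h2; nra.
by have := N_large; rewrite -/N; lra.
Qed.

Let tests_few i : (i <= phases)%N -> (5 * (n + colours i).+1 ^ clique_size i)%:R <= expR Lam.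
Proof.
move=> ip; rewrite natrM natrX.
have h3 : (n + colours i).+1%:R <= expR (2 * L).
  apply: (@le_trans _ _ (3 * N)).
    have : ((n + colours i).+1 <= 3 * n)%N by have := colours_le ip; have := n0; clear; lia.
    by rewrite -(ler_nat R) natrM.
  rewrite (_ : 2 * L = L + L); last by ring.
  rewrite expRD NE ler_wpM2r ?expR_ge0//.
  apply: (@le_trans _ _ L); first by have := L_large; lra.
  by apply: L_expR; have := L0; lra.
have h5 : 5 <= expR L.
  apply: (@le_trans _ _ L); first by have := L_large; lra.
  by apply: L_expR; have := L0; lra.
apply: (@le_trans _ _ (expR L * expR (2 * L) ^+ clique_size i)).
  by apply: ler_pM => //; rewrite lerXn2r ?nnegrE ?expR_ge0.
rewrite -expRM_natl -expRD ler_expR /Lam.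
have := size_le_L i; have := L1; move: (clique_size i)%:R L => k x x1 kx; nra.
Qed.

Let tau_big : Lam <= tau * lam * Y.
Proof.
rewrite -!expRD; apply: poly_expR => //; first by lra.
by have := L0; lra.
Qed.

(** All the numerical conditions of a phase hold because [k <= L / 10], while [eps], [lam],
    [tau] and [Y] are powers of [n] with the exponents [- 1 / 4], [- 1 / 2], [- 1 / 5] and
    [4 / 5]. *)
Lemma scheduled_phase i (H : {set {set 'I_n}}) : (i < phases)%N ->
  H \subset vertex_pairs 'I_n -> typical H (clique_size i) (density i) (error i) ->
  exists (H' F P : {set {set 'I_n}}) (col : {set 'I_n} -> nat),
  [/\ [/\ H' \subset H, F \subset H & typical H' (clique_size i) (density i.+1) (error i.+1)],
      forall K, K \in P -> clique H K && (#|K| == clique_size i),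
      forall e, e \in H -> ((e \in H') + (e \in F) + #|[set K in P | e \subset K]| = 1)%N,
      (forall K, K \in P -> (col K < colours i)%N) /\
      (forall K K', K \in P -> K' \in P -> K != K' -> ~~ [disjoint K & K'] -> col K != col K') &
      forall v, 2 ^+ #|[set e in F | v \in e]| <=
        expR (Lam + 4 * (clique_size i)%:R * error i.+1 * (N * density i))].
Proof.
move=> ip HV Htyp; have ip' := ltnW ip.
have k3 : (3 <= clique_size i)%N by apply: leq_trans (size_ge5 ip').
have cn : #|'I_n|%:R = N by rewrite card_ord.
have Cn : (0 < #|'I_n|)%N by rewrite card_ord.
have Y0 : 0 < Y := expR_gt0 _.
have lam0 : 0 < lam := expR_gt0 _.
have tau0 : 0 <= tau := expR_ge0 _.
have err12 : 2 * error i.+1 <= 1 by have := error_small ip; have := error_ge0 i.+1; lra.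
have eps0 : 0 < eps := expR_gt0 _.
have eps4 : 4 * eps <= 1.
  have := eps_size_small i; have : 1 <= (clique_size i)%:R :> R by rewrite ler1n (leq_trans _ k3).
  have := eps0; move: eps (clique_size i)%:R => e k; nra.
have := @phase R _ (colours i) H (clique_size i) (density i) (error i) (error i.+1) tau eps lam Lam Y
  HV Cn isT k3 (density_gt0 i).
rewrite !cn -density_next card_ord.
move=> /(_ (colours_enough ip') Htyp Y0 lam0 (error_ge0 i) tau0 (error_ge0 _) err12 eps0 eps4).
move=> /(_ (@nominal_ge' i) (Y_colours ip') (tests_few ip') tau_big (theta_up ip) (theta_lo ip)).
by move=> /(_ (lam_small ip') (kappa_small i)).
Qed.

Let growth (i : nat) : R := \sum_(j < i) (2 / 3) ^+ j.

Let growth_le i : growth i <= 3.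
Proof.
have -> : growth i = 3 * (1 - (2 / 3) ^+ i).
  elim: i => [|i IH]; rewrite /growth; first by rewrite big_ord0 expr0 subrr mulr0.
  by rewrite big_ord_recr/= -/(growth i) IH exprS; field.
have : 0 <= (2 / 3) ^+ i :> R by rewrite exprn_ge0.
lra.
Qed.

Let growth_next i : growth i.+1 = growth i + (2 / 3) ^+ i.
Proof. by rewrite /growth big_ord_recr. Qed.

(** The factor [(2 / 3) ^+ i] makes the costs of all the phases summable. *)
Let density_cost i : density i * clique_cost i ^+ 2 <= 16 * (p * (1 + l) ^+ 2) * (2 / 3) ^+ i.
Proof.
have cost : clique_cost i <= (1 + i%:R) * (1 + l).
  rewrite /clique_cost; have := mulr_ge0 (ler0n R i) (ltW l0); lra.
have e4 : 1 + i%:R <= 4 * expR (i%:R / 4) :> R.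
  by have := expR_ge1Dx (i%:R / 4 : R); have := ler0n R i; lra.
have e2 : expR (- (1 / 2)) <= 2 / 3 :> R.
  rewrite expRN invf_ple ?posrE ?expR_gt0//; apply: le_trans (expR_ge1Dx _).
  by rewrite invf_div; lra.
have h1 : clique_cost i ^+ 2 <= 16 * expR (i%:R / 2) * (1 + l) ^+ 2.
  have l1 : 0 <= 1 + l by rewrite addr_ge0// ltW.
  apply: (@le_trans _ _ ((4 * expR (i%:R / 4) * (1 + l)) ^+ 2)).
    rewrite lerXn2r ?nnegrE ?(ltW (cost_gt0 _)) ?mulr_ge0 ?expR_ge0//.
    by apply: (le_trans cost); rewrite ler_wpM2r.
  rewrite !exprMn -expRM_natl (_ : 2 * (i%:R / 4) = i%:R / 2); last by field.
  by rewrite le_eqVlt; apply/orP; left; apply/eqP; ring.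
have h2 : density i * expR (i%:R / 2) <= p * (2 / 3) ^+ i.
  apply: (@le_trans _ _ (p * expR (- (1 / 2)) ^+ i)).
    by rewrite -expRM_natl -!expRD ler_expR; lra.
  by rewrite ler_wpM2l ?expR_ge0// lerXn2r ?nnegrE ?expR_ge0.
apply: (le_trans (ler_wpM2l (ltW (density_gt0 i)) h1)).
have l2 : 0 <= 16 * (1 + l) ^+ 2 by rewrite mulr_ge0// exprn_ge0// addr_ge0// ltW.
have := ler_wpM2l l2 h2; move: (expR (i%:R / 2)) ((2 / 3) ^+ i) => u v; lra.
Qed.

Let density_cost1 i : density i * clique_cost i <= 16 * (p * (1 + l)) * (2 / 3) ^+ i.
Proof.
have l1 : 0 < 1 + l by rewrite addr_gt0.
rewrite -(ler_pM2r l1); apply: le_trans (_ : density i * clique_cost i ^+ 2 <= _); last first.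
  by have := density_cost i; rewrite expr2; lra.
rewrite -mulrA ler_wpM2l ?expR_ge0// expr2 ler_wpM2l ?(ltW (cost_gt0 i))//.
by rewrite /clique_cost; have := ler0n R i; lra.
Qed.

Let a : R := 640 * (N * p * (1 + l) / L).
Let b : R := 12800 * (N ^+ 2 * p * (1 + l) ^+ 2 / L ^+ 2).
Let z : R := 8 * L ^+ 2 + 8 * L ^+ 2 * expR (- (L / 8)) * (N * p).

Let colours_growth i : (i <= phases)%N -> (colours i)%:R <= a * (2 / 3) ^+ i.
Proof.
move=> ip; rewrite /colours -natr1; have k1 := size_m1_gt0 ip; have := size_m1_ge ip.
set K := (clique_size i)%:R - 1 in k1 *; have r0 := cost_gt0 i => hK.
have q0 : 0 <= N * density i / K by rewrite divr_ge0 ?mulr_ge0 ?expR_ge0// ltW.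
have q1 : 1 <= N * density i / K.
  rewrite ler_pdivlMr// mul1r; apply: le_trans (Nd_ge ip).
  apply: (@le_trans _ _ L); first by have := size_le i; have := L0; rewrite /K; lra.
  by apply: L_expR; have := L0; lra.
apply: (@le_trans _ _ (2 * (N * density i / K))).
  have : (Num.trunc (N * density i / K))%:R <= N * density i / K by rewrite truncn_le.
  lra.
rewrite mulrA ler_pdivrMr//.
have g0 : 0 <= (2 / 3) ^+ i :> R by rewrite exprn_ge0.
have a0 : 0 <= a.
  apply: mulr_ge0; first exact: ler0n.
  by rewrite !mulr_ge0 ?invr_ge0 ?expR_ge0 ?addr_ge0 ?(ltW l0) ?(ltW L0).
apply: le_trans (ler_wpM2l (mulr_ge0 a0 g0) hK).
have -> : a * (2 / 3) ^+ i * (L / (10 * clique_cost i) / 2) =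
    2 * N * (16 * (p * (1 + l)) * (2 / 3) ^+ i) / clique_cost i.
  by rewrite /a; field; rewrite gt_eqF//= gt_eqF.
rewrite ler_pdivlMr// (_ : _ * clique_cost i = 2 * N * (density i * clique_cost i)); last by ring.
by rewrite ler_wpM2l ?density_cost1// mulr_ge0.
Qed.

Lemma typical_degree (H : {set {set 'I_n}}) (k : nat) (d theta : R) v : H \subset vertex_pairs 'I_n ->
  (0 < k)%N -> 0 <= d -> theta <= 1 -> typical H k d theta ->
  #|[set e in H | v \in e]|%:R <= 2 * (N * d).
Proof.
move=> HV k0 d0 t1 /typicalP/(_ [set v]); rewrite cards1 card_ord expr1 => /(_ k0)/andP[_ up].
apply: le_trans (_ : #|common_nbrs H [set v] setT|%:R <= _).
  rewrite ler_nat; have := card_edges_at setT v HV; rewrite inE mul1n; apply: leq_trans.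
  by apply/subset_leq_card/subsetP => e; rewrite !inE subsetT.
apply: (le_trans up); rewrite ler_wpM2r ?mulr_ge0//; lra.
Qed.

Let cliques_growth i (H P : {set {set 'I_n}}) : (i <= phases)%N -> H \subset vertex_pairs 'I_n ->
  typical H (clique_size i) (density i) (error i) ->
  (forall K, K \in P -> clique H K && (#|K| == clique_size i)) ->
  (forall e, e \in H -> (#|[set K in P | e \subset K]| <= 1)%N) ->
  #|P|%:R <= b * (2 / 3) ^+ i.
Proof.
move=> ip HV Htyp Pk P1; have k5 := size_ge5 ip.
have d0 : 0 <= density i := expR_ge0 _.
have deg v : (#|[set e in H | v \in e]| <= Num.trunc (2 * (N * density i)))%N.
  rewrite truncn_ge_nat ?mulr_ge0//; apply: (typical_degree v HV _ d0 _ Htyp).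
    exact: leq_trans k5.
  by have := error_small ip; have := error_ge0 i; lra.
have := leq_trans (card_cliques_le HV Pk P1) (card_edges_le HV deg).
rewrite card_ord -(ler_nat R) !natrM -subn1 natrB ?(leq_trans _ k5)// => h.
have {}h : #|P|%:R * ((clique_size i)%:R * ((clique_size i)%:R - 1)) <= N * (2 * (N * density i)).
  by apply: (le_trans h); rewrite ler_wpM2l// truncn_le !mulr_ge0.
have hK := size_m1_ge ip; have k1 := size_m1_gt0 ip; have r0 := cost_gt0 i.
set x := L / (10 * clique_cost i) / 2 in hK.
have x0 : 0 < x by rewrite !divr_gt0 ?mulr_gt0.
have hx : #|P|%:R * x ^+ 2 <= N * (2 * (N * density i)).
  apply: le_trans h; rewrite ler_wpM2l// expr2 ler_pM ?(ltW x0)//; lra.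
have -> : b * (2 / 3) ^+ i = 2 * N ^+ 2 * (16 * (p * (1 + l) ^+ 2) * (2 / 3) ^+ i) / clique_cost i ^+ 2 / x ^+ 2.
  by rewrite /b /x; field; rewrite !gt_eqF.
rewrite ler_pdivlMr ?exprn_gt0//; apply: (le_trans hx).
rewrite ler_pdivlMr ?exprn_gt0//.
have := ler_wpM2l (mulr_ge0 (ler0n R 2) (exprn_ge0 2 (ler0n R n))) (density_cost i).
rewrite -/N; lra.
Qed.

Let dumps_growth i (m : nat) : (i < phases)%N ->
  2 ^+ m <= expR (Lam + 4 * (clique_size i)%:R * error i.+1 * (N * density i)) -> m%:R <= z.
Proof.
move=> ip h; have e2 : expR (1 / 2) <= 2 :> R.
  by apply: le_trans (expR_le_quadratic _ _) _; lra.
have {}h : m%:R * (1 / 2) <= Lam + 4 * (clique_size i)%:R * error i.+1 * (N * density i).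
  rewrite -ler_expR expRM_natl; apply: le_trans h.
  by rewrite lerXn2r ?nnegrE ?expR_ge0.
have Np : N * density i <= N * p by rewrite ler_wpM2l// density_le_p.
have ke : (clique_size i)%:R * error i.+1 <= L ^+ 2 * expR (- (L / 8)).
  rewrite /error mulrA ler_wpM2r ?expR_ge0// expr2 ler_pM ?size_le_L//.
  have : i.+1%:R <= phases%:R :> R by rewrite ler_nat.
  by rewrite -[i.+2%:R]natr1; have := phases_le; have := L_large; lra.
have ke0 : 0 <= (clique_size i)%:R * error i.+1 by rewrite mulr_ge0.
have : (clique_size i)%:R * error i.+1 * (N * density i) <= L ^+ 2 * expR (- (L / 8)) * (N * p).
  by apply: ler_pM => //; rewrite mulr_ge0 ?expR_ge0.
rewrite /z; rewrite /Lam in h; lra.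
Qed.

Let kmax : nat := Num.trunc (L / l).

Let size_le_kmax i : (clique_size i <= kmax)%N.
Proof.
apply: le_truncn; rewrite ler_pM2l// lef_pV2 ?posrE ?mulr_gt0//.
by rewrite /clique_cost; have := ler0n R i; have := l0; lra.
Qed.

(** The mean sizes are at least [n ^ (9 / 10)] and the tested sets fewer than [expR (2 * L ^ 2)]. *)
Lemma typical_whp :
  1 - harmonic n <= gnp_prob p (fun E : {set {set 'I_n}} => typical E (clique_size 0) p (error 0)).
Proof.
have p0 : 0 <= p := expR_ge0 _.
have p1 : p <= 1 by rewrite -[leRHS]expR0 ler_expR oppr_le0 ltW.
have e0 : 0 < error 0 by rewrite /error mul1r expR_gt0.
have e1 : error 0 <= 1 by have := error_small (leq0n phases); lra.
have hY j : (j <= clique_size 0)%N -> expR (9 / 10 * L) <= n%:R * p ^+ j.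
  by move=> /nominal_ge; rewrite /density addr0.
apply: le_trans (gnp_typical p0 p1 e0 e1 hY); rewrite lerD2l lerN2.
have n1 : n.+1%:R <= expR (2 * L).
  rewrite (_ : 2 * L = L + L); last by ring.
  rewrite expRD -NE -natr1 -/N; have := N_large; nra.
have two : 2 <= expR L.
  by apply: (@le_trans _ _ L); [have := L_large; lra|apply: L_expR; have := L0; lra].
have kL := size_le_L 0.
have tail : 125 * L ^+ 2 <= expR (9 / 10 * L) * error 0 ^+ 2 / 8.
  rewrite /error mul1r -expRM_natl -expRD; have : 1000 * L ^+ 2 <= expR (9 / 10 * L + 2 * - (L / 8)).
    by apply: poly_expR => //; have := L0; lra.
  lra.
apply: (@le_trans _ _ (expR L * expR (2 * L) ^+ clique_size 0 * expR (L - 125 * L ^+ 2))).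
  apply: ler_pM; rewrite ?mulr_ge0 ?exprn_ge0 ?expR_ge0//.
    by apply: ler_pM; rewrite ?exprn_ge0// lerXn2r ?nnegrE ?expR_ge0.
  by rewrite ler_expR lerB.
rewrite -expRM_natl -!expRD; apply: (@le_trans _ _ (expR (- (2 * L)))).
  rewrite ler_expR; have := L_large.
  move: (clique_size 0)%:R kL => k kL L1000.
  have : k * L <= L * L by rewrite ler_wpM2r// ltW.
  have : 1000 * L <= L * L by rewrite ler_wpM2r// ltW.
  rewrite expr2; lra.
by rewrite /harmonic expRN lef_pV2 ?posrE ?expR_gt0.
Qed.

Variable E : {set {set 'I_n}}.
Hypotheses (EV : E \subset vertex_pairs 'I_n) (Etyp : typical E (clique_size 0) p (error 0)).

Let phases_iterated i : (i <= phases)%N ->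
  exists (H F P : {set {set 'I_n}}) (col : {set 'I_n} -> nat) (c : nat),
  [/\ partial_partition E kmax H F P col c,
      typical H (clique_size i) (density i) (error i),
      forall v, #|[set e in F | v \in e]|%:R <= i%:R * z,
      #|P|%:R <= b * growth i & c%:R <= a * growth i].
Proof.
elim: i => [_|i IH ip].
  exists E, set0, set0, (fun=> 0%N), 0%N; split.
  - exact: partial_partition_init.
  - by rewrite /density addr0.
  - move=> v; rewrite mul0r -[leRHS]/(0%:R) ler_nat leqn0 cards_eq0 -subset0.
    by apply/subsetP => e; rewrite !inE.
  - by rewrite cards0 /growth big_ord0 mulr0.
  - by rewrite /growth big_ord0 mulr0.
have [H [F [P [col [c [part Htyp Fdeg Pb cb]]]]]] := IH (ltnW ip).
have HV : H \subset vertex_pairs 'I_n by case: part => -[HE _] _ _ _ _; exact: subset_trans HE EV.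
have [H' [F' [P' [col' [[H'H F'H H'typ] P'k cov' [colM colP] F'deg]]]]] := scheduled_phase ip HV Htyp.
have P'1 e : e \in H -> (#|[set K in P' | e \subset K]| <= 1)%N.
  by move=> /cov' <-; rewrite leq_addl.
exists H', (F :|: F'), (P :|: P'), (fun K => if K \in P then col K else (c + col' K)%N), (c + colours i)%N.
split.
- apply: (partial_partition_extend EV part _ (size_le_kmax i) H'H F'H P'k cov' colM colP).
  by apply: leq_trans (size_ge5 (ltnW ip)).
- apply/typicalP => A Ak; apply: (typicalP _ _ _ _ H'typ).
  exact: leq_trans Ak (size_anti i).
- move=> v; rewrite -natr1 mulrDl mul1r.
  apply: le_trans (lerD (Fdeg v) (dumps_growth ip (F'deg v))); rewrite -natrD ler_nat.
  apply: leq_trans (leq_of_leqif (leq_card_setU _ _)); apply/subset_leq_card/subsetP => e.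
  by rewrite !inE => /andP[/orP[->|->] ->]; rewrite ?orbT.
- rewrite growth_next mulrDr; apply: le_trans (lerD Pb (cliques_growth (ltnW ip) HV Htyp P'k P'1)).
  by rewrite -natrD ler_nat (leq_of_leqif (leq_card_setU _ _)).
- by rewrite growth_next mulrDr natrD lerD// colours_growth// ltnW.
Qed.

Let log_ratio : R := L / l.
Let BB : R := (3 * 12800) * (1 + gamma^-1) ^+ 2 + 1.
Let CC : R := (3 * 640) * (1 + gamma^-1) + 2.

Let Np_gt0 : 0 < N * p. Proof. by rewrite mulr_gt0 ?expR_gt0 ?ltr0n. Qed.

Let p_cost : 1 + l <= l * (1 + gamma^-1).
Proof.
have g0 := gamma0; have : 1 <= l * gamma^-1 by rewrite ler_pdivlMr// mul1r.
by rewrite mulrDr mulr1; lra.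
Qed.

(** The degrees of the edges left after the last phase, or dumped during the phases, are
    smaller than [n * p] by a power of [n], and so by any power of [L]. *)
Let rest_degree (m : nat) : m%:R <= 2 * (N * density phases) + phases%:R * z ->
  m%:R <= N * p * (l / L) ^+ 2.
Proof.
move=> /le_trans; apply.
have g2 : (gamma / L) ^+ 2 <= (l / L) ^+ 2.
  rewrite lerXn2r ?nnegrE ?divr_ge0 ?(ltW gamma0) ?(ltW l0) ?(ltW L0)//.
  by rewrite ler_wpM2r// invr_ge0 ltW.
apply: le_trans (ler_wpM2l (ltW Np_gt0) g2).
set G := (gamma / L) ^+ 2.
have GU : 1000 * L ^+ 3 <= G * U.
  have -> : G * U = gamma ^+ 2 * U / L ^+ 2 by rewrite /G expr_div_n mulrAC.
  rewrite ler_pdivlMr ?exprn_gt0//; apply: le_trans L_dom.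
  by rewrite -mulrA -exprD.
have U0 : 0 < U := expR_gt0 _.
have L33 : 1 <= L ^+ 3 by rewrite exprn_ege1.
have hI : expR (- phases%:R) <= 4 * U^-1.
  have e4 : expR 1 <= 4 :> R.
    have e2 : expR (1 / 2) <= 2 :> R.
      by apply: le_trans (expR_le_quadratic _ _) _; lra.
    have -> : (1 : R) = 2%:R * (1 / 2) by field.
    rewrite expRM_natl; apply: (@le_trans _ _ (2 ^+ 2)); last by lra.
    by rewrite lerXn2r ?nnegrE ?expR_ge0.
  apply: (@le_trans _ _ (expR 1 * U^-1)); last by rewrite ler_wpM2r// invr_ge0 ltW.
  rewrite -expRN -expRD ler_expR; have := truncnS_gt (L / 200); rewrite -/phases -natr1; lra.
have h1 : 2 * (N * density phases) <= (1 / 100) * (N * p) * G.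
  have -> : density phases = p * expR (- phases%:R) by rewrite -expRD /density; congr expR; ring.
  have : expR (- phases%:R) <= (1 / 200) * G.
    apply: (le_trans hI); rewrite ler_pdivrMr//; lra.
  move=> /(ler_wpM2l (ltW Np_gt0)); lra.
have h8 : 8 * L ^+ 2 <= L ^+ 3 by rewrite [leRHS]exprSr mulrC ler_wpM2l ?exprn_ge0 ?(ltW L0)//; have := L_large; lra.
have pl : phases%:R <= L / 200 := phases_le.
have h2 : phases%:R * (8 * L ^+ 2) <= (1 / 100) * (N * p) * G.
  apply: (@le_trans _ _ (8 * L ^+ 3 / 200)).
    have -> : 8 * L ^+ 3 / 200 = L / 200 * (8 * L ^+ 2) by ring.
    by rewrite ler_wpM2r// mulr_ge0// exprn_ge0// ltW.
  have NpU : U <= N * p.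
    by rewrite NE -expRD ler_expR; have := l_up; have := L0; lra.
  have : G * U <= G * (N * p) by rewrite ler_wpM2l// exprn_ge0// divr_ge0 ?(ltW gamma0) ?(ltW L0).
  lra.
have h3 : phases%:R * (8 * L ^+ 2 * expR (- (L / 8)) * (N * p)) <= (1 / 100) * (N * p) * G.
  have eU : expR (- (L / 8)) <= U^-1 by rewrite -expRN ler_expR; have := L0; lra.
  have : 8 * L ^+ 3 / 200 * expR (- (L / 8)) <= (1 / 100) * G.
    apply: (@le_trans _ _ (8 * L ^+ 3 / 200 / U)).
      by apply: ler_wpM2l => //; apply: divr_ge0; rewrite ?mulr_ge0 ?exprn_ge0 ?ler0n ?(ltW L0).
    rewrite ler_pdivrMr//; lra.
  move=> /(ler_wpM2l (ltW Np_gt0)) h.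
  apply: (@le_trans _ _ (L / 200 * (8 * L ^+ 2 * expR (- (L / 8)) * (N * p)))).
    by rewrite ler_wpM2r// !mulr_ge0 ?exprn_ge0 ?expR_ge0 ?(ltW L0).
  by move: h; rewrite exprSr; lra.
have G0 : 0 <= N * p * G by rewrite mulr_ge0 ?(ltW Np_gt0)// exprn_ge0// divr_ge0 ?(ltW gamma0) ?(ltW L0).
rewrite /z mulrDr; lra.
Qed.

(** The cost of the phases is a convergent series; dividing by [gamma] replaces [1 + l] by [l]. *)
Lemma good_partition : exists P : {set {set 'I_n}}, [/\ clique_partition E P,
  (\max_(K in P) #|K|)%N%:R <= log_ratio,
  #|P|%:R <= BB * (N ^+ 2 * p / log_ratio ^+ 2) &
  (chromatic_index P)%:R <= CC * (N * p / log_ratio)].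
Proof.
have [H [F [P [col [c [part Htyp Fdeg Pb cb]]]]]] := phases_iterated (leqnn phases).
have [[HE _] _ _ _ _] := part.
have HV : H \subset vertex_pairs 'I_n := subset_trans HE EV.
pose D := Num.trunc (2 * (N * density phases) + phases%:R * z).
have L0' := L0; have l0' := l0.
have z0 : 0 <= z by rewrite addr_ge0 ?mulr_ge0 ?expR_ge0 ?exprn_ge0 ?(ltW L0).
have D0 : 0 <= 2 * (N * density phases) + phases%:R * z by rewrite addr_ge0 ?mulr_ge0 ?expR_ge0.
have degD v : (#|[set e in H :|: F | v \in e]| <= D)%N.
  rewrite truncn_ge_nat//; apply: (@le_trans _ _ (#|[set e in H | v \in e]|%:R + #|[set e in F | v \in e]|%:R)).
    rewrite -natrD ler_nat; apply: leq_trans (leq_of_leqif (leq_card_setU _ _)).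
    apply/subset_leq_card/subsetP => e.
    by rewrite !inE => /andP[/orP[->|->] ->]; rewrite ?orbT.
  apply: lerD; last exact: Fdeg.
  apply: (typical_degree v HV _ (expR_ge0 _) _ Htyp); first exact: leq_trans (size_ge5 (leqnn _)).
  by have := error_small (leqnn phases); have := error_ge0 phases; lra.
have kmax2 : (2 <= kmax)%N by apply: leq_trans (size_le_kmax phases); apply: leq_trans (size_ge5 (leqnn _)).
have [P' [P'part P'max P'card P'chi]] := partial_partition_complete EV part degD kmax2.
have ratio0 : 0 < log_ratio by rewrite divr_gt0.
have DR : D%:R <= N * p * (l / L) ^+ 2 by apply: rest_degree; rewrite truncn_le.
have lL : l / L <= 1 by rewrite ler_pdivrMr// mul1r; have := l_up; lra.
have lL0 : 0 <= l / L by rewrite divr_ge0 ?(ltW l0') ?(ltW L0').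
have il : log_ratio^-1 = l / L by rewrite /log_ratio invf_div.
have c1 : (1 + l) / L <= (1 + gamma^-1) * (l / L).
  by rewrite mulrA ler_wpM2r ?invr_ge0 ?(ltW L0')// [leRHS]mulrC p_cost.
have c0 : 0 <= (1 + l) / L by rewrite divr_ge0 ?(ltW L0')// addr_ge0// ltW.
have Np := ltW Np_gt0.
exists P'; split => //.
- apply: (@le_trans _ _ kmax%:R); first by rewrite ler_nat.
  by rewrite truncn_le ltW.
- apply: (@le_trans _ _ (b * 3 + N * (N * p * (l / L) ^+ 2))).
    apply: (@le_trans _ _ (#|P|%:R + N * D%:R)).
      by move: P'card; rewrite card_ord -(ler_nat R) natrD natrM.
    apply: lerD; last by rewrite ler_wpM2l.
    apply: (le_trans Pb); rewrite ler_wpM2l ?growth_le//.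
    apply: mulr_ge0; first exact: ler0n.
    by rewrite !mulr_ge0 ?invr_ge0 ?exprn_ge0 ?expR_ge0 ?addr_ge0 ?(ltW l0') ?(ltW L0').
  rewrite /BB -exprVn il.
  have sq : ((1 + l) / L) ^+ 2 <= (1 + gamma^-1) ^+ 2 * (l / L) ^+ 2.
    by rewrite -exprMn lerXn2r ?nnegrE// (le_trans c0).
  have -> : b * 3 = (3 * 12800) * (N * (N * p)) * ((1 + l) / L) ^+ 2.
    by rewrite /b expr_div_n; field; rewrite gt_eqF.
  have h0 : 0 <= (3 * 12800) * (N * (N * p)).
    by apply: mulr_ge0; [apply: mulr_ge0; exact: ler0n|exact: mulr_ge0].
  have := ler_wpM2l h0 sq; move: (12800 : R) ((1 + gamma^-1) ^+ 2) ((l / L) ^+ 2) => cst u v; lra.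
- apply: (@le_trans _ _ (a * 3 + 2 * (N * p * (l / L) ^+ 2))).
    apply: (@le_trans _ _ (c%:R + 2 * D%:R)).
      by move: P'chi; rewrite -(ler_nat R) natrD natrM.
    apply: lerD; last by rewrite ler_wpM2l.
    apply: (le_trans cb); rewrite ler_wpM2l ?growth_le//.
    apply: mulr_ge0; first exact: ler0n.
    by rewrite !mulr_ge0 ?invr_ge0 ?expR_ge0 ?addr_ge0 ?(ltW l0') ?(ltW L0').
  rewrite /CC il.
  have -> : a * 3 = (3 * 640) * (N * p) * ((1 + l) / L) by rewrite /a; field; rewrite gt_eqF.
  have h0 : 0 <= (3 * 640) * (N * p) by apply: mulr_ge0; [apply: mulr_ge0; exact: ler0n|].
  have h1 := ler_wpM2l h0 c1.
  have h2 : N * p * (l / L) ^+ 2 <= N * p * (l / L).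
    by rewrite ler_wpM2l// expr2 ler_piMl.
  move: (640 : R) (gamma^-1) (l / L) h1 h2 {lL lL0 il c1 c0 DR h0} => cst u v; lra.
Qed.

End Schedule.

(** * The theorem *)

Lemma gnp_prob_sub (R : realType) (n : nat) (p : R) (P Q : pred {set {set 'I_n}}) :
  0 <= p -> p <= 1 -> (forall E : {set {set 'I_n}}, E \subset vertex_pairs 'I_n -> P E -> Q E) ->
  gnp_prob p P <= gnp_prob p Q.
Proof.
move=> p0 p1 PQ; rewrite !gnp_probE; apply: gnp_expect_le => // E EV.
by case PE: (P E); rewrite ?(PQ _ EV PE)//; case: (Q E).
Qed.

Lemma gnp_prob_le1 (R : realType) (n : nat) (p : R) (P : pred {set {set 'I_n}}) :
  0 <= p -> p <= 1 -> gnp_prob p P <= 1.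
Proof.
move=> p0 p1; rewrite gnp_probE -[leRHS](gnp_expect1 n p); apply: gnp_expect_le => // E _.
by case: (P E).
Qed.

Local Open Scope classical_set_scope.

Lemma near_ln_ge (R : realType) (r : R) : \forall n \near \oo, (0 < n)%N /\ r <= ln n%:R.
Proof.
near=> n.
have rn : expR r <= n%:R by near: n; exact: nbhs_infty_ger.
have n0 : (0 < n)%N by rewrite -(ltr0n R) (lt_le_trans (expR_gt0 r)).
by split; rewrite // -ler_expR lnK ?posrE ?ltr0n.
Unshelve. all: by end_near. Qed.

Lemma near_power_le_expR (R : realType) (a b c : R) : 0 < a -> 0 < b -> 0 < c ->
  \forall n \near \oo, a * ln n%:R ^+ 5 <= c * expR (6%:R * (ln n%:R / b)).
Proof.
move=> a0 b0 c0; near=> n.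
have [n0 abc] : (0 < n)%N /\ a * b ^+ 6 / c <= ln n%:R by near: n; exact: near_ln_ge.
set L := ln n%:R in abc *.
have L0 : 0 <= L by apply: le_trans abc; rewrite divr_ge0 ?mulr_ge0 ?exprn_ge0 ?ltW.
have : (L / b) ^+ 6 <= expR (6%:R * (L / b)).
  have Lb : 0 <= L / b by rewrite divr_ge0// ltW.
  rewrite expRM_natl lerXn2r ?nnegrE ?expR_ge0//.
  by apply: le_trans (expR_ge1Dx _); rewrite lerDr.
move=> /(ler_wpM2l (ltW c0)); apply: le_trans.
rewrite expr_div_n [leRHS]mulrA ler_pdivlMr ?exprn_gt0// [L ^+ 6]exprSr.
rewrite ler_pdivrMr// in abc; have := ler_wpM2l (exprn_ge0 5 L0) abc.
move: (b ^+ 6) (L ^+ 5) => u v; lra.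
Unshelve. all: by end_near. Qed.

Theorem theorem7 (R : realType) :
  exists2 alpha : R, 0 < alpha &
  forall gamma : R, 0 < gamma < 1 ->
  exists B C : R, [/\ 0 < B, 0 < C &
  forall p : nat -> R,
    (\forall n \near \oo, n%:R `^ (- alpha) <= p n <= 1 - gamma) ->
    (fun n : nat => gnp_prob (p n) (fun E : {set {set 'I_n}} =>
       [exists P : {set {set 'I_n}},
         [&& clique_partition E P,
             (\max_(K in P) #|K|)%N%:R <= log_base (p n)^-1 n%:R,
             #|P|%:R <= B * (n%:R ^+ 2 * p n / log_base (p n)^-1 n%:R ^+ 2),
             (max_degree P <= chromatic_index P)%N
           & (chromatic_index P)%:R <= C * (n%:R * p n / log_base (p n)^-1 n%:R)]]))
      @ \oo --> (1 : R)].
Proof.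
(* With this exponent [- ln p <= ln n / 200], which leaves room for cliques of at least 5
   vertices in every phase. *)
exists (1 / 200); first by rewrite divr_gt0 ?ltr0n.
move=> gamma /andP[g0 g1].
have gi : 0 < gamma^-1 by rewrite invr_gt0.
exists ((3 * 12800) * (1 + gamma^-1) ^+ 2 + 1), ((3 * 640) * (1 + gamma^-1) + 2); split.
- apply: ltr_wpDl; last exact: ltr01.
  apply: mulr_ge0; first by apply: mulr_ge0; exact: ler0n.
  by apply: exprn_ge0; apply: addr_ge0; [exact: ler01|exact: ltW].
- apply: ltr_wpDl; last exact: ltr0n.
  apply: mulr_ge0; first by apply: mulr_ge0; exact: ler0n.
  by apply: addr_ge0; [exact: ler01|exact: ltW].
move=> p hp.
apply: (@squeeze_cvgr _ _ _ _ (fun n => 1 - harmonic n) (fun=> 1)); last exact: cvg_cst.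
  near=> n.
  have /andP[plo pup] : n%:R `^ (- (1 / 200)) <= p n <= 1 - gamma by near: n.
  have [n0 L_large L_dom] : [/\ (0 < n)%N, 1000 <= ln n%:R :> R &
     1000 * ln n%:R ^+ 5 <= gamma ^+ 2 * expR (ln n%:R / 200) :> R].
    have [n0 L_large] : (0 < n)%N /\ 1000 <= ln n%:R :> R by near: n; exact: near_ln_ge.
    split; [exact: n0|exact: L_large|].
    rewrite (_ : ln n%:R / 200 = 6%:R * (ln n%:R / 1200)); last by field.
    near: n; apply: near_power_le_expR; [exact: ltr0n|exact: ltr0n|exact: exprn_gt0].
  have nR : 0 < n%:R :> R by rewrite ltr0n.
  have p0 : 0 < p n by apply: lt_le_trans plo; exact: powR_gt0.
  have p1 : p n <= 1 by apply: (le_trans pup); rewrite gerBl ltW.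
  pose l := - ln (p n).
  have pE : p n = expR (- l) by rewrite /l opprK lnK.
  have l_lo : gamma <= l.
    rewrite /l lerNr -ler_expR lnK//; exact: le_trans pup (onem_le_expR _).
  have l_up : l <= ln n%:R / 200.
    rewrite /l lerNl -ler_expR lnK//; apply: le_trans plo.
    rewrite /powR (gt_eqF nR) ler_expR; lra.
  have logE : log_base (p n)^-1 n%:R = ln n%:R / l by rewrite /log_base lnV.
  apply/andP; split; last by apply: gnp_prob_le1 => //; exact: ltW.
  have := typical_whp n0 g0 g1 L_large L_dom l_lo; rewrite -pE => /le_trans; apply.
  apply: gnp_prob_sub => //; first exact: ltW.
  move=> E EV Etyp; rewrite pE in Etyp.
  have [P [Ppart Pmax Pcard Pchi]] := good_partition n0 g0 g1 L_large L_dom l_lo l_up EV Etyp.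
  apply/existsP; exists P; rewrite Ppart logE Pmax max_degree_le_chromatic_index/=.
  by rewrite pE Pcard.
rewrite -[X in _ --> X]subr0; apply: cvgB; [exact: cvg_cst|exact: cvg_harmonic].
Unshelve. all: by end_near. Qed.
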